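(* Let $\Sigma$ be a compact Riemann surface of genus $g\ge 2$ with an anti-holomorphic involution $f$, and let $(E,\Phi)$ be a stable $SL(2,\mathbb{C})$-Higgs bundle on $\Sigma$ which is a fixed point of the induced action of $f$ and has smooth spectral curve $p:S\to\Sigma$ given by $\eta^2=q$, where $q\in H^0(\Sigma,K^2)$ has only simple zeros and $f^*(\overline{q})=q$. Let $K^{1/2}$ be an $f$-invariant theta characteristic and $L\in\mathrm{Prym}(S,\Sigma)$ the line bundle with $E=p_*(L\otimes p^*(K^{1/2}))$. Suppose $q$ has a zero fixed by $f$. Then there exists a lift $\tilde{\tau}:L\to L$ of $\tau$ to a holomorphic anti-linear map with $\tilde{\tau}\circ\tilde{\tau}=1$. In this case $E$ has a real structure, i.e. there is a holomorphic anti-linear isomorphism $\phi:E\to E$ covering $f$ with $\phi^{-1}\circ\Phi\circ\phi=-\Phi$ and $\phi^2=1$.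
   Context: $K$ is the canonical bundle of $\Sigma$. An $SL(2,\mathbb{C})$-Higgs bundle is a pair $(E,\Phi)$ with $E$ a rank $2$ holomorphic bundle with trivial determinant and $\Phi$ a trace-free holomorphic section of $\mathrm{End}(E)\otimes K$. The induced action of $f$ on isomorphism classes is $(E,\Phi)\mapsto(f^*(\overline{E}^* ),f^*(\overline{\Phi^t}))$. An anti-linear bundle isomorphism $\phi$ covering $f$ extends to form-valued sections by $\phi(\omega\otimes s)=f^*(\overline{\omega})\otimes\phi(s)$, and is holomorphic if it sends holomorphic sections to holomorphic sections. The spectral curve is $S=\{(\eta,z)\in K\mid\eta^2=q(z)\}$, a smooth double cover of $\Sigma$ in the total space of $K$, with tautological section $\eta$ of $p^*K$. $\mathrm{Prym}(S,\Sigma)$ is the group of line bundles $M$ on $S$ with $\sigma^*M\simeq M^*$, where $\sigma:S\to S$ exchanges the sheets. An $f$-invariant theta characteristic is a holomorphic line bundle $K^{1/2}$ with $(K^{1/2})^2\simeq K$ and $f^*(\overline{K}^{1/2})\simeq K^{1/2}$ (these exist). The Higgs bundle is recovered as $E=p_*(L\otimes p^*(K^{1/2}))$ with $\Phi$ the pushforward of $\eta:L\otimes p^*(K^{1/2})\to L\otimes p^*(K^{3/2})$. The map $\tilde{f}:S\to S$ is the restriction of the anti-holomorphic lift of $f$ to $K$ sending $y\in K_x$ to $f^*(\overline{y})\in K_{f(x)}$; since $(E,\Phi)$ is fixed by $f$, $\tilde{f}^*(\overline{L})\simeq L^*$. Put $\tau=\tilde{f}\sigma$, an anti-holomorphic involution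 of $S$; then $\tau^*(\overline{L})\simeq L$. *)

(* Defs.v *)
(* Complex manifolds and bundles are presented by raw data (charts, transition
   matrices) together with separate predicates asserting the axioms, so that
   constructions such as dual, tensor product and pull-back are plain terms. *)
From HB Require Import structures.
From mathcomp Require Import all_boot all_order all_algebra.
From mathcomp Require Import complex.
From mathcomp Require Import all_classical all_reals.
From mathcomp Require Import topology normedtype derive.

Set Implicit Arguments.
Unset Strict Implicit.
Unset Printing Implicit Defensive.

Import Order.TTheory GRing.Theory Num.Theory.
Import numFieldNormedType.Exports.

Local Open Scope classical_set_scope.
Local Open Scope ring_scope.

(* The complex numbers, as a type carrying the norm topology and hence the
   complex notions [derivable] and [derive1]. *)
Definition cplx (R : realType) : numClosedFieldType := R[i].

Record surface (R : realType) := Surface {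
  points :> topologicalType;
  chart : Type;
  cdom : chart -> set points;
  cfwd : chart -> points -> cplx R;
  cbwd : chart -> cplx R -> points }.

Definition riemann_surface (R : realType) (X : surface R) : Prop :=
  [/\ hausdorff_space X,
      forall x : X, exists c : chart X, cdom c x,
      forall c : chart X, [/\ open (cdom c), open (cfwd c @` cdom c),
        forall x, cdom c x -> cbwd c (cfwd c x) = x,
        forall x, cdom c x -> {for x, continuous (cfwd c)} &
        forall x, cdom c x -> {for cfwd c x, continuous (cbwd c)}] &
      forall (c c' : chart X) x, cdom c x -> cdom c' x ->
        derivable (fun z : cplx R => cfwd c' (cbwd c z) : cplx R) (cfwd c x) 1].

Definition hol_fun (R : realType) (X : surface R) (U : set X)
    (h : X -> cplx R) : Prop :=
  forall (c : chart X) x, U x -> cdom c x ->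
    derivable (fun z : cplx R => h (cbwd c z) : cplx R) (cfwd c x) 1.

Definition hol_map (R : realType) (X Y : surface R) (h : X -> Y) : Prop :=
  continuous h /\
  forall c : chart Y, hol_fun (h @^-1` cdom c) (fun x => cfwd c (h x)).

Definition antihol_map (R : realType) (X Y : surface R) (h : X -> Y) : Prop :=
  continuous h /\
  forall c : chart Y, hol_fun (h @^-1` cdom c) (fun x => (cfwd c (h x))^*).

(* Holomorphic vector bundles, given by transition matrices: a section has
    coordinates [s_i] over [bdom i], related by [s_i = (btrans i j) s_j]. *)

Record bundle (R : realType) (X : surface R) (r : nat) := Bundle {
  bidx : Type;
  bdom : bidx -> set X;
  btrans : bidx -> bidx -> X -> 'M[cplx R]_r }.

Definition hol_bundle (R : realType) (X : surface R) r (E : bundle X r) : Prop :=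
  [/\ forall i : bidx E, open (bdom i),
      forall x : X, exists i : bidx E, bdom i x,
      forall (i j : bidx E) k l,
        hol_fun (bdom i `&` bdom j) (fun x => btrans i j x k l),
      forall (i : bidx E) x, bdom i x -> btrans i i x = 1%:M &
      forall (i j k : bidx E) x, bdom i x -> bdom j x -> bdom k x ->
        btrans i k x = btrans i j x *m btrans j k x].

(* The fibre at [x]: compatible families of coordinate vectors.  Coordinates
   in frames not defined at [x] are set to 0 so that equality is the right one. *)
Definition fiber_pred (R : realType) (X : surface R) r (E : bundle X r) (x : X) :
    {pred bidx E -> 'cV[cplx R]_r} :=
  fun v => `[< (forall i, ~ bdom i x -> v i = 0) /\
    (forall i j, bdom i x -> bdom j x -> v i = btrans i j x *m v j) >].

Arguments fiber_pred {R X r} E x.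

Lemma fiber_predP (R : realType) (X : surface R) r (E : bundle X r) (x : X) v :
  reflect ((forall i, ~ bdom i x -> v i = 0) /\
    (forall i j, bdom i x -> bdom j x -> v i = btrans i j x *m v j))
  (v \in fiber_pred E x).
Proof. exact: asboolP. Qed.

Arguments fiber_predP {R X r E x v}.

Lemma fiber_pred_submod (R : realType) (X : surface R) r (E : bundle X r) (x : X) :
  submod_closed (fiber_pred E x).
Proof.
split; first by apply/fiber_predP; split => // i j _ _; rewrite mulmx0.
move=> a u v /fiber_predP[u0 ug] /fiber_predP[v0 vg]; apply/fiber_predP; split.
  move=> i ix; change (a *: u i + v i = 0).
  by rewrite u0// v0// scaler0 addr0.
move=> i j ix jx.
change (a *: u i + v i = btrans i j x *m (a *: u j + v j)).
by rewrite mulmxDr -scalemxAr -ug// -vg.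
Qed.

HB.instance Definition _ (R : realType) (X : surface R) r (E : bundle X r) (x : X) :=
  GRing.isSubmodClosed.Build (cplx R) (bidx E -> 'cV[cplx R]_r) (fiber_pred E x)
    (fiber_pred_submod E x).

Record fiber (R : realType) (X : surface R) r (E : bundle X r) (x : X) := Fiber {
  coords :> bidx E -> 'cV[cplx R]_r;
  coordsP : coords \in fiber_pred E x }.

HB.instance Definition _ (R : realType) (X : surface R) r (E : bundle X r) (x : X) :=
  [isSub for @coords R X r E x].
HB.instance Definition _ (R : realType) (X : surface R) r (E : bundle X r) (x : X) :=
  [Choice of fiber E x by <:].
HB.instance Definition _ (R : realType) (X : surface R) r (E : bundle X r) (x : X) :=
  [SubChoice_isSubLmodule of fiber E x by <:].

Definition total_space (R : realType) (X : surface R) r (E : bundle X r) : Type :=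
  {x : X & fiber E x}.

Definition sec (R : realType) (X : surface R) r (E : bundle X r) : Type :=
  forall x, fiber E x.

Definition hol_sec (R : realType) (X : surface R) r (E : bundle X r)
    (U : set X) (s : sec E) : Prop :=
  forall (i : bidx E) k, hol_fun (U `&` bdom i) (fun x => s x i k 0).

Definition triv_bundle (R : realType) (X : surface R) : bundle X 1 :=
  @Bundle R X 1 unit (fun=> setT) (fun _ _ _ => 1%:M).

Definition det_bundle (R : realType) (X : surface R) r (E : bundle X r) : bundle X 1 :=
  @Bundle R X 1 (bidx E) (@bdom _ _ _ E) (fun i j x => (\det (btrans i j x))%:M).

Definition dual (R : realType) (X : surface R) r (E : bundle X r) : bundle X r :=
  @Bundle R X r (bidx E) (@bdom _ _ _ E) (fun i j x => (invmx (btrans i j x))^T).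

Definition pull (R : realType) (X Y : surface R) (h : X -> Y) r (E : bundle Y r) :
    bundle X r :=
  @Bundle R X r (bidx E) (fun i => h @^-1` bdom i) (fun i j x => btrans i j (h x)).

(* [f^*(\bar E)], for anti-holomorphic [f] *)
Definition conj_pull (R : realType) (X Y : surface R) (f : X -> Y) r (E : bundle Y r) :
    bundle X r :=
  @Bundle R X r (bidx E) (fun i => f @^-1` bdom i)
    (fun i j x => map_mx Num.conj (btrans i j (f x))).

(* [E (x) N] for a line bundle [N] *)
Definition tensor (R : realType) (X : surface R) r (E : bundle X r) (N : bundle X 1) :
    bundle X r :=
  @Bundle R X r (bidx E * bidx N)%type (fun i => bdom i.1 `&` bdom i.2)
    (fun i j x => btrans i.2 j.2 x 0 0 *: btrans i.1 j.1 x).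

(* The coordinate of a covector in the frame [c] is its coefficient on [dz_c]. *)
Definition canonical_bundle (R : realType) (X : surface R) : bundle X 1 :=
  @Bundle R X 1 (chart X) (@cdom _ X)
    (fun c c' x =>
       (derive1 (fun z : cplx R => cfwd c' (cbwd c z) : cplx R) (cfwd c x))%:M).

Definition tens_coords (R : realType) (X : surface R) r (E : bundle X r)
    (N : bundle X 1) (x : X) (u : fiber E x) (v : fiber N x) :
    bidx (tensor E N) -> 'cV[cplx R]_r :=
  fun i => v i.2 0 0 *: u i.1.

Lemma tens_subproof (R : realType) (X : surface R) r (E : bundle X r)
    (N : bundle X 1) (x : X) (u : fiber E x) (v : fiber N x) :
  tens_coords u v \in fiber_pred (tensor E N) x.
Proof.
have /fiber_predP[u0 ug] := coordsP u; have /fiber_predP[v0 vg] := coordsP v.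
apply/fiber_predP; rewrite /tens_coords; split=> [[i j]|[i j] [k l]] /=.
  by move=> /not_andP[/u0->|/v0->]; rewrite ?scaler0// mxE scale0r.
move=> [ix jx] [kx lx].
by rewrite (ug i k)// (vg j l)// mxE big_ord1 -scalemxAl -scalemxAr scalerA.
Qed.

Definition tens (R : realType) (X : surface R) r (E : bundle X r)
    (N : bundle X 1) (x : X) (u : fiber E x) (v : fiber N x) :
    fiber (tensor E N) x :=
  Fiber (tens_subproof u v).

Lemma pullv_subproof (R : realType) (X Y : surface R) (h : X -> Y) r
    (E : bundle Y r) (x : X) (v : fiber E (h x)) :
  (v : bidx (pull h E) -> 'cV[cplx R]_r) \in fiber_pred (pull h E) x.
Proof. by have /fiber_predP[v0 vg] := coordsP v; apply/fiber_predP; split. Qed.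

Definition pullv (R : realType) (X Y : surface R) (h : X -> Y) r
    (E : bundle Y r) (x : X) (v : fiber E (h x)) : fiber (pull h E) x :=
  Fiber (pullv_subproof v).

Definition hol_hom (R : realType) (X : surface R) r r' (E : bundle X r)
    (F : bundle X r') (psi : forall x, fiber E x -> fiber F x) : Prop :=
  (forall x, linear (psi x)) /\
  forall (U : set X) (s : sec E), open U -> hol_sec U s ->
    hol_sec U (fun x => psi x (s x)).

Definition hol_iso (R : realType) (X : surface R) r (E F : bundle X r)
    (psi : forall x, fiber E x -> fiber F x) : Prop :=
  hol_hom psi /\ exists psi' : forall x, fiber F x -> fiber E x,
    hol_hom psi' /\ forall x, cancel (psi x) (psi' x) /\ cancel (psi' x) (psi x).

Definition isomorphic (R : realType) (X : surface R) r (E F : bundle X r) : Prop :=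
  exists psi : forall x, fiber E x -> fiber F x, hol_iso psi.

(* Holomorphic anti-linear maps [E -> E] covering [f]: they send holomorphic
   sections to holomorphic sections; [s'] is the image of [s]. *)
Definition antilinear_lift (R : realType) (X : surface R) r (E : bundle X r)
    (f : X -> X) (phi : forall x, fiber E x -> fiber E (f x)) : Prop :=
  (forall x (a : cplx R) u v, phi x (a *: u + v) = a^* *: phi x u + phi x v) /\
  forall (U : set X) (s s' : sec E), open U -> hol_sec U s ->
    (forall x, U x -> s' (f x) = phi x (s x)) -> hol_sec (f @` U) s'.

Definition total_map (R : realType) (X : surface R) r (E : bundle X r)
    (f : X -> X) (phi : forall x, fiber E x -> fiber E (f x)) (v : total_space E) :
    total_space E :=
  Tagged (fiber E) (phi (tag v) (tagged v)).

Definition has_genus (R : realType) (X : surface R) (g : nat) : Prop :=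
  exists b : 'I_g -> sec (canonical_bundle X),
    (forall k, hol_sec setT (b k)) /\
    forall w : sec (canonical_bundle X), hol_sec setT w ->
      exists! a : 'rV[cplx R]_g, forall x, w x = \sum_(k < g) a 0 k *: b k x.

Definition has_order (R : realType) (X : surface R) (N : bundle X 1)
    (s : sec N) (x : X) (n : int) : Prop :=
  exists (i : bidx N) (c : chart X) (U : set X) (h : X -> cplx R),
    [/\ open U, U x, U `<=` bdom i `&` cdom c, hol_fun U h & h x != 0 /\
        forall y, U y -> y <> x -> s y i 0 0 = (cfwd c y - cfwd c x) ^ n * h y].

(* the degree of the divisor of a nonzero meromorphic section; the section is
   only meaningful outside the finite set [D] *)
Definition has_degree (R : realType) (X : surface R) (N : bundle X 1) (d : int) :
    Prop :=
  exists (s : sec N) (D : seq X) (n : X -> int),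
    [/\ uniq D, hol_sec [set x | x \notin D] s,
        forall x, has_order s x (n x),
        forall x, x \notin D -> n x = 0 &
        d = \sum_(x <- D) n x].

(* A section of [End(E) (x) K] is a bundle map [E -> E (x) K]. *)

Definition higgs_field (R : realType) (X : surface R) r (E : bundle X r) : Type :=
  forall x, fiber E x -> fiber (tensor E (canonical_bundle X)) x.

(* in the frame [i] of [E], [Phi = A dz_c] at [x] *)
Definition higgs_matrix (R : realType) (X : surface R) r (E : bundle X r)
    (Phi : higgs_field E) (x : X) (i : bidx E) (c : chart X) (A : 'M[cplx R]_r) :
    Prop :=
  [/\ bdom i x, cdom c x & forall v : fiber E x, Phi x v (i, c) = A *m v i].

Definition SL2_higgs_bundle (R : realType) (X : surface R) (E : bundle X 2)
    (Phi : higgs_field E) : Prop :=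
  [/\ hol_bundle E, isomorphic (det_bundle E) (triv_bundle X), hol_hom Phi &
      forall x i c A, higgs_matrix Phi x i c A -> \tr A = 0].

(* slope stability for rank 2: deg N < deg E / 2 for invariant line subbundles *)
Definition stable_higgs (R : realType) (X : surface R) (E : bundle X 2)
    (Phi : higgs_field E) : Prop :=
  forall (N : bundle X 1) (iota : forall x, fiber N x -> fiber E x),
    hol_bundle N -> hol_hom iota -> (forall x, injective (iota x)) ->
    (forall x (n : fiber N x), exists (m : fiber N x)
       (y : fiber (canonical_bundle X) x), Phi x (iota x n) = tens (iota x m) y) ->
  forall d e : int, has_degree N d -> has_degree (det_bundle E) e -> 2 * d < e.

Definition higgs_iso (R : realType) (X : surface R) r (E F : bundle X r)
    (Phi : higgs_field E) (Psi : higgs_field F) : Prop :=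
  exists psi : forall x, fiber E x -> fiber F x, hol_iso psi /\
    forall x (v u : fiber E x) (y : fiber (canonical_bundle X) x),
      Phi x v = tens u y -> Psi x (psi x v) = tens (psi x u) y.

(* [f^*(\bar{dz_c}) = (conj_jac f c c' x) dz_c'] at [x] *)
Definition conj_jac (R : realType) (X : surface R) (f : X -> X)
    (c c' : chart X) (x : X) : cplx R :=
  derive1 (fun z : cplx R => (cfwd c (f (cbwd c' z)))^* : cplx R) (cfwd c' x).

(* [v'] in [K_(f x)] is [f^*(\bar v)] for [v] in [K_x] ([f] an involution) *)
Definition is_conj_pull (R : realType) (X : surface R) (f : X -> X)
    (v v' : total_space (canonical_bundle X)) : Prop :=
  tag v' = f (tag v) /\
  forall c c' : chart X, cdom c (tag v) -> cdom c' (tag v') ->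
    tagged v' c' 0 0 = (tagged v c 0 0)^* * conj_jac f c c' (tag v').

Definition quadratic (R : realType) (X : surface R) : bundle X 1 :=
  tensor (canonical_bundle X) (canonical_bundle X).

(* [f^*(\bar q) = q] *)
Definition conj_invariant (R : realType) (X : surface R) (f : X -> X)
    (q : sec (quadratic X)) : Prop :=
  forall (c c' : chart X) x, cdom c (f x) -> cdom c' x ->
    q x (c', c') 0 0 = (q (f x) (c, c) 0 0)^* * conj_jac f c c' x ^+ 2.

(* [Psi = f^*(\bar{Phi^t})] on [f^*(\bar E^* )] *)
Definition is_conj_pull_higgs (R : realType) (X : surface R) (f : X -> X) r
    (E : bundle X r) (Phi : higgs_field E)
    (Psi : higgs_field (conj_pull f (dual E))) : Prop :=
  forall x i c c' A, higgs_matrix Phi (f x) i c A -> cdom c' x ->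
    higgs_matrix Psi x i c' (conj_jac f c c' x *: (map_mx Num.conj A)^T).

Definition fixed_higgs (R : realType) (X : surface R) (f : X -> X) r
    (E : bundle X r) (Phi : higgs_field E) : Prop :=
  exists Psi : higgs_field (conj_pull f (dual E)),
    is_conj_pull_higgs Phi Psi /\ higgs_iso Phi Psi.

(* [phiK] is the extension of [phi] to form-valued vectors:
   [phiK (s (x) w) = phi s (x) f^*(\bar w)] *)
Definition extends_to_forms (R : realType) (X : surface R) (f : X -> X) r
    (E : bundle X r) (phi : forall x, fiber E x -> fiber E (f x))
    (phiK : forall x, fiber (tensor E (canonical_bundle X)) x ->
                      fiber (tensor E (canonical_bundle X)) (f x)) : Prop :=
  forall x (u : fiber E x) (y : fiber (canonical_bundle X) x)
         (y' : fiber (canonical_bundle X) (f x)),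
    is_conj_pull f (Tagged (fiber _) y) (Tagged (fiber _) y') ->
    phiK x (tens u y) = tens (phi x u) y'.

Definition simple_zeros (R : realType) (X : surface R) (q : sec (quadratic X)) :
    Prop :=
  forall (c : chart X) x, cdom c x -> q x = 0 ->
    derive1 (fun z : cplx R => q (cbwd c z) (c, c) 0 0 : cplx R) (cfwd c x) != 0.

(* characteristic polynomial of [Phi]: [eta^2 - q], i.e. [q = - det Phi] *)
Definition higgs_char (R : realType) (X : surface R) (E : bundle X 2)
    (Phi : higgs_field E) (q : sec (quadratic X)) : Prop :=
  forall x i c A, higgs_matrix Phi x i c A -> q x (c, c) 0 0 = - \det A.

(* The inclusion [S -> K] of the spectral curve in the total space of [K], in
   terms of the projection [p] and the tautological section [eta] of [p^*K]. *)
Definition spectral_point (R : realType) (X S : surface R) (p : S -> X)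
    (eta : forall s, fiber (canonical_bundle X) (p s)) (s : S) :
    total_space (canonical_bundle X) :=
  Tagged (fiber _) (eta s).

(* [S] is the complex submanifold [{ v | v^2 = q }] of the total space of [K]:
   the inclusion is a bijection onto this set, holomorphic, a homeomorphism for
   the induced topology, and an immersion. *)
Definition spectral_curve (R : realType) (X S : surface R) (p : S -> X)
    (eta : forall s, fiber (canonical_bundle X) (p s)) (q : sec (quadratic X)) :
    Prop :=
  [/\ injective (spectral_point eta),
      range (spectral_point eta) =
        [set v | tens (tagged v) (tagged v) = q (tag v)],
      hol_map p /\ forall c : chart X,
        hol_fun (p @^-1` cdom c) (fun s => eta s c 0 0),
      forall (s : S) (c : chart X) (A : set S), cdom c (p s) ->
        nbhs s A <->
        exists2 e : cplx R, 0 < e & forall s' : S, cdom c (p s') ->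
          `|cfwd c (p s') - cfwd c (p s)| < e ->
          `|eta s' c 0 0 - eta s c 0 0| < e -> A s' &
      forall (s : S) (c : chart X) (k : chart S), cdom c (p s) -> cdom k s ->
        derive1 (fun z : cplx R => cfwd c (p (cbwd k z)) : cplx R) (cfwd k s) != 0
        \/ derive1 (fun z : cplx R => eta (cbwd k z) c 0 0 : cplx R) (cfwd k s) != 0].

Definition sheet_exchange (R : realType) (X S : surface R) (p : S -> X)
    (eta : forall s, fiber (canonical_bundle X) (p s)) (sigma : S -> S) : Prop :=
  forall s, spectral_point eta (sigma s) = Tagged (fiber _) (- eta s).

(* [ftil] is the restriction to [S] of [v |-> f^*(\bar v)] *)
Definition spectral_lift (R : realType) (X S : surface R) (p : S -> X)
    (eta : forall s, fiber (canonical_bundle X) (p s)) (f : X -> X)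
    (ftil : S -> S) : Prop :=
  forall s, is_conj_pull f (spectral_point eta s) (spectral_point eta (ftil s)).

(* [Theta] is an isomorphism of sheaves of [O_X]-modules from the sections of
    [E] to the direct image [U |-> M(p^-1 U)] of those of [M]; a section over
    [U] is an everywhere defined section, considered on [U] only. *)
Definition direct_image_iso (R : realType) (X S : surface R) (p : S -> X) r
    (E : bundle X r) (M : bundle S 1) (Theta : set X -> sec E -> sec M) : Prop :=
  [/\ forall U s, open U -> hol_sec U s -> hol_sec (p @^-1` U) (Theta U s),
      forall U (h : X -> cplx R) s s' (s'' : sec E), open U ->
        hol_fun U h -> hol_sec U s -> hol_sec U s' ->
        (forall x, U x -> s'' x = h x *: s x + s' x) ->
        forall t, U (p t) -> Theta U s'' t = h (p t) *: Theta U s t + Theta U s' t,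
      forall U V s s', open U -> open V -> V `<=` U -> hol_sec U s -> hol_sec V s' ->
        (forall x, V x -> s' x = s x) ->
        forall t, V (p t) -> Theta V s' t = Theta U s t,
      forall U s, open U -> hol_sec U s ->
        (forall t, U (p t) -> Theta U s t = 0) -> forall x, U x -> s x = 0 &
      forall U (m : sec M), open U -> hol_sec (p @^-1` U) m ->
        exists2 s, hol_sec U s & forall t, U (p t) -> Theta U s t = m t].

(* [Phi] is the push-forward of [eta : M -> M (x) p^*K]: where
   [Phi s = s' (x) w], one has [s' (x) p^*w = s (x) eta] in [M (x) p^*K]. *)
Definition higgs_direct_image (R : realType) (X S : surface R) (p : S -> X)
    (eta : forall s, fiber (canonical_bundle X) (p s)) r
    (E : bundle X r) (M : bundle S 1) (Theta : set X -> sec E -> sec M)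
    (Phi : higgs_field E) : Prop :=
  forall U (s s' : sec E) (w : sec (canonical_bundle X)), open U ->
    hol_sec U s -> hol_sec U s' -> hol_sec U w ->
    (forall x, U x -> Phi x (s x) = tens (s' x) (w x)) ->
    forall t, U (p t) ->
      tens (Theta U s' t) (pullv (w (p t))) = tens (Theta U s t) (pullv (eta t)).

(* Main.v *)
Require Import Defs.
From HB Require Import structures.
From mathcomp Require Import all_boot all_order all_algebra.
From mathcomp Require Import ring lra.
From mathcomp Require Import complex.
From mathcomp Require Import all_classical all_reals.
From mathcomp Require Import interval_inference topology normedtype derive sequences exp trigo.
From mathcomp Require Import measure lebesgue_measure lebesgue_integral ftc.

Set Implicit Arguments.
Unset Strict Implicit.
Unset Printing Implicit Defensive.

Import Order.TTheory GRing.Theory Num.Theory.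
Import numFieldNormedType.Exports.

Local Open Scope classical_set_scope.
Local Open Scope ring_scope.

(** The two real structures come from a single anti-linear endomorphism of E.

    The isomorphism expressing that the Higgs bundle is fixed by f, together with
    a trivialization of det E, which identifies E with its dual and Phi^t with
    - Phi, yields an anti-linear map phi : E -> E covering f which anticommutes
    with the Higgs field ([fixed_higgs_lift]).  Its square is a holomorphic
    endomorphism commuting with Phi.  As the zeros of q are simple, Phi vanishes
    nowhere, so the square has the form a + b Phi at each point; its trace and the
    trace of its square are holomorphic functions on X, hence constant, and at the
    zero x0 of q fixed by f they show that b vanishes.  At x0 the map phi preserves
    the kernel of Phi, a line, on which a square of an anti-linear map is a modulus
    squared; so a > 0 ([anti_square_positive]), and phi can be rescaled to an
    involution.  In the same way, evaluation at x0 shows that K^(1/2) carries a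
    real structure ([line_real_structure]).

    The bundle E being the direct image of M = L (x) p^* K^(1/2), the fibre of M
    at a point s of the spectral curve is a quotient of the fibre of E at p s,
    namely by the kernel of Phi + eta s ([theta_row_higgs], [theta_row_neq0]).
    As phi changes the sign of Phi, it maps this kernel at s to the one at tau s,
    and thus descends to an anti-linear involution of M covering tau; dividing by
    the real structure of K^(1/2) gives the lift of tau to L
    ([lift_coeff_exists], [lift_mx_involutive]).

    Two facts of complex analysis enter.  Holomorphic functions on X are constant
    ([hol_constant]): this rests on Goursat's theorem ([goursat]), applied in
    logarithmic polar coordinates to obtain the mean value property and the
    maximum principle on discs.  And tau is antiholomorphic ([tau_antihol]): the
    Jacobian of f, which enters the action of tau on eta, varies holomorphically
    because it is a ratio of coefficients of the Higgs field ([conj_jac_hol]).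

    Bundle maps are handled through their matrices in frames: an anti-linear map
    is a family of matrices P i j, followed by conjugation of the coordinates. *)

(** * Goursat's theorem on rectangles *)

Lemma antiderivative (R : realType) (W : R -> R) (a b : R) :
  {in `[a, b], forall x, {for x, continuous W}} ->
  exists P : R -> R, {in `]a, b[, forall x : R, is_derive x 1 P (W x)}.
Proof.
move=> Wc; exists (fun x => \int[lebesgue_measure]_(t in `[a, x]) W t)%R.
move=> x; rewrite in_itv/= => /andP[ax xb].
have Wi : lebesgue_measure.-integrable `[a, b] (EFin \o W).
  apply: continuous_compact_integrable; first exact: segment_compact.
  by apply/continuous_in_subspaceT => y; rewrite inE/= => /Wc.
have xab : x \in `[a, b] by rewrite in_itv/= !ltW.
have [dP eP] := continuous_FTC1_closed xb Wi ax (Wc _ xab).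
exact: (DeriveDef dP (etrans (esym (derive1E _ _)) eP)).
Qed.

Lemma bounded_derivative (R : realType) (P W : R -> R) (a b k : R) : a <= b ->
  {in `[a, b], forall x : R, is_derive x 1 P (W x)} ->
  {in `[a, b], forall x, `|W x| <= k} -> `|P b - P a| <= k * (b - a).
Proof.
move=> ab dP Wk; have [] := @MVT_segment R P W a b ab.
- by move=> x xab; apply: dP; exact: subset_itv_oo_cc.
- apply: derivable_within_continuous => x xab.
  by have [] := dP x xab.
- move=> c cab ->; rewrite normrM (ger0_norm (_ : 0 <= b - a)) ?subr_ge0//.
  by rewrite ler_wpM2r ?subr_ge0//; exact: Wk.
Qed.

Lemma is_derive_affine_primitive (R : realType) (u v y0 x : R) :
  is_derive x 1 (fun x : R => u * x + v * (x - y0) ^+ 2 / 2) (u + v * (x - y0)).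
Proof.
have dq : is_derive x 1 ((fun x : R => x - y0) * (fun x : R => x - y0))
    ((x - y0) *: (1 : R) + (x - y0) *: (1 : R)).
  have d1 : is_derive x 1 (fun x : R => x - y0) 1.
    by have := is_deriveB (is_derive_id x 1) (is_derive_cst y0 x 1); rewrite subr0.
  exact: (is_deriveM d1 d1).
have dl := is_deriveZ u (is_derive_id x (1 : R)).
have := is_deriveD dl (is_deriveZ (v / 2) dq).
rewrite /GRing.scale/= => H.
have -> : (fun x : R => u * x + v * (x - y0) ^+ 2 / 2) =
  u \*: (id : R -> R) + (v / 2) \*: ((fun x : R => x - y0) * (fun x : R => x - y0)).
  by apply/funext => z; rewrite !fctE/= /GRing.scale/=; field.
have -> : u + v * (x - y0) = u * 1 + v / 2 * ((x - y0) * 1 + (x - y0) * 1).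
  by field.
exact: H.
Qed.

(** The boundary terms of Goursat's argument: the increment of an antiderivative
    of an almost affine function is that of the exact quadratic antiderivative,
    up to the error times the length. *)
Lemma affine_derivative_error (R : realType) (P W : R -> R) (a b y0 u v k : R) :
  a <= b -> {in `[a, b], forall x : R, is_derive x 1 P (W x)} ->
  {in `[a, b], forall x, `|W x - (u + v * (x - y0))| <= k} ->
  `|P b - P a - (u * (b - a) + v * ((b - y0) ^+ 2 - (a - y0) ^+ 2) / 2)|
    <= k * (b - a).
Proof.
move=> ab dP Wk.
pose Q : R -> R := fun x => P x - (u * x + v * (x - y0) ^+ 2 / 2).
have -> : P b - P a - (u * (b - a) + v * ((b - y0) ^+ 2 - (a - y0) ^+ 2) / 2)
    = Q b - Q a by rewrite /Q; field.
apply: (@bounded_derivative _ Q (fun x => W x - (u + v * (x - y0)))) => // x xab.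
exact: is_deriveB (dP x xab) (is_derive_affine_primitive _ _ _ _).
Qed.

(** A box violating Q has a quarter violating Q, so that a nested sequence of
    violating boxes of proportions w : h shrinks to a point, and contradicts the
    local hypothesis there. *)
Lemma box_induction (R : realType) (w h : R) (Q : R -> R -> R -> Prop) :
  0 < w -> 0 < h ->
  (forall x y t, 0 < t -> Q x y (t / 2) -> Q (x + t / 2 * w) y (t / 2) ->
    Q x (y + t / 2 * h) (t / 2) -> Q (x + t / 2 * w) (y + t / 2 * h) (t / 2) ->
    Q x y t) ->
  forall a c,
  (forall x0 y0, a <= x0 <= a + w -> c <= y0 <= c + h ->
    exists2 d, 0 < d & forall x y t, 0 < t -> t < d ->
    a <= x -> x + t * w <= a + w -> c <= y -> y + t * h <= c + h ->
    x <= x0 <= x + t * w -> y <= y0 <= y + t * h -> Q x y t) ->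
  Q a c 1.
Proof.
move=> w0 h0 Qdiv a c Qloc; apply: contrapT => nQ.
pose bad (p : R * R) (t : R) := ~ Q p.1 p.2 t.
have stepE (p : R * R) t : {p' : R * R | 0 < t -> bad p t ->
    bad p' (t / 2) /\ (p'.1 = p.1 \/ p'.1 = p.1 + t / 2 * w) /\
    (p'.2 = p.2 \/ p'.2 = p.2 + t / 2 * h)}.
  apply: cid; case: (pselect (0 < t /\ bad p t)) => [[t0 bp]|nt]; last first.
    by exists p => t0 bp; case: nt.
  apply: contrapT => /forallNP H; apply: bp; apply: Qdiv => //.
  - apply: contrapT => b; apply: (H p) => _ _; split=> //; split; by left.
  - apply: contrapT => b; apply: (H (p.1 + t / 2 * w, p.2)) => _ _; split=> //.
    by split; [right|left].
  - apply: contrapT => b; apply: (H (p.1, p.2 + t / 2 * h)) => _ _; split=> //.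
    by split; [left|right].
  - apply: contrapT => b.
    apply: (H (p.1 + t / 2 * w, p.2 + t / 2 * h)) => _ _; split=> //.
    by split; right.
pose tt n : R := 2^-1 ^+ n.
pose pp := fix pp n := if n is m.+1 then sval (stepE (pp m) (tt m)) else (a, c).
have tt0 n : 0 < tt n by rewrite exprn_gt0// invr_gt0.
have ttS n : tt n.+1 = tt n / 2 by rewrite /tt exprSr.
have bpp n : bad (pp n) (tt n).
  elim: n => [|n IH]; first by rewrite /tt expr0.
  by rewrite /= ttS; case: (stepE _ _) => p' /= /(_ (tt0 n) IH)[].
have stp n : (pp n.+1).1 = (pp n).1 \/ (pp n.+1).1 = (pp n).1 + tt n / 2 * w.
  by rewrite /=; case: (stepE _ _) => p' /= /(_ (tt0 n) (bpp n))[_ []].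
have stp2 n : (pp n.+1).2 = (pp n).2 \/ (pp n.+1).2 = (pp n).2 + tt n / 2 * h.
  by rewrite /=; case: (stepE _ _) => p' /= /(_ (tt0 n) (bpp n))[_ []].
have nested (s : nat -> R) (l : R) : 0 < l ->
    (forall n, s n.+1 = s n \/ s n.+1 = s n + tt n / 2 * l) ->
  exists z, forall n, s n <= z <= s n + tt n * l.
  move=> l0 sS.
  have sm n m : (n <= m)%N -> s n <= s m /\ s m + tt m * l <= s n + tt n * l.
    elim: m => [|m IH]; first by rewrite leqn0 => /eqP->.
    rewrite leq_eqVlt => /predU1P[<-//|]; rewrite ltnS => /IH[IH1 IH2].
    have := mulr_gt0 (tt0 m) l0.
    by rewrite ttS; case: (sS m) => ->; split; lra.
  exists (sup (range s)) => n; apply/andP; split.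
    apply: ub_le_sup; last by exists n.
    exists (s 0%N + tt 0%N * l) => _ [m _ <-].
    have [_] := sm 0%N m (leq0n _).
    by have := mulr_gt0 (tt0 m) l0; lra.
  apply: ge_sup; first by exists (s 0%N), 0%N.
  move=> _ [m _ <-]; case: (leqP n m) => nm.
    have [_] := sm n m nm.
    by have := mulr_gt0 (tt0 m) l0; lra.
  have [] := sm m n (ltnW nm).
  by have := mulr_gt0 (tt0 n) l0; lra.
have [x0 x0P] := nested _ _ w0 stp.
have [y0 y0P] := nested _ _ h0 stp2.
have sub (s : nat -> R) (l : R) : 0 < l ->
    (forall n, s n.+1 = s n \/ s n.+1 = s n + tt n / 2 * l) ->
  forall n, s 0%N <= s n /\ s n + tt n * l <= s 0%N + l.
  move=> l0 sS; elim=> [|n [IH1 IH2]]; first by rewrite /tt expr0 mul1r.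
  have := mulr_gt0 (tt0 n) l0.
  by rewrite ttS; case: (sS n) => ->; split; lra.
have tt_1 : tt 0%N = 1 by rewrite /tt expr0.
have [d d0 dP] : exists2 d, 0 < d & forall x y t, 0 < t -> t < d ->
    a <= x -> x + t * w <= a + w -> c <= y -> y + t * h <= c + h ->
    x <= x0 <= x + t * w -> y <= y0 <= y + t * h -> Q x y t.
  apply: Qloc.
    by have := x0P 0%N; rewrite tt_1 mul1r.
  by have := y0P 0%N; rewrite tt_1 mul1r.
have [n ttn] : exists n, tt n < d.
  have /cvgr0_norm_lt/(_ d d0) : (fun n => 2^-1 ^+ n : R) @ \oo --> (0 : R).
    by apply: cvg_expr; rewrite ger0_norm ?invr_ge0// invf_lt1// ltr1n.
  move=> [n _ /(_ n)] /=; rewrite leqnn => /(_ isT).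
  by rewrite ger0_norm ?ltW//; exists n.
have [s1 s2] := sub _ _ w0 stp n; have [s3 s4] := sub _ _ h0 stp2 n.
exact: (bpp n) (dP _ _ _ (tt0 n) ttn s1 s2 s3 s4 (x0P n) (y0P n)).
Qed.

(** Complex differentiability of U + iV at x0 + i y0 in real terms, the
    derivative being al + i be. *)
Definition cauchy_riemann (R : realType) (U V : R -> R -> R) (x0 y0 : R) : Prop :=
  exists al be : R, forall e, 0 < e -> exists2 d, 0 < d &
    forall x y, `|x - x0| < d -> `|y - y0| < d ->
      `|U x y - U x0 y0 - (al * (x - x0) - be * (y - y0))|
         <= e * (`|x - x0| + `|y - y0|) /\
      `|V x y - V x0 y0 - (be * (x - x0) + al * (y - y0))|
         <= e * (`|x - x0| + `|y - y0|).

Lemma cauchy_riemann_continuous (R : realType) (U V : R -> R -> R) (x y : R) :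
  cauchy_riemann U V x y ->
  {for x, continuous (fun x' => V x' y)} /\ {for y, continuous (U x)}.
Proof.
move=> [al [be CR]].
have lip (F : R -> R) (z m : R) (d : R) : 0 < d ->
  (forall z', `|z' - z| < d -> `|F z' - F z - m * (z' - z)| <= `|z' - z|) ->
  {for z, continuous F}.
  move=> d0 H; apply/cvgrPdist_lt => e e0; near=> z'.
  have zd : `|z' - z| < d by rewrite distrC; near: z'; apply/nbhs_ballP; exists d.
  have m0 : 0 < `|m| + 1 by rewrite ltr_wpDl.
  have ze : `|z' - z| * (`|m| + 1) < e.
    rewrite -ltr_pdivlMr// distrC; near: z'; apply/nbhs_ballP.
    by exists (e / (`|m| + 1)) => //=; rewrite divr_gt0.
  have := H _ zd.
  have := ler_normD (F z' - F z - m * (z' - z)) (m * (z' - z)).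
  rewrite subrK (distrC (F z)) normrM; lra.
have [d d0 dP] := CR 1 ltr01; split.
- apply: (@lip _ x be d d0) => z zd.
  have [|_] := dP z y zd; first by rewrite subrr normr0.
  by rewrite subrr normr0 mulr0 !addr0 mul1r.
- apply: (@lip _ y (- be) d d0) => z zd.
  have [|+ _] := dP x z _ zd; first by rewrite subrr normr0.
  by rewrite subrr normr0 mulr0 !add0r mul1r mulNr.
Unshelve. all: by end_near. Qed.

(** The left side integrates U along the vertical edges and the right side V
    along the horizontal ones, P x and N y being antiderivatives on these lines;
    their difference, the imaginary part of the boundary integral of U + iV, is
    thus additive under subdivision for purely algebraic reasons.  The difference vanishes for affine U + iV, hence
    is negligible compared with the area of small boxes around each point. *)
Lemma goursat (R : realType) (U V P N : R -> R -> R) (a b c d : R) :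
  a <= b -> c <= d ->
  (forall x y, a <= x <= b -> c <= y <= d -> cauchy_riemann U V x y) ->
  (forall x y, a <= x <= b -> c <= y <= d -> is_derive y 1 (P x) (U x y)) ->
  (forall x y, a <= x <= b -> c <= y <= d -> is_derive x 1 (N y) (V x y)) ->
  (P b d - P b c) - (P a d - P a c) = (N d b - N d a) - (N c b - N c a).
Proof.
move=> ab cd CR dP dN.
move: ab; rewrite le_eqVlt => /predU1P[->|ab]; first by rewrite !subrr.
move: cd; rewrite le_eqVlt => /predU1P[->|cd]; first by rewrite !subrr.
pose w := b - a; pose h := d - c.
have w0 : 0 < w by rewrite subr_gt0.
have h0 : 0 < h by rewrite subr_gt0.
pose I x1 x2 y1 y2 := (P x2 y2 - P x2 y1) - (P x1 y2 - P x1 y1) -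
  ((N y2 x2 - N y2 x1) - (N y1 x2 - N y1 x1)).
apply/eqP; rewrite -subr_eq0 -normr_le0; apply/ler_addgt0Pr => e e0.
rewrite add0r.
suff : `|I a (a + 1 * w) c (c + 1 * h)| <= e * 1 ^+ 2.
  have -> : a + 1 * w = b by rewrite /w; ring.
  have -> : c + 1 * h = d by rewrite /h; ring.
  by rewrite expr1n mulr1.
pose Q x y t := `|I x (x + t * w) y (y + t * h)| <= e * t ^+ 2.
apply: (@box_induction R w h Q) => //.
  move=> x y t t0; rewrite /Q => q1 q2 q3 q4.
  have xx : x + t / 2 * w + t / 2 * w = x + t * w by field.
  have yy : y + t / 2 * h + t / 2 * h = y + t * h by field.
  rewrite xx in q2 q4; rewrite yy in q3 q4.
  set A := I _ _ _ _ in q1; set B := I _ _ _ _ in q2.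
  set C := I _ _ _ _ in q3; set D := I _ _ _ _ in q4.
  have -> : I x (x + t * w) y (y + t * h) = A + B + C + D.
    by rewrite /A /B /C /D /I; ring.
  have := ler_normD (A + B + C) D; have := ler_normD (A + B) C.
  have := ler_normD A B.
  have -> : e * t ^+ 2 = 4 * (e * (t / 2) ^+ 2) by field.
  lra.
move=> x0 y0 /andP[ax0 x0b] /andP[cy0 y0d].
have x0ab : a <= x0 <= b by apply/andP; split=> //; rewrite /w in x0b; lra.
have y0cd : c <= y0 <= d by apply/andP; split=> //; rewrite /h in y0d; lra.
have [al [be ALBE]] := CR _ _ x0ab y0cd.
(* in a box of sides t w and t h the four edges contribute at most
   2 (e / K) (t (w + h))^2, which is e t^2 *)
pose K := 2 * (w + h) ^+ 2.
have K0 : 0 < K by rewrite mulr_gt0// exprn_gt0// addr_gt0.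
have [r r0 rP] := ALBE (e / K) (divr_gt0 e0 K0).
exists (r / (w + h)); first by rewrite divr_gt0// addr_gt0.
move=> x y t t0 tr ax xb cy yd /andP[xx0 x0x] /andP[yy0 y0y]; rewrite /Q.
have tw0 : 0 < t * w by rewrite mulr_gt0.
have th0 : 0 < t * h by rewrite mulr_gt0.
have twr : t * w + t * h < r by rewrite -mulrDr -ltr_pdivlMr// addr_gt0.
have xb' : x + t * w <= b by rewrite (_ : b = a + w)//; rewrite /w; ring.
have yd' : y + t * h <= d by rewrite (_ : d = c + h)//; rewrite /h; ring.
have nx x' : x <= x' <= x + t * w -> `|x' - x0| <= t * w.
  by clear -xx0 x0x => /andP[? ?]; rewrite ler_norml; apply/andP; split; lra.
have ny y' : y <= y' <= y + t * h -> `|y' - y0| <= t * h.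
  by clear -yy0 y0y => /andP[? ?]; rewrite ler_norml; apply/andP; split; lra.
have eK0 : 0 <= e / K by rewrite ltW// divr_gt0.
have est x' y' : x <= x' <= x + t * w -> y <= y' <= y + t * h ->
    `|U x' y' - U x0 y0 - (al * (x' - x0) - be * (y' - y0))|
       <= e / K * (t * w + t * h) /\
    `|V x' y' - V x0 y0 - (be * (x' - x0) + al * (y' - y0))|
       <= e / K * (t * w + t * h).
  move=> /nx nx' /ny ny'.
  have le : e / K * (`|x' - x0| + `|y' - y0|) <= e / K * (t * w + t * h).
    by rewrite ler_wpM2l// lerD.
  have [||U1 V1] := rP x' y'.
  - by apply: le_lt_trans nx' _; apply: lt_trans twr; rewrite ltrDl.
  - by apply: le_lt_trans ny' _; apply: lt_trans twr; rewrite ltrDr.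
  by split; [exact: le_trans U1 le|exact: le_trans V1 le].
have PE x' : x <= x' <= x + t * w ->
  `|P x' (y + t * h) - P x' y - ((U x0 y0 + al * (x' - x0)) * (t * h) +
     (- be) * ((y + t * h - y0) ^+ 2 - (y - y0) ^+ 2) / 2)|
  <= e / K * (t * w + t * h) * (t * h).
  move=> xx'.
  have -> : t * h = y + t * h - y by ring.
  have yth : y <= y + t * h by rewrite lerDl ltW.
  have -> : y + (y + t * h - y) = y + t * h by ring.
  apply: (@affine_derivative_error _ (P x') (U x')) => // y'; rewrite in_itv/=.
    move=> /andP[y1 y2]; apply: dP.
      by move/andP: xx' => [x1 x2]; rewrite (le_trans ax x1) (le_trans x2 xb').
    by rewrite (le_trans cy y1) (le_trans y2 yd').
  move=> yy'; have [+ _] := est _ _ xx' yy'.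
  by congr (is_true (`|_| <= _)); ring.
have NE y' : y <= y' <= y + t * h ->
  `|N y' (x + t * w) - N y' x - ((V x0 y0 + al * (y' - y0)) * (t * w) +
     be * ((x + t * w - x0) ^+ 2 - (x - x0) ^+ 2) / 2)|
  <= e / K * (t * w + t * h) * (t * w).
  move=> yy'.
  have -> : t * w = x + t * w - x by ring.
  have xtw : x <= x + t * w by rewrite lerDl ltW.
  have -> : x + (x + t * w - x) = x + t * w by ring.
  apply: (@affine_derivative_error _ (N y') (V^~ y')) => // x'; rewrite in_itv/=.
    move=> /andP[x1 x2]; apply: dN.
      by rewrite (le_trans ax x1) (le_trans x2 xb').
    by move/andP: yy' => [y1 y2]; rewrite (le_trans cy y1) (le_trans y2 yd').
  move=> xx'; have [_ +] := est _ _ xx' yy'.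
  by congr (is_true (`|_| <= _)); ring.
have /PE P1 : x <= x <= x + t * w by rewrite lexx lerDl ltW.
have /PE P2 : x <= x + t * w <= x + t * w by rewrite lexx lerDl ltW.
have /NE N1 : y <= y <= y + t * h by rewrite lexx lerDl ltW.
have /NE N2 : y <= y + t * h <= y + t * h by rewrite lexx lerDl ltW.
rewrite /I.
have -> : e * t ^+ 2 = 2 * (e / K * (t * w + t * h) * (t * h)) +
    2 * (e / K * (t * w + t * h) * (t * w)).
  by rewrite /K; field; rewrite gt_eqF// addr_gt0.
set B1 := e / K * (t * w + t * h) * (t * h) in P1 P2 *.
set B2 := e / K * (t * w + t * h) * (t * w) in N1 N2 *.
set p1 := (X in `|X| <= _) in P1; set p2 := (X in `|X| <= _) in P2.
set n1 := (X in `|X| <= _) in N1; set n2 := (X in `|X| <= _) in N2.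
rewrite [X in `|X|](_ : _ = p2 - p1 - (n2 - n1)); last first.
  by rewrite /p1 /p2 /n1 /n2; field.
have := ler_normB (p2 - p1) (n2 - n1); have := ler_normB p2 p1.
have := ler_normB n2 n1; clear -P1 P2 N1 N2; lra.
Qed.

(** * Periodic functions on half-planes *)

(** Goursat's theorem on the rectangle of height one period: the contributions
    of the horizontal edges cancel, because V takes the same values on both. *)
Lemma strip_mean_constant (R : realType) (U V P : R -> R -> R) (rho T c : R) :
  0 < T -> (forall x y, x < rho -> cauchy_riemann U V x y) ->
  (forall x, x < rho -> V x (c + T) = V x c) ->
  (forall x y, x < rho -> c <= y <= c + T -> is_derive y 1 (P x) (U x y)) ->
  forall x1 x2, x1 <= x2 -> x2 < rho ->
  P x1 (c + T) - P x1 c = P x2 (c + T) - P x2 c.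
Proof.
move=> T0 CR VT dP x1 x2 x12 x2r.
pose a := x1 - 1; pose b := (x2 + rho) / 2.
have ax1 : a < x1 by rewrite /a; lra.
have x2b : x2 < b by rewrite /b; lra.
have br : b < rho by rewrite /b; lra.
have Vc y : {in `[a, b], forall x, {for x, continuous (V^~ y)}}.
  move=> x; rewrite in_itv/= => /andP[_ xb].
  exact: (cauchy_riemann_continuous (CR x y (le_lt_trans xb br))).1.
have [N NP] := choice (fun y => antiderivative (Vc y)).
have [K KP] : exists K : R, forall x, a < x < b -> N (c + T) x - N c x = K.
  have dK : {in `]a, b[, forall x : R, is_derive x 1 (N (c + T) - N c) 0}.
    move=> x xab; have := is_deriveB (NP (c + T) x xab) (NP c x xab).
    rewrite VT ?subrr//.
    by move: xab; rewrite in_itv/= => /andP[_ xb]; exact: lt_trans br.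
  exists (N (c + T) x1 - N c x1).
  suff : forall x y, x <= y -> a < x -> y < b ->
      (N (c + T) - N c) x = (N (c + T) - N c) y.
    move=> H x /andP[ax xb]; have [xx1|/ltW x1x] := leP x x1.
      by apply: H => //; exact: le_lt_trans x2b.
    by symmetry; apply: H.
  move=> x y xy ax yb; apply/esym/eqP; rewrite -subr_eq0 -normr_le0.
  rewrite -(mul0r (y - x)).
  apply: (@bounded_derivative _ _ (fun=> 0)) => // z; rewrite in_itv/=.
    by move=> /andP[? ?]; apply: dK; rewrite in_itv/=; apply/andP; split; lra.
  by rewrite normr0.
have : (P x2 (c + T) - P x2 c) - (P x1 (c + T) - P x1 c) =
    (N (c + T) x2 - N (c + T) x1) - (N c x2 - N c x1).
  apply: (@goursat R U V P N x1 x2 c (c + T)) => //.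
  - by rewrite lerDl ltW.
  - by move=> x y /andP[_ ?] _; apply: CR; lra.
  - by move=> x y /andP[_ ?] ?; apply: dP => //; lra.
  - move=> x y /andP[? ?] _; apply: NP; rewrite in_itv/=.
    by apply/andP; split; lra.
have : N (c + T) x1 - N c x1 = K by apply: KP; apply/andP; split; lra.
have : N (c + T) x2 - N c x2 = K by apply: KP; apply/andP; split; lra.
clear; lra.
Qed.

(** The mean of U over a vertical period does not depend on the abscissa and
    tends to M on the left, so it is M; a continuous function bounded by M has
    mean M only if it is M. *)
Lemma strip_maximum (R : realType) (U V : R -> R -> R) (rho T M : R) :
  0 < T -> (forall x y, x < rho -> cauchy_riemann U V x y) ->
  (forall x y, x < rho -> V x (y + T) = V x y) ->
  (forall x y, x < rho -> U x y <= M) ->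
  (forall e, 0 < e -> exists x0, forall x y, x < x0 -> `|U x y - M| <= e) ->
  forall x y, x < rho -> U x y = M.
Proof.
move=> T0 CR VT UM Uinf x2 y0 x2r.
(* centring the period at y0 makes y0 an interior point of it *)
pose c := y0 - T / 2.
have ac x : exists P : R -> R, x < rho -> forall y : R, c <= y <= c + T ->
    is_derive y 1 P (U x y).
  case: (pselect (x < rho)) => [xr|nxr]; last by exists (fun=> 0).
  have Uc : {in `[c - 1, c + T + 1], forall y, {for y, continuous (U x)}}.
    by move=> y _; exact: (cauchy_riemann_continuous (CR x y xr)).2.
  have [P PP] := antiderivative Uc; exists P => _ y /andP[? ?]; apply: PP.
  by rewrite in_itv/=; apply/andP; split; lra.
have [P PP] := choice ac.
have mean x1 : x1 <= x2 -> P x1 (c + T) - P x1 c = P x2 (c + T) - P x2 c.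
  move=> x12; apply: (@strip_mean_constant R U V P rho T c) => //.
    by move=> x xr; exact: VT.
  by move=> x y xr; exact: PP.
have tot : P x2 (c + T) - P x2 c = M * T.
  apply/eqP; rewrite -subr_eq0 -normr_le0; apply/ler_addgt0Pr => e e0.
  rewrite add0r.
  have [x0 x0P] := Uinf (e / T) (divr_gt0 e0 T0).
  pose x1 := Num.min x0 x2 - 1.
  have [x10 x12] : x1 < x0 /\ x1 < x2.
    have : Num.min x0 x2 <= x0 by rewrite ge_min lexx.
    have : Num.min x0 x2 <= x2 by rewrite ge_min lexx orbT.
    by rewrite /x1; split; lra.
  rewrite -(mean x1) ?(ltW x12)//.
  have := @affine_derivative_error _ (P x1) (U x1) c (c + T) c M 0 (e / T).
  rewrite !mul0r addr0 (_ : c + T - c = T); last by ring.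
  rewrite divfK ?gt_eqF//; apply; first by rewrite lerDl ltW.
    move=> y; rewrite in_itv/= => yc; apply: PP => //; exact: lt_trans x2r.
  by move=> y _; rewrite mul0r addr0; exact: x0P.
pose D := (fun y : R => M * y) - P x2.
have dD y : c <= y <= c + T -> is_derive y 1 D (M - U x2 y).
  move=> yc; apply: is_deriveB; last exact: PP.
  have := is_deriveZ M (is_derive_id y (1 : R)).
  by rewrite /GRing.scale/= mulr1.
have Dmono y1 y2 : c <= y1 -> y1 <= y2 -> y2 <= c + T -> D y1 <= D y2.
  move=> cy1 y12 y2T; rewrite -subr_ge0.
  have [] := @MVT_segment R D (fun y => M - U x2 y) y1 y2 y12.
  - move=> y; rewrite in_itv/= => /andP[? ?]; apply: dD; apply/andP; split; lra.
  - apply: derivable_within_continuous => y; rewrite in_itv/= => /andP[? ?].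
    by have [] : is_derive y 1 D (M - U x2 y) by apply: dD; apply/andP; split; lra.
  - move=> y _ ->; rewrite mulr_ge0 ?subr_ge0//; exact: UM.
have Dends : D c = D (c + T).
  have : D (c + T) - D c = 0.
    rewrite /D !fctE mulrDr -tot; ring.
  lra.
have Dc y : c <= y <= c + T -> D y = D c.
  move=> /andP[cy yT]; apply/eqP; rewrite eq_le; apply/andP; split.
    by rewrite Dends Dmono.
  by rewrite Dmono.
have y0c : c < y0 < c + T by rewrite /c; apply/andP; split; lra.
have : is_derive y0 1 D 0.
  apply: (@near_eq_is_derive _ _ _ (cst (D c))) (is_derive_cst _ _ _).
  move/andP: y0c => [cy0 y0T].
  near=> y; rewrite /cst; symmetry; apply: Dc; apply/andP; split.
    by near: y; exact: lt_le_nbhsr.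
  by near: y; exact: lt_le_nbhsl.
move=> /(@derive_val _ _ _ _ _ _ _); rewrite (@derive_val _ _ _ _ _ _ _ (dD y0 _)).
  lra.
by move/andP: y0c => [/ltW-> /ltW->].
Unshelve. all: by end_near. Qed.

(** * Slopes and complex differentiation *)

Lemma cvg_dist_ltP (K : numFieldType) (T : topologicalType) (F : T -> K) (x0 : T)
    (d : K) :
  (forall e, 0 < e -> \forall x \near x0, `|d - F x| < e) <-> F @ x0 --> d.
Proof.
have FF : Filter (nbhs x0) by exact: nbhs_filter.
by split=> [?|/cvgrPdist_lt//]; apply/cvgrPdist_lt.
Qed.

(** Differentiability in the sense of Caratheodory.  The slope g is defined on
    all of K, so that chain rule and implicit differentiation reduce to
    the composition of continuous functions. *)
Definition slope_at (K : numFieldType) (F : K -> K) (z0 d : K) : Prop :=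
  exists g : K -> K, [/\ forall z, F z = F z0 + g z * (z - z0), g z0 = d &
    {for z0, continuous g}].

Lemma slope_is_derive (K : numFieldType) (F : K -> K) (z0 d : K) :
  slope_at F z0 d -> is_derive z0 1 F d.
Proof.
move=> [g [Fg g0 gc]].
have cv : (fun h : K => h^-1 *: (F (h *: 1 + z0) - F z0)) @ (0 : K)^' --> d.
  have gc0 : (fun h : K => g (h + z0)) @ (0 : K)^' --> d.
    apply: cvg_within_filter; rewrite -g0.
    apply: (@cvg_comp _ _ _ (fun h : K => h + z0) g _ (nbhs z0)) => //.
    have : (fun h : K => h + z0) @ (0 : K) --> 0 + z0.
      exact: (cvgD cvg_id (cvg_cst _)).
    by rewrite add0r.
  apply: cvg_trans gc0; apply: near_eq_cvg; near=> h.
  have h0 : h != 0 by near: h; exact: nbhs_dnbhs_neq.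
  rewrite /GRing.scale/= mulr1 (Fg (h + z0)) addrAC subrr add0r addrK.
  by rewrite mulrCA mulVf ?mulr1.
apply: DeriveDef; first by apply/cvg_ex; exists d.
by apply: cvg_lim => //.
Unshelve. all: by end_near. Qed.

Lemma is_derive_slope (K : numFieldType) (F : K -> K) (z0 d : K) :
  is_derive z0 1 F d -> slope_at F z0 d.
Proof.
move=> dF.
have cv : (fun h : K => h^-1 *: (F (h *: 1 + z0) - F z0)) @ (0 : K)^' --> d.
  by rewrite -(@derive_val _ _ _ _ _ _ _ dF); exact: (@ex_derive _ _ _ _ _ _ _ dF).
exists (fun z => if z == z0 then d else (F z - F z0) / (z - z0)).
split; last 1 first.
- suff : (fun z => if z == z0 then d else (F z - F z0) / (z - z0)) @ z0 --> d.
    by rewrite /prop_for /continuous_at eqxx.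
  apply/cvg_dist_ltP => e e0.
  move/cvgrPdist_lt : cv => /(_ e e0) H.
  have {}H : \forall h \near (0 : K), h != 0 ->
     `|d - h^-1 *: (F (h *: 1 + z0) - F z0)| < e.
    exact: H.
  have : \forall z \near z0, z - z0 != 0 ->
     `|d - (z - z0)^-1 *: (F ((z - z0) *: 1 + z0) - F z0)| < e.
    have cz : (fun z : K => z - z0) @ z0 --> (0 : K).
      by rewrite -(subrr z0); exact: (cvgB cvg_id (cvg_cst _)).
    exact: (cz _ H).
  apply: filterS => z; rewrite subr_eq0; case: (eqVneq z z0) => [_ _|zz0].
    by rewrite subrr normr0.
  by rewrite /GRing.scale/= mulr1 subrK mulrC => /(_ isT).
- move=> z; case: (eqVneq z z0) => [->|zz0]; first by rewrite subrr mulr0 addr0.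
  by rewrite divfK ?subr_eq0// addrC subrK.
- by rewrite eqxx.
Unshelve. all: by end_near. Qed.

Lemma slope_comp (K : numFieldType) (F G : K -> K) (z0 d e : K) :
  slope_at F z0 d -> slope_at G (F z0) e -> slope_at (G \o F) z0 (e * d).
Proof.
move=> [g [Fg g0 gc]] [k [Gk k0 kc]].
have Fc : {for z0, continuous F}.
  have -> : F = (fun z => F z0 + g z * (z - z0)) by apply/funext.
  rewrite /prop_for /continuous_at.
  exact: (cvgD (cvg_cst _) (cvgM gc (cvgB cvg_id (cvg_cst _)))).
exists (fun z => k (F z) * g z); split; last 1 first.
- rewrite /prop_for /continuous_at.
  have kF : (fun z => k (F z)) @ z0 --> k (F z0) by exact: (cvg_comp _ _ Fc kc).
  exact: (cvgM kF gc).
- move=> z /=; rewrite (Gk (F z)) (_ : F z - F z0 = g z * (z - z0)) ?mulrA//.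
  by rewrite (Fg z) addrAC subrr add0r.
- by rewrite k0 g0.
Qed.

(** Implicit differentiation: the increment of W is that of Q divided by a slope
    of P, which stays close to d. *)
Lemma slope_inv (K : numFieldType) (P W Q : K -> K) (z0 d e : K) :
  {for z0, continuous W} -> (\forall z \near z0, P (W z) = Q z) ->
  slope_at P (W z0) d -> d != 0 -> slope_at Q z0 e -> slope_at W z0 (e / d).
Proof.
move=> Wc PWQ [g [Pg g0 gc]] d0 [k [Qk k0 kc]].
have gWc : (fun z => g (W z)) @ z0 --> d by rewrite -g0; exact: (cvg_comp _ _ Wc gc).
apply: is_derive_slope.
have PW0 : P (W z0) = Q z0 by exact: nbhs_singleton PWQ.
have : is_derive z0 1 (fun z => W z0 +
    (if z == z0 then e / d else k z / g (W z)) * (z - z0)) (e / d).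
  apply: slope_is_derive.
  exists (fun z => if z == z0 then e / d else k z / g (W z)); split; last 1 first.
  - suff : (fun z => if z == z0 then e / d else k z / g (W z)) @ z0 --> e / d.
      by rewrite /prop_for /continuous_at eqxx.
    have : (fun z => k z / g (W z)) @ z0 --> e / d.
      have kc' : k @ z0 --> e by rewrite -k0.
      exact: (cvgM kc' (cvgV d0 gWc)).
    move=> /cvg_dist_ltP H; apply/cvg_dist_ltP => r r0; apply: filterS (H r r0) => z.
    by case: eqP => // _ _; rewrite subrr normr0.
  - by move=> z; rewrite eqxx subrr mulr0 addr0.
  - by rewrite eqxx.
apply: near_eq_is_derive; near=> z.
case: (eqVneq z z0) => [->|zz0]; first by rewrite subrr mulr0 addr0.
have gW0 : g (W z) != 0.
  by near: z; exact: (cvgr_neq0 _ gWc).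
have PWz : P (W z) = Q z by near: z.
have : g (W z) * (W z - W z0) = k z * (z - z0).
  apply: (addrI (Q z0)); rewrite -{1}PW0 -Pg PWz; exact: Qk.
move=> E; rewrite mulrAC -E mulrAC divff// mul1r addrC subrK//.
Unshelve. all: by end_near. Qed.

Lemma slope_unique (K : numFieldType) (F : K -> K) (z0 d e : K) :
  slope_at F z0 d -> slope_at F z0 e -> d = e.
Proof.
move=> /slope_is_derive dF /slope_is_derive eF.
by rewrite -(@derive_val _ _ _ _ _ _ _ dF) (@derive_val _ _ _ _ _ _ _ eF).
Qed.

Lemma derivableP_slope (K : numFieldType) (F : K -> K) (z0 : K) :
  derivable F z0 1 -> slope_at F z0 (derive1 F z0).
Proof. by move=> /derivableP dF; apply: is_derive_slope; rewrite derive1E. Qed.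

Lemma slope_derivable (K : numFieldType) (F : K -> K) (z0 d : K) :
  slope_at F z0 d -> derivable F z0 1.
Proof. by move=> /slope_is_derive []. Qed.

Lemma slope_derive1 (K : numFieldType) (F : K -> K) (z0 d : K) :
  slope_at F z0 d -> derive1 F z0 = d.
Proof. by move=> /slope_is_derive dF; rewrite derive1E derive_val. Qed.

Lemma slope_continuous (K : numFieldType) (F : K -> K) (z0 d : K) :
  slope_at F z0 d -> {for z0, continuous F}.
Proof.
move=> /slope_derivable /derivable1_diffP; exact: differentiable_continuous.
Qed.

Lemma slope_near (K : numFieldType) (F G : K -> K) (z0 d : K) :
  (\forall z \near z0, F z = G z) -> slope_at F z0 d -> slope_at G z0 d.
Proof.
move=> FG /slope_is_derive dF; apply: is_derive_slope.
exact: near_eq_is_derive FG dF.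
Qed.

Section ComplexPlane.
Variable R : realType.
Local Notation C := (cplx R).

Lemma conj_continuous : continuous (fun z : C => z^*).
Proof.
move=> z; apply/cvg_dist_ltP => e e0; near=> w.
rewrite -rmorphB norm_conjC; near: w.
by apply/nbhs_ballP; exists e.
Unshelve. all: by end_near. Qed.

(** Conjugation before and after turns holomorphic functions into holomorphic
    ones; it carries the chain rule over to antiholomorphic maps. *)
Lemma slope_conj (F : C -> C) (z0 d : C) :
  slope_at F z0^* d -> slope_at (fun z => (F z^*)^*) z0 d^*.
Proof.
move=> [g [Fg g0 gc]]; exists (fun z => (g z^*)^*); split.
- by move=> z; rewrite [in LHS]Fg rmorphD rmorphM rmorphB/= !conjCK.
- by rewrite g0.
- rewrite /prop_for /continuous_at.
  have c1 : (fun z : C => g z^*) @ z0 --> g z0^*.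
    exact: (cvg_comp _ _ (@conj_continuous z0) gc).
  exact: (cvg_comp _ _ c1 (@conj_continuous _)).
Qed.

Lemma real_complex_continuous : continuous (fun x : R => x%:C%C : C).
Proof.
move=> x; apply/cvg_dist_ltP => e e0.
have er : e = (complex.Re e)%:C%C by rewrite RRe_real// gtr0_real.
near=> y; rewrite -rmorphB normc_def/= expr0n/= addr0 sqrtr_sqr er ltcR.
near: y; apply/nbhs_ballP; exists (complex.Re e) => //=.
by rewrite -ltcR -er.
Unshelve. all: by end_near. Qed.

Lemma ler_normRe (z : C) : `|complex.Re z| <= complex.Re `|z|.
Proof. by have := normc_ge_Re z; rewrite lecE => /andP[_]. Qed.

Lemma ler_normIm (z : C) : `|complex.Im z| <= complex.Re `|z|.
Proof.
have := ler_normRe (z * 'i%C); rewrite ReiNIm normrN normrM.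
by rewrite (_ : `|'i%C| = 1 :> C) ?mulr1// normc_def/= expr0n expr1n add0r sqrtr1.
Qed.

End ComplexPlane.

(** * The maximum principle on discs *)

Section PolarCoordinates.
Variable R : realType.
Local Notation C := (cplx R).
Local Notation "''i'" := ('i%C : C).
Local Notation "x %:C" := (x%:C%C : C).

(** The hypothesis on G is what the chain rule gives for G = h o exp, when the
    real and imaginary parts of the exponent vary separately; the limit of the
    second slope being i times that of the first is the equation of Cauchy and
    Riemann. *)
Lemma slopes_cauchy_riemann (G : R -> R -> C) (p r : R * R -> C) (D : C) (x0 y0 : R) :
  (forall x y, G x y = G x0 y0 +
     (p (x, y) * (x - x0)%:C + r (x, y) * (y - y0)%:C)) ->
  p @ (x0, y0) --> D -> r @ (x0, y0) --> 'i * D ->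
  cauchy_riemann (fun x y => complex.Re (G x y)) (fun x y => complex.Im (G x y)) x0 y0.
Proof.
move=> GE pD rD; exists (complex.Re D), (complex.Im D) => e e0.
have e0C : 0 < e%:C :> C by rewrite ltcR.
have /cvg_dist_ltP/(_ _ e0C) pe := pD; have /cvg_dist_ltP/(_ _ e0C) re := rD.
have [d /= d0 dP] : exists2 d : R, 0 < d &
    ball (x0, y0) d `<=` [set u | `|D - p u| < e%:C /\ `|'i * D - r u| < e%:C].
  have : \forall u \near (x0, y0), `|D - p u| < e%:C /\ `|'i * D - r u| < e%:C.
    near=> u; split; near: u; [exact: pe|exact: re].
  by move=> /nbhs_ballP.
exists d => // x y xd yd.
have [pxy rxy] : `|D - p (x, y)| < e%:C /\ `|'i * D - r (x, y)| < e%:C.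
  by apply: dP; split; rewrite /ball/= distrC.
set E : C := G x y - G x0 y0 - (D * (x - x0)%:C + 'i * D * (y - y0)%:C).
have nE : `|E| <= (e * (`|x - x0| + `|y - y0|))%:C.
  have -> : E = - (D - p (x, y)) * (x - x0)%:C - ('i * D - r (x, y)) * (y - y0)%:C.
    by rewrite /E GE; ring.
  apply: (le_trans (ler_normB _ _)).
  have nr (t : R) : `|t%:C| = `|t|%:C.
    by rewrite normc_def/= expr0n/= addr0 sqrtr_sqr.
  rewrite !normrM normrN !nr mulrDr rmorphD !rmorphM/=.
  by apply: lerD; apply: ler_wpM2r; rewrite ?ler0c//; exact: ltW.
have nEr : complex.Re `|E| <= e * (`|x - x0| + `|y - y0|).
  by have := nE; rewrite lecE => /andP[_].
split.
  apply: le_trans nEr; have := ler_normRe E; congr (is_true (`|_| <= _)).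
  rewrite /E; case: (G x y) => a b; case: (G x0 y0) => a' b'; case: (D) => u v.
  by simpc => /=; ring.
apply: le_trans nEr; have := ler_normIm E; congr (is_true (`|_| <= _)).
rewrite /E; case: (G x y) => a b; case: (G x0 y0) => a' b'; case: (D) => u v.
by simpc => /=; ring.
Unshelve. all: by end_near. Qed.

(** The complex exponential of x + i y. *)
Definition polar (x y : R) : C := (expR x * cos y +i* (expR x * sin y))%C.

Lemma norm_polar x y : `|polar x y| = (expR x)%:C.
Proof.
by rewrite normc_def/= !exprMn -mulrDr cos2Dsin2 mulr1 sqrtr_sqr ger0_norm.
Qed.

Lemma polarP (w : C) : w != 0 -> exists x y, w = polar x y.
Proof.
move=> w0; case: w w0 => a b w0.
pose s := Num.sqrt (a ^+ 2 + b ^+ 2).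
have s20 : 0 < a ^+ 2 + b ^+ 2.
  rewrite lt_neqAle addr_ge0 ?sqr_ge0// andbT eq_sym paddr_eq0 ?sqr_ge0//.
  by apply: contra w0 => /andP[]; rewrite !sqrf_eq0 => /eqP-> /eqP->.
have s0 : 0 < s by rewrite sqrtr_gt0.
have s2 : s ^+ 2 = a ^+ 2 + b ^+ 2 by rewrite sqr_sqrtr// ltW.
have as1 : -1 <= a / s <= 1.
  rewrite -ler_norml normrM normfV (ger0_norm (ltW s0)) ler_pdivrMr// mul1r.
  by rewrite /s -sqrtr_sqr ler_wsqrtr// lerDl sqr_ge0.
have sq : Num.sqrt (1 - (a / s) ^+ 2) = `|b| / s.
  have -> : 1 - (a / s) ^+ 2 = (b / s) ^+ 2.
    by rewrite !expr_div_n s2; field; rewrite gt_eqF.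
  by rewrite sqrtr_sqr normrM normfV (ger0_norm (ltW s0)).
(* acos takes its values in the upper half-circle *)
exists (ln s), (if 0 <= b then acos (a / s) else - acos (a / s)).
rewrite /polar lnK ?posrE//; case: ifPn => b0.
  rewrite acosK ?in_itv//= sin_acos// sq ger0_norm//.
  by congr (_ +i* _)%C; field; rewrite gt_eqF.
rewrite cosN sinN acosK ?in_itv//= sin_acos// sq ltr0_norm ?ltNge//.
by congr (_ +i* _)%C; field; rewrite gt_eqF.
Qed.

Lemma polar_cauchy_riemann (h : C -> C) (z0 : C) (x0 y0 : R) :
  derivable h (z0 + polar x0 y0) 1 ->
  cauchy_riemann (fun x y => complex.Re (h (z0 + polar x y)))
    (fun x y => complex.Im (h (z0 + polar x y))) x0 y0.
Proof.
move=> /derivableP_slope; set D : C := derive1 _ _ => -[g [hg gD gc]].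
have [s1 [s1E s10 s1c]] := is_derive_slope (is_derive_expR x0).
have [s2 [s2E s20 s2c]] := is_derive_slope (is_derive_cos y0).
have [s3 [s3E s30 s3c]] := is_derive_slope (is_derive_sin y0).
pose cis (y : R) : C := (cos y)%:C + 'i * (sin y)%:C.
have polE x y : polar x y = (expR x)%:C * cis y.
  by rewrite /polar /cis; simpc.
pose G1 (u : R * R) := g (z0 + polar u.1 u.2).
pose p (u : R * R) : C := G1 u * ((s1 u.1)%:C * cis u.2).
pose r (u : R * R) : C :=
  G1 u * ((expR x0)%:C * ((s2 u.2)%:C + 'i * (s3 u.2)%:C)).
pose l : C := D * polar x0 y0.
have c1 (F : R -> R) : {for x0, continuous F} ->
    (fun u : R * R => (F u.1)%:C) @ (x0, y0) --> ((F x0)%:C).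
  move=> Fc; have h1 : (fun u : R * R => F u.1) @ (x0, y0) --> F x0.
    by apply: (@cvg_comp _ _ _ (fun u : R * R => u.1) F) Fc; exact: cvg_fst.
  exact: (cvg_comp _ _ h1 (@real_complex_continuous R _)).
have c2 (F : R -> R) : {for y0, continuous F} ->
    (fun u : R * R => (F u.2)%:C) @ (x0, y0) --> ((F y0)%:C).
  move=> Fc; have h1 : (fun u : R * R => F u.2) @ (x0, y0) --> F y0.
    by apply: (@cvg_comp _ _ _ (fun u : R * R => u.2) F) Fc; exact: cvg_snd.
  exact: (cvg_comp _ _ h1 (@real_complex_continuous R _)).
have ci (F H : R * R -> C) (a b : C) : F @ (x0, y0) --> a -> H @ (x0, y0) --> b ->
    (fun u => F u + 'i * H u) @ (x0, y0) --> a + 'i * b.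
  by move=> Fa Hb; exact: (cvgD Fa (cvgM (cvg_cst _) Hb)).
have cm (F H : R * R -> C) (a b : C) : F @ (x0, y0) --> a -> H @ (x0, y0) --> b ->
    (fun u => F u * H u) @ (x0, y0) --> a * b.
  by move=> Fa Hb; exact: (cvgM Fa Hb).
have ccis : (fun u : R * R => cis u.2) @ (x0, y0) --> cis y0.
  apply: ci; apply: c2; [exact: continuous_cos|exact: continuous_sin].
have cpol : (fun u : R * R => z0 + polar u.1 u.2) @ (x0, y0) --> z0 + polar x0 y0.
  rewrite (_ : (fun u => _) = fun u : R * R => z0 + (expR u.1)%:C * cis u.2).
    rewrite polE.
    have := cm _ _ _ _ (c1 _ (@continuous_expR R x0)) ccis => H.
    exact: (cvgD (cvg_cst _) H).
  by apply/funext => u; rewrite polE.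
have cG1 : G1 @ (x0, y0) --> D by rewrite -gD; exact: (cvg_comp _ _ cpol gc).
apply: (@slopes_cauchy_riemann _ p r l).
- move=> x y; rewrite (hg (z0 + polar x y)); congr (_ + _).
  rewrite /p /r /G1/= -!mulrA -mulrDr; congr (_ * _).
  rewrite !polE (s1E x) /cis (s2E y) (s3E y) !rmorphD !rmorphM !rmorphB/=.
  by ring.
- have -> : l = D * ((s1 x0)%:C * cis y0) by rewrite s10 -polE.
  exact: (cm _ _ _ _ cG1 (cm _ _ _ _ (c1 _ s1c) ccis)).
- have -> : 'i * l = D * ((expR x0)%:C * ((s2 y0)%:C + 'i * (s3 y0)%:C)).
    rewrite s20 s30 /l polE /cis rmorphN/= -[- (sin y0)%:C]mul1r.
    have i2 : 'i * 'i = -1 :> C by rewrite -expr2 sqr_i.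
    rewrite [in RHS](_ : 1 * - (sin y0)%:C = 'i * 'i * (sin y0)%:C); last first.
      by rewrite i2 mulN1r mul1r.
    by ring.
  exact: (cm _ _ _ _ cG1
    (cm _ _ _ _ (cvg_cst _) (ci _ _ _ _ (c2 _ s2c) (c2 _ s3c)))).
Qed.

(** In logarithmic polar coordinates the punctured disc becomes a half-plane on
    which h has period 2 pi, the centre lying at the left end. *)
Lemma disc_maximum (h : C -> C) (z0 : C) (r : R) :
  0 < r -> (forall z, `|z - z0| < r%:C -> derivable h z 1) ->
  (forall z, `|z - z0| < r%:C -> complex.Re (h z) <= complex.Re (h z0)) ->
  forall z, `|z - z0| < r%:C -> complex.Re (h z) = complex.Re (h z0).
Proof.
move=> r0 dh hmax z zr.
case: (eqVneq (z - z0) 0) => [/eqP|]; first by rewrite subr_eq0 => /eqP->.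
move=> /polarP[x [y zE]].
have {zE} zE : z = z0 + polar x y by rewrite -zE addrC subrK.
have pol_in x' y' : (x' < ln r) = (`|z0 + polar x' y' - z0| < r%:C).
  rewrite addrAC subrr add0r norm_polar ltcR -{2}[r]lnK ?posrE//.
  by rewrite ltr_expR.
rewrite zE.
apply: (@strip_maximum R (fun x y => complex.Re (h (z0 + polar x y)))
  (fun x y => complex.Im (h (z0 + polar x y))) (ln r) (pi *+ 2)).
- by rewrite mulrn_wgt0// pi_gt0.
- by move=> x' y' x'r; apply: polar_cauchy_riemann; apply: dh; rewrite -pol_in.
- by move=> x' y' _; rewrite /polar cosD2pi sinD2pi.
- by move=> x' y' x'r; apply: hmax; rewrite -pol_in.
- move=> e e0.
  have /slope_continuous hc : slope_at h z0 (derive1 h z0).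
    by apply: derivableP_slope; apply: dh; rewrite subrr normr0 ltcR.
  have e0C : 0 < e%:C :> C by rewrite ltcR.
  have /cvg_dist_ltP/(_ _ e0C)/nbhs_ballP[d /= d0 dP] := hc.
  have dE : d = (complex.Re d)%:C by rewrite RRe_real// gtr0_real.
  have d0r : 0 < complex.Re d by rewrite -ltcR -dE.
  exists (ln (complex.Re d)) => x' y' x'd.
  have /dP/= : ball z0 d (z0 + polar x' y').
    rewrite /ball/= opprD addrA subrr sub0r normrN norm_polar dE ltcR.
    by rewrite -[ltRHS]lnK ?posrE// ltr_expR.
  have ReB (u v : C) : complex.Re (u - v) = complex.Re u - complex.Re v.
    by case: u v => [? ?] [].
  move=> H; rewrite distrC -ReB; apply: (le_trans (ler_normRe _)); apply/ltW.
  by have := H; rewrite ltcE => /andP[_].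
- by rewrite (pol_in x y) -zE.
Qed.

End PolarCoordinates.

(** * Holomorphic functions on Riemann surfaces *)

Section HolomorphicFunctions.
Variable R : realType.
Local Notation C := (cplx R).

(** Holomorphy at a single point.  On open sets this is the usual notion, and
    every closure property holds point by point. *)
Variant hol_at (X : surface R) (h : X -> C) (x : X) : Prop :=
  HolAt of forall c : chart X, cdom c x ->
    derivable (fun z : C => h (cbwd c z) : C) (cfwd c x) 1.

Variable X : surface R.
Hypothesis X_surface : riemann_surface X.
Implicit Types (h k : X -> C) (x : X).

Lemma hol_funP U h : hol_fun U h <-> forall x, U x -> hol_at h x.
Proof.
split=> [H x Ux|H c x Ux cx]; first by split=> c cx; exact: H.
by have [hx] := H x Ux; exact: hx.
Qed.

Lemma chartK (c : chart X) x : cdom c x -> cbwd c (cfwd c x) = x.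
Proof. by case: X_surface => _ _ /(_ c)[_ _ + _ _] _; apply. Qed.

Lemma chart_exists x : exists c : chart X, cdom c x.
Proof. by case: X_surface. Qed.

Lemma cdom_nbhs (c : chart X) x : cdom c x -> nbhs x (cdom c).
Proof.
by case: X_surface => _ _ /(_ c)[o _ _ _ _] _ cx; apply: open_nbhs_nbhs; split.
Qed.

Lemma cfwd_cvg (c : chart X) x : cdom c x -> cfwd c @ x --> cfwd c x.
Proof. by case: X_surface => _ _ /(_ c)[_ _ _ + _] _; apply. Qed.

Lemma cbwd_cvg (c : chart X) x : cdom c x -> cbwd c @ (cfwd c x) --> x.
Proof.
move=> cx; case: (X_surface) => _ _ /(_ c)[_ _ _ _ +] _ => /(_ x cx).
by rewrite /prop_for /continuous_at chartK.
Qed.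

Lemma near_chart (c : chart X) x : cdom c x ->
  \forall z \near cfwd c x, cdom c (cbwd c z) /\ cfwd c (cbwd c z) = z.
Proof.
move=> cx; case: (X_surface) => _ _ /(_ c)[_ o _ _ _] _.
have : nbhs (cfwd c x) (cfwd c @` cdom c).
  by apply: open_nbhs_nbhs; split=> //; exists x.
by apply: filterS => _ [y cy <-]; rewrite chartK.
Qed.

Lemma hol_at_near h k x : (\forall y \near x, h y = k y) ->
  hol_at h x -> hol_at k x.
Proof.
move=> hk [hx]; split=> c cx; have /derivableP_slope hs := hx c cx.
apply: (@slope_derivable _ _ _ (derive1 (h \o cbwd c) (cfwd c x))).
apply: slope_near hs; exact: (cbwd_cvg cx hk).
Qed.

Lemma hol_at_cst (a : C) x : hol_at (fun=> a) x.
Proof. by split=> c cx; exact: derivable_cst. Qed.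

Lemma hol_atD h k x : hol_at h x -> hol_at k x -> hol_at (fun y => h y + k y) x.
Proof. by move=> [hx] [kx]; split=> c cx; exact: (derivableD (hx c cx) (kx c cx)). Qed.

Lemma hol_atN h x : hol_at h x -> hol_at (fun y => - h y) x.
Proof. by move=> [hx]; split=> c cx; exact: (derivableN (hx c cx)). Qed.

Lemma hol_atM h k x : hol_at h x -> hol_at k x -> hol_at (fun y => h y * k y) x.
Proof. by move=> [hx] [kx]; split=> c cx; exact: (derivableM (hx c cx) (kx c cx)). Qed.

Lemma hol_atV h x : h x != 0 -> hol_at h x -> hol_at (fun y => (h y)^-1) x.
Proof.
move=> h0 [hx]; split=> c cx; apply: (derivableV _ (hx c cx)).
by rewrite chartK.
Qed.

Lemma hol_at_sum (I : Type) (r : seq I) (h : I -> X -> C) x :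
  (forall i, hol_at (h i) x) -> hol_at (fun y => \sum_(i <- r) h i y) x.
Proof.
move=> hx; elim: r => [|i r IH].
  rewrite (_ : (fun y => _) = fun=> 0); first exact: hol_at_cst.
  by apply/funext => y; rewrite big_nil.
rewrite (_ : (fun y => _) = fun y => h i y + \sum_(i <- r) h i y).
  exact: (hol_atD (hx i) IH).
by apply/funext => y; rewrite big_cons.
Qed.

Lemma hol_at_continuous h x : hol_at h x -> {for x, continuous h}.
Proof.
have [c cx] := chart_exists x => -[/(_ c cx)]/derivableP_slope/slope_continuous hc.
have hx : (fun y => h (cbwd c (cfwd c y))) @ x --> h x.
  rewrite -{2}(chartK cx); exact: (cvg_comp _ _ (cfwd_cvg cx) hc).
rewrite /prop_for /continuous_at; apply: cvg_trans hx.
apply: near_eq_cvg; near=> y; rewrite chartK//.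
by near: y; exact: cdom_nbhs.
Unshelve. all: by end_near. Qed.

End HolomorphicFunctions.

Arguments hol_at_cst {R X}.

Lemma hol_at_comp (R : realType) (X Y : surface R) (p : X -> Y) (h : Y -> cplx R) x :
  riemann_surface X -> riemann_surface Y ->
  hol_map p -> hol_at h (p x) -> hol_at (h \o p) x.
Proof.
move=> hX hY [pc ph] [hpx]; split=> c cx; have [c' c'x] := chart_exists hY (p x).
have /derivableP_slope ps := ph c' c x c'x cx.
have /derivableP_slope hs := hpx c' c'x.
have := slope_comp ps; rewrite (chartK hX cx) => /(_ _ _ hs) H.
apply: (slope_derivable (slope_near _ H)).
near=> z; rewrite /= chartK//.
near: z; exact: (cbwd_cvg hX cx (pc x _ (cdom_nbhs hY c'x))).
Unshelve. all: by end_near. Qed.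

(** Near f x the function is the conjugate of the holomorphic h read in the
    conjugate of a chart, in which f is holomorphic. *)
Lemma hol_at_conj_comp (R : realType) (X Y : surface R) (f : X -> Y)
    (h : Y -> cplx R) x :
  riemann_surface X -> riemann_surface Y ->
  antihol_map f -> hol_at h (f x) -> hol_at (fun y => (h (f y))^*) x.
Proof.
move=> hX hY [fc fh] [hfx]; split=> c cx; have [c' c'x] := chart_exists hY (f x).
have /derivableP_slope fs := fh c' c x c'x cx.
have /derivableP_slope hs := hfx c' c'x.
have := slope_comp fs; rewrite (chartK hX cx) => H.
have hs' := @slope_conj R (h \o cbwd c') (cfwd c' (f x))^*
  (derive1 (h \o cbwd c') (cfwd c' (f x))).
rewrite conjCK in hs'; have {}H := H _ _ (hs' hs).
apply: (slope_derivable (slope_near _ H)).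
near=> z; rewrite /= conjCK chartK//.
near: z; exact: (cbwd_cvg hX cx (fc x _ (cdom_nbhs hY c'x))).
Unshelve. all: by end_near. Qed.

Lemma compact_attains_max (R : realType) (T : topologicalType) (u : T -> R) (t : T) :
  compact [set: T] -> continuous u -> exists t0, forall t, u t <= u t0.
Proof.
move=> cT uc; have cI : compact (u @` setT).
  by apply: continuous_compact => //; apply: continuous_subspaceT.
have [M [Mr Mb]] := compact_bounded cI.
have su : has_sup (u @` setT).
  split; first by exists (u t), t.
  exists (M + 1) => _ [y _ <-]; apply: (le_trans (ler_norm _)).
  by apply: (Mb (M + 1)); [rewrite ltrDl|exists y].
have : closure (u @` setT) (sup (u @` setT)) by exact: (closure_sup su.1 su.2).
have /closure_id <- : closed (u @` setT).
  by apply: compact_closed cI; exact: Rhausdorff.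
move=> [t0 _ ut0]; exists t0 => y; rewrite ut0.
by apply: sup_upper_bound => //; exists y.
Qed.

Section Liouville.
Variables (R : realType) (X : surface R).
Hypotheses (X_surface : riemann_surface X) (X_compact : compact [set: X])
  (X_connected : connected [set: X]).
Local Notation C := (cplx R).

Lemma Re_continuous : continuous (fun z : C => complex.Re z).
Proof.
move=> z; apply/cvg_dist_ltP => e e0.
have e0C : 0 < (e%:C%C : C) by rewrite ltcR.
apply/nbhs_ballP; exists (e%:C%C : C) => //= w.
rewrite /ball/= => zw.
have -> : complex.Re z - complex.Re w = complex.Re (z - w).
  by case: z {zw} => [? ?]; case: w.
apply: (le_lt_trans (ler_normRe _)).
by have := zw; rewrite ltcE => /andP[_].
Qed.

(** The set where the real part attains its maximum is closed, and open by the
    maximum principle on discs. *)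
Lemma Re_hol_constant (h : X -> C) x y : (forall x, hol_at h x) ->
  complex.Re (h x) = complex.Re (h y).
Proof.
move=> hh; have hc z : {for z, continuous (fun z => complex.Re (h z))}.
  exact: (cvg_comp _ _ (hol_at_continuous X_surface (hh z)) (@Re_continuous _)).
have [t0 t0P] := compact_attains_max x X_compact hc.
pose M := complex.Re (h t0).
have oM : open [set z | complex.Re (h z) = M].
  rewrite openE => z /= zM; rewrite /interior.
  have [c cz] := chart_exists X_surface z.
  have /nbhs_ballP[e /= e0 eP] := near_chart X_surface cz.
  have er : e = (complex.Re e)%:C%C by rewrite RRe_real// gtr0_real.
  have r0 : 0 < complex.Re e by rewrite -ltcR -er.
  have eP' w : `|w - cfwd c z| < (complex.Re e)%:C%C ->
      cdom c (cbwd c w) /\ cfwd c (cbwd c w) = w.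
    by move=> wz; apply: eP; rewrite /ball/= distrC er.
  have disc := @disc_maximum R (fun w => h (cbwd c w)) (cfwd c z) (complex.Re e) r0.
  near=> w.
  have cw : cdom c w by near: w; exact: cdom_nbhs.
  have -> : w = cbwd c (cfwd c w) by rewrite chartK.
  rewrite /= disc; first by rewrite (chartK X_surface cz).
  - by move=> v /eP'[cv vE]; rewrite -vE; have [hv] := hh (cbwd c v); exact: hv.
  - by move=> v _; rewrite (chartK X_surface cz) zM; exact: t0P.
  - near: w; have /cvg_dist_ltP/(_ e e0) := cfwd_cvg X_surface cz.
    by apply: filterS => w; rewrite distrC -er.
have cM : closed [set z | complex.Re (h z) = M].
  apply: (@preimage_closed _ _ (fun z => complex.Re (h z)) [set M]).
    by move=> z _; exact: hc.
  by apply: accessible_closed_set1; apply: hausdorff_accessible; exact: Rhausdorff.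
have /= MT := @X_connected [set z | complex.Re (h z) = M].
have {}MT : [set z | complex.Re (h z) = M] = [set: X].
  apply: MT; first by exists t0.
  - by exists [set z | complex.Re (h z) = M] => //; rewrite setTI.
  - by exists [set z | complex.Re (h z) = M] => //; rewrite setTI.
have eqM z : complex.Re (h z) = M by have : [set: X] z by []; rewrite -MT.
by rewrite !eqM.
Unshelve. all: by end_near. Qed.

Theorem hol_constant (h : X -> C) : (forall x, hol_at h x) -> forall x y, h x = h y.
Proof.
move=> hh x y.
have rexy := Re_hol_constant x y hh.
(* the imaginary part of h is minus the real part of i h *)
have hi z : hol_at (fun w => ('i%C : C) * h w) z.
  exact: (hol_atM (hol_at_cst ('i%C : C) z) (hh z)).
have := Re_hol_constant x y hi.
have ReiM (w : C) : complex.Re (('i%C : C) * w) = - complex.Im w.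
  by case: w => a b /=; rewrite mul0r mul1r sub0r.
rewrite !ReiM => /oppr_inj.
by move: rexy; case: (h x) => a b; case: (h y) => a' b' /= -> ->.
Qed.
End Liouville.

(** * Frames and anti-linear maps *)

Lemma linear_colE (K : fieldType) (V : lmodType K) (r : nat) (phi : 'cV[K]_r -> V) :
  linear phi -> forall a, phi a = \sum_l a l 0 *: phi (delta_mx l 0).
Proof.
move=> lphi a.
pose Phi : {linear 'cV[K]_r -> V} := HB.pack phi (GRing.isLinear.Build K _ _ _ phi lphi).
rewrite -[phi a]/(Phi a) {1}[a]matrix_sum_delta linear_sum; apply: eq_bigr => l _.
by rewrite big_ord1 linearZ.
Qed.

Section Frames.
Variables (R : realType) (X : surface R) (r : nat) (E : bundle X r).
Local Notation C := (cplx R).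

Lemma coordsD x (u v : fiber E x) i : (u + v) i = u i + v i.
Proof. by []. Qed.

Lemma coordsZ x (a : C) (u : fiber E x) i : (a *: u) i = a *: u i.
Proof. by []. Qed.

Lemma coordsN x (u : fiber E x) i : (- u) i = - u i.
Proof. by []. Qed.

Lemma coords0 x i : (0 : fiber E x) i = 0.
Proof. by []. Qed.

Lemma coords_out x (u : fiber E x) i : ~ bdom i x -> u i = 0.
Proof. by have /fiber_predP[u0 _] := coordsP u; exact: u0. Qed.

Lemma coords_trans x (u : fiber E x) i j : bdom i x -> bdom j x ->
  u i = btrans i j x *m u j.
Proof. by have /fiber_predP[_ ug] := coordsP u; exact: ug. Qed.

Lemma fiber_eq x (u v : fiber E x) : (forall i, u i = v i) -> u = v.
Proof. by move=> uv; apply: val_inj; apply/funext. Qed.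

Lemma fiber_ext x (u v : fiber E x) i : bdom i x -> u i = v i -> u = v.
Proof.
move=> ix uv; apply: fiber_eq => j; case: (pselect (bdom j x)) => [jx|jx].
  by rewrite (coords_trans u jx ix) uv -coords_trans.
by rewrite !coords_out.
Qed.

Lemma total_space_ext (u v : total_space E) i : tag u = tag v -> bdom i (tag v) ->
  tagged u i = tagged v i -> u = v.
Proof.
case: u v => [x u] [y v] /= xy; case: y / xy v => v iy uv.
by rewrite (fiber_ext iy uv).
Qed.

Hypothesis E_hol : hol_bundle E.

Lemma bdom_exists x : exists i : bidx E, bdom i x.
Proof. by case: E_hol. Qed.

Definition some_index x : bidx E := sval (cid (bdom_exists x)).

Lemma some_indexP x : bdom (some_index x) x.
Proof. exact: svalP (cid (bdom_exists x)). Qed.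

Lemma btrans1 (i : bidx E) x : bdom i x -> btrans i i x = 1%:M.
Proof. by case: E_hol => _ _ _ + _; apply. Qed.

Lemma btransM (i j k : bidx E) x : bdom i x -> bdom j x -> bdom k x ->
  btrans i j x *m btrans j k x = btrans i k x.
Proof. by case: E_hol => _ _ _ _ + ix jx kx => /(_ i j k x ix jx kx). Qed.

Lemma bdom_nbhs (i : bidx E) x : bdom i x -> nbhs x (bdom i).
Proof. by case: E_hol => /(_ i) o _ _ _ _ ix; apply: open_nbhs_nbhs; split. Qed.

Lemma btrans_hol (i j : bidx E) x k l : bdom i x -> bdom j x ->
  hol_at (fun y => btrans i j y k l) x.
Proof.
by case: E_hol => _ _ /(_ i j k l)/hol_funP H _ _ ix jx; apply: H; split.
Qed.

Lemma frame_subproof (i : bidx E) x (a : 'cV[C]_r) :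
  (fun j : bidx E => if `[< bdom i x /\ bdom j x >] then btrans j i x *m a else 0)
    \in fiber_pred E x.
Proof.
apply/fiber_predP; split=> [j jx|j k jx kx].
  by case: asboolP => // -[].
case: asboolP => [[ix _]|nx].
  by rewrite asboolT// mulmxA btransM.
by case: asboolP => [[ix _]|_]; [case: nx|rewrite mulmx0].
Qed.

(** A section is a function on the whole surface; local frames are therefore
    extended by zero. *)
Definition frame (i : bidx E) x (a : 'cV[C]_r) : fiber E x :=
  Fiber (frame_subproof i x a).

Lemma frameE (i j : bidx E) x a : bdom i x -> bdom j x ->
  frame i x a j = btrans j i x *m a.
Proof. by move=> ix jx; rewrite /= asboolT. Qed.

Lemma frame_id (i : bidx E) x a : bdom i x -> frame i x a i = a.
Proof. by move=> ix; rewrite frameE// btrans1// mul1mx. Qed.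

Lemma frameK (i : bidx E) x (v : fiber E x) : bdom i x -> frame i x (v i) = v.
Proof. by move=> ix; apply: (fiber_ext ix); rewrite frame_id. Qed.

Lemma frame_linear (i : bidx E) x : linear (frame i x).
Proof.
move=> a u v; apply: fiber_eq => j; rewrite coordsD coordsZ /=.
by case: asboolP => _; rewrite ?scaler0 ?addr0// mulmxDr scalemxAr.
Qed.

Lemma hol_sec_frame (U : set X) (i : bidx E) (a : X -> 'cV[C]_r) : 
  (forall x k, U x -> bdom i x -> hol_at (fun y => a y k 0) x) ->
  riemann_surface X ->
  hol_sec (U `&` bdom i) (fun x => frame i x (a x)).
Proof.
move=> ha hX j k; apply/hol_funP => x [[Ux ix] jx].
apply: (hol_at_near hX (h := fun y => \sum_l btrans j i y k l * a y l 0)).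
  near=> y; have iy : bdom i y by near: y; exact: bdom_nbhs.
  have jy : bdom j y by near: y; exact: bdom_nbhs.
  by rewrite frameE// mxE.
apply: hol_at_sum => l; apply: hol_atM; first exact: btrans_hol.
exact: ha.
Unshelve. all: by end_near. Qed.

End Frames.

Lemma hol_sec_at (R : realType) (X : surface R) r (E : bundle X r) (U : set X)
    (s : sec E) i k x : hol_sec U s -> U x -> bdom i x ->
  hol_at (fun y => s y i k 0) x.
Proof. by move=> /(_ i k)/hol_funP H Ux ix; apply: H. Qed.

Section HomMatrix.
Variables (R : realType) (X : surface R) (r r' : nat).
Variables (E : bundle X r) (F : bundle X r').
Hypotheses (X_surface : riemann_surface X) (E_hol : hol_bundle E).
Variable psi : forall x, fiber E x -> fiber F x.
Hypothesis psi_hol : hol_hom psi.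
Local Notation C := (cplx R).

Definition hom_matrix (i : bidx F) (j : bidx E) (x : X) : 'M[C]_(r', r) :=
  \matrix_(k, l) psi (frame E_hol j x (delta_mx l 0)) i k 0.

Lemma hom_matrixE i j x (v : fiber E x) : bdom j x ->
  psi v i = hom_matrix i j x *m v j.
Proof.
move=> jx; rewrite -{1}(frameK E_hol v jx); apply/matrixP => k z; rewrite ord1 mxE.
have lpsi : linear (fun a : 'cV[C]_r => psi (frame E_hol j x a)).
  by move=> a u w; rewrite frame_linear; case: psi_hol => /(_ x) ->.
rewrite (linear_colE lpsi).
have csum (I : Type) (s : seq I) (w : I -> fiber F x) :
    (\sum_(t <- s) w t) i k 0 = \sum_(t <- s) w t i k 0.
  elim: s => [|t s IH]; first by rewrite !big_nil coords0 mxE.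
  by rewrite !big_cons coordsD mxE IH.
by rewrite csum; apply: eq_bigr => l _; rewrite coordsZ !mxE mulrC.
Qed.

Lemma hom_matrix_hol i j k l x : bdom i x -> bdom j x ->
  hol_at (fun y => hom_matrix i j y k l) x.
Proof.
move=> ix jx; case: psi_hol => _ hpsi.
have oj : open (bdom j) by case: E_hol => /(_ j).
have hs : hol_sec (bdom j) (fun y => frame E_hol j y (delta_mx l 0)).
  by rewrite -[bdom j]setTI; apply: (hol_sec_frame (a := fun=> delta_mx l 0)) => //.
have := hol_sec_at k (hpsi _ _ oj hs) jx ix.
by congr hol_at; apply/funext => y; rewrite mxE.
Qed.

End HomMatrix.

Section AntilinearMaps.
Variables (R : realType) (X : surface R) (r : nat) (E : bundle X r) (f : X -> X).
Hypotheses (X_surface : riemann_surface X) (E_hol : hol_bundle E)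
  (f_antihol : antihol_map f) (f_invol : forall x, f (f x) = x).
Local Notation C := (cplx R).
Local Notation "A ^j" := (map_mx Num.conj A) (at level 2).

(** Coordinates of an anti-linear map covering f: the vector v is sent to the
    vector with coordinates P i j x *m conj (v j) in the frame i.  As f is
    antiholomorphic, such a map preserves holomorphy of sections when the
    conjugates of the coefficients are holomorphic. *)
Definition anti_cocycle (P : bidx E -> bidx E -> X -> 'M[C]_r) : Prop :=
  (forall i i' j j' x, bdom i (f x) -> bdom i' (f x) -> bdom j x -> bdom j' x ->
    P i' j' x = btrans i' i (f x) *m P i j x *m (btrans j j' x)^j) /\
  (forall i j k l x, bdom i (f x) -> bdom j x -> hol_at (fun y => (P i j y k l)^*) x).

Definition anti_map (P : bidx E -> bidx E -> X -> 'M[C]_r) (x : X) (v : fiber E x) :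
    fiber E (f x) :=
  let i := some_index E_hol (f x) in let j := some_index E_hol x in
  frame E_hol i (f x) (P i j x *m (v j)^j).

Variable P : bidx E -> bidx E -> X -> 'M[C]_r.
Hypothesis PP : anti_cocycle P.

Lemma anti_mapE i j x (v : fiber E x) : bdom i (f x) -> bdom j x ->
  anti_map P v i = P i j x *m (v j)^j.
Proof.
move=> ix jx; rewrite /anti_map frameE//; last exact: some_indexP.
set i0 := some_index _ _; set j0 := some_index _ _.
have i0x : bdom i0 (f x) by exact: some_indexP.
have j0x : bdom j0 x by exact: some_indexP.
rewrite (PP.1 i0 i j0 j x)// (coords_trans v j0x jx) map_mxM !mulmxA.
by [].
Qed.

Lemma anti_map_lift : antilinear_lift (anti_map P).
Proof.
split=> [x a u v|U s s' oU hs ss'].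
  have ix := some_indexP E_hol (f x); have jx := some_indexP E_hol x.
  apply: (fiber_ext ix); rewrite coordsD coordsZ !(anti_mapE _ ix jx).
  by rewrite coordsD coordsZ map_mxD map_mxZ mulmxDr scalemxAr.
move=> i k; apply/hol_funP => _ [[x Ux <-] ifx].
have jx := some_indexP E_hol x; set j := some_index _ _ in jx.
apply: (hol_at_near X_surface
  (h := fun y => \sum_l P i j (f y) k l * (s (f y) j l 0)^*)).
  have fc : continuous f by case: f_antihol.
  have ofx : \forall y \near f x, bdom j (f y).
    by apply: fc; rewrite f_invol; exact: bdom_nbhs.
  have oUfx : \forall y \near f x, U (f y).
    by apply: fc; rewrite f_invol; apply: open_nbhs_nbhs.
  near=> y.
  have iy : bdom i y by near: y; exact: bdom_nbhs.
  have jy : bdom j (f y) by near: y.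
  have Uy : U (f y) by near: y.
  have -> : s' y i k 0 = s' (f (f y)) i k 0 by rewrite f_invol.
  rewrite ss'// (@anti_mapE i j)//; last by rewrite f_invol.
  by rewrite mxE; apply: eq_bigr => l _; rewrite mxE.
have hc (h : X -> C) : hol_at h x -> hol_at (fun y => (h (f y))^*) (f x).
  move=> hh; apply: (hol_at_conj_comp X_surface X_surface f_antihol).
  by rewrite f_invol.
apply: hol_at_sum => l; apply: hol_atM.
  have := hc _ (PP.2 i j k l x ifx jx).
  by congr hol_at; apply/funext => y; rewrite conjCK.
exact: hc (hol_sec_at l hs Ux jx).
Unshelve. all: by end_near. Qed.

Lemma anti_map_involutive :
  (forall i j x, bdom i x -> bdom j (f x) -> P i j (f x) *m (P j i x)^j = 1%:M) ->
  forall v : total_space E, total_map (anti_map P) (total_map (anti_map P) v) = v.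
Proof.
move=> P1 [x v]; have ix := some_indexP E_hol x; have jx := some_indexP E_hol (f x).
apply: (total_space_ext (i := some_index E_hol x)) => //; first exact: f_invol.
change (anti_map P (anti_map P v) (some_index E_hol x) = v (some_index E_hol x)).
rewrite (anti_mapE _ _ jx) ?f_invol// (anti_mapE _ jx ix) map_mxM mulmxA P1//.
by rewrite mul1mx; apply/matrixP => k l; rewrite !mxE/= conjCK.
Qed.

End AntilinearMaps.

(** * The square of an anti-linear map *)

Lemma mulmx_conj_sqr (K : pzRingType) n (T S T' : 'M[K]_n) : T' *m T = 1%:M ->
  (T *m S *m T') *m (T *m S *m T') = T *m (S *m S) *m T'.
Proof.
move=> TT; rewrite -(mulmxA (T *m S)) (mulmxA T' (T *m S)) (mulmxA T' T) TT.
by rewrite mul1mx !mulmxA.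
Qed.

Section SquareOfAntilinear.
Variables (R : realType) (X : surface R) (r : nat) (E : bundle X r) (f : X -> X).
Hypotheses (X_surface : riemann_surface X) (X_compact : compact [set: X])
  (X_connected : connected [set: X]) (E_hol : hol_bundle E)
  (f_antihol : antihol_map f) (f_invol : forall x, f (f x) = x).
Local Notation C := (cplx R).
Local Notation "A ^j" := (map_mx Num.conj A) (at level 2).
Variable P : bidx E -> bidx E -> X -> 'M[C]_r.
Hypothesis PP : anti_cocycle f P.

(** The matrix in the frame i of the square of the anti-linear map P. *)
Definition anti_square (i j : bidx E) (x : X) : 'M[C]_r :=
  P i j (f x) *m (P j i x)^j.

Lemma mx_conjK m n (A : 'M[C]_(m, n)) : A^j^j = A.
Proof. by apply/matrixP => k l; rewrite !mxE conjCK. Qed.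

Lemma anti_square_trans i i' j j' x : bdom i x -> bdom i' x ->
  bdom j (f x) -> bdom j' (f x) ->
  anti_square i' j' x = btrans i' i x *m anti_square i j x *m btrans i i' x.
Proof.
move=> ix i'x jx j'x; rewrite /anti_square.
rewrite (PP.1 i i' j j' (f x)) ?f_invol// (PP.1 j j' i i' x)//.
have GH : btrans j j' (f x) *m btrans j' j (f x) = 1%:M.
  by rewrite (btransM E_hol)// (btrans1 E_hol).
have := congr1 (map_mx Num.conj) GH; rewrite map_mxM map_mx1 => {}GH.
rewrite !map_mxM -!mulmxA; congr (_ *m (_ *m _)).
by rewrite mulmxA GH mul1mx; congr (_ *m _); exact: mx_conjK.
Qed.

Lemma anti_square_hol i j k l x : bdom i x -> bdom j (f x) ->
  hol_at (fun y => anti_square i j y k l) x.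
Proof.
move=> ix jx; rewrite (_ : (fun y => _) =
    fun y => \sum_m P i j (f y) k m * (P j i y m l)^*); last first.
  by apply/funext => y; rewrite mxE; apply: eq_bigr => m _; rewrite mxE.
apply: hol_at_sum => m; apply: hol_atM; last exact: PP.2.
have := hol_at_conj_comp X_surface X_surface f_antihol (PP.2 i j k m (f x) _ jx).
rewrite f_invol => /(_ ix).
by congr hol_at; apply/funext => y; rewrite conjCK.
Qed.

Lemma trace_conj_btrans (i i' : bidx E) x (M : 'M[C]_r) : bdom i x -> bdom i' x ->
  \tr (btrans i' i x *m M *m btrans i i' x) = \tr M.
Proof.
move=> ix i'x; rewrite mxtrace_mulC mulmxA (btransM E_hol)//.
by rewrite (btrans1 E_hol)// mul1mx.
Qed.

(** The trace of the square is a global holomorphic function. *)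
Lemma anti_square_trace i i' j j' x y : bdom i x -> bdom i' y ->
  bdom j (f x) -> bdom j' (f y) ->
  \tr (anti_square i j x) = \tr (anti_square i' j' y).
Proof.
pose t x := \tr (anti_square (some_index E_hol x) (some_index E_hol (f x)) x).
have tE k l z : bdom k z -> bdom l (f z) -> \tr (anti_square k l z) = t z.
  move=> kz lz.
  have kz' := some_indexP E_hol z; have lz' := some_indexP E_hol (f z).
  by rewrite (anti_square_trans kz' kz lz' lz) trace_conj_btrans.
move=> ix i'y jx j'y; rewrite (tE i j x ix jx) (tE i' j' y i'y j'y).
apply: (hol_constant X_surface X_compact X_connected) => z.
have kz := some_indexP E_hol z; have lz := some_indexP E_hol (f z).
set k := some_index _ _ in kz; set l := some_index _ _ in lz.
apply: (hol_at_near X_surface (h := fun w => \sum_m anti_square k l w m m)).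
  have fc : continuous f by case: f_antihol.
  near=> w; rewrite -(tE k l)//.
    by near: w; exact: (bdom_nbhs E_hol).
  by near: w; apply: fc; exact: (bdom_nbhs E_hol).
by apply: hol_at_sum => m; exact: anti_square_hol.
Unshelve. all: by end_near. Qed.

(** For a square of the form a + b A with A traceless, this second constant
    determines b^2 det A once the trace is known. *)
Lemma anti_square_trace2 i i' j j' x y : bdom i x -> bdom i' y ->
  bdom j (f x) -> bdom j' (f y) ->
  \tr (anti_square i j x *m anti_square i j x) =
  \tr (anti_square i' j' y *m anti_square i' j' y).
Proof.
pose s x := anti_square (some_index E_hol x) (some_index E_hol (f x)) x.
pose t x := \tr (s x *m s x).
have tE k l z : bdom k z -> bdom l (f z) ->
    \tr (anti_square k l z *m anti_square k l z) = t z.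
  move=> kz lz.
  have kz' := some_indexP E_hol z; have lz' := some_indexP E_hol (f z).
  have TT := btransM E_hol kz' kz kz'; rewrite (btrans1 E_hol kz') in TT.
  rewrite (anti_square_trans kz' kz lz' lz) -/(s z) /t.
  rewrite -(trace_conj_btrans (s z *m s z) kz' kz); congr (\tr _).
  exact: mulmx_conj_sqr.
move=> ix i'y jx j'y; rewrite (tE i j x ix jx) (tE i' j' y i'y j'y).
apply: (hol_constant X_surface X_compact X_connected) => z.
have kz := some_indexP E_hol z; have lz := some_indexP E_hol (f z).
set k := some_index _ _ in kz; set l := some_index _ _ in lz.
apply: (hol_at_near X_surface (h := fun w =>
  \sum_m \sum_n anti_square k l w m n * anti_square k l w n m)).
  have fc : continuous f by case: f_antihol.
  near=> w; rewrite -(tE k l).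
  - by apply: eq_bigr => m _; rewrite mxE.
  - by near: w; exact: (bdom_nbhs E_hol).
  - by near: w; apply: fc; exact: (bdom_nbhs E_hol).
apply: hol_at_sum => m; apply: hol_at_sum => n.
by apply: hol_atM; exact: anti_square_hol.
Unshelve. all: by end_near. Qed.

Lemma anti_cocycle_scale (a : C) : anti_cocycle f (fun i j x => a *: P i j x).
Proof.
split=> [i i' j j' x ? ? ? ?|i j k l x ? ?].
  by rewrite (PP.1 i i' j j' x)// -scalemxAr -scalemxAl.
rewrite (_ : (fun y => _) = fun y => a^* * (P i j y k l)^*).
  by apply: hol_atM; [exact: hol_at_cst|exact: PP.2].
by apply/funext => y; rewrite mxE rmorphM.
Qed.

(** Scaling an anti-linear map by b scales its square by |b|^2, so that only a
    positive square can be normalized. *)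
Lemma anti_cocycle_normalize (a : C) : 0 < a ->
  (forall i j x, bdom i x -> bdom j (f x) -> anti_square i j x = a%:M) ->
  exists2 b : C, b != 0 & forall i j x, bdom i x -> bdom j (f x) ->
    (b *: P i j (f x)) *m (b *: P j i x)^j = 1%:M.
Proof.
move=> a0 sqa; exists (sqrtC a)^-1.
  by rewrite invr_eq0 sqrtC_eq0 gt_eqF.
move=> i j x ix jx; rewrite map_mxZ -scalemxAl -scalemxAr scalerA.
rewrite [P i j (f x) *m _](sqa i j x ix jx) /=.
have sr : ((sqrtC a)^-1)^* = (sqrtC a)^-1.
  by apply: CrealP; rewrite realV; apply: ger0_real; rewrite sqrtC_ge0 ltW.
rewrite sr -invfM -expr2 sqrtCK scale_scalar_mx mulVf//.
by rewrite gt_eqF.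
Qed.

End SquareOfAntilinear.

(** On a line the square of v |-> P conj(v) is |P|^2, so positivity of the
    constant square is visible at any point fixed by f. *)
Lemma line_real_structure (R : realType) (X : surface R) (N : bundle X 1) (f : X -> X)
    (P : bidx N -> bidx N -> X -> 'M[cplx R]_1) (x0 : X) :
  riemann_surface X -> compact [set: X] -> connected [set: X] ->
  hol_bundle N -> antihol_map f -> (forall x, f (f x) = x) ->
  anti_cocycle f P -> f x0 = x0 ->
  (forall i j, bdom i (f x0) -> bdom j x0 -> P i j x0 0 0 != 0) ->
  exists P' : bidx N -> bidx N -> X -> 'M[cplx R]_1, anti_cocycle f P' /\
    forall i j x, bdom i x -> bdom j (f x) ->
      P' i j (f x) *m map_mx Num.conj (P' j i x) = 1%:M.
Proof.
move=> hX cX kX hN fa ff PP fx0 Pn0.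
have ix0 := some_indexP hN x0; set i0 := some_index hN x0 in ix0.
have ifx0 : bdom i0 (f x0) by rewrite fx0.
have sqE i j x : bdom i x -> bdom j (f x) ->
    anti_square f P i j x = (`|P i0 i0 x0 0 0| ^+ 2)%:M.
  move=> ix jx; rewrite [LHS]mx11_scalar; congr (_%:M).
  have := anti_square_trace hX cX kX hN fa ff PP ix ix0 jx ifx0.
  rewrite !trace_mx11 => ->.
  by rewrite /anti_square fx0 !mxE big_ord1 !mxE normCK.
have a0 : 0 < `|P i0 i0 x0 0 0| ^+ 2.
  by rewrite exprn_gt0// normr_gt0; apply: Pn0.
have [b b0 bP] := anti_cocycle_normalize a0 sqE.
by exists (fun i j x => b *: P i j x); split=> //; exact: anti_cocycle_scale.
Qed.

(** * Matrices of size two *)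

Section TwoByTwo.
Variable K : numFieldType.

Lemma mx22P (A B : 'M[K]_2) : A 0 0 = B 0 0 -> A 0 1 = B 0 1 ->
  A 1 0 = B 1 0 -> A 1 1 = B 1 1 -> A = B.
Proof.
move=> a00 a01 a10 a11; apply/matrixP => i j.
have ord2 (k : 'I_2) : k = 0 \/ k = 1.
  by case: k => [[|[|//]] k2]; [left|right]; apply: val_inj.
by case: (ord2 i) => ->; case: (ord2 j) => ->.
Qed.

Lemma mulmx22 (A : 'M[K]_2) n (B : 'M[K]_(2, n)) i j :
  (A *m B) i j = A i 0 * B 0 j + A i 1 * B 1 j.
Proof.
rewrite mxE !big_ord_recl big_ord0 addr0.
by congr (_ * _ + A i _ * B _ j); apply: val_inj.
Qed.

Lemma mulmx12 m (x : 'M[K]_(m, 2)) n (A : 'M[K]_(2, n)) i j :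
  (x *m A) i j = x i 0 * A 0 j + x i 1 * A 1 j.
Proof.
rewrite mxE !big_ord_recl big_ord0 addr0.
by congr (_ * _ + x i _ * A _ j); apply: val_inj.
Qed.

Lemma tr22 (A : 'M[K]_2) : \tr A = A 0 0 + A 1 1.
Proof.
rewrite /mxtrace !big_ord_recl big_ord0 addr0.
by congr (_ + A _ _); apply: val_inj.
Qed.

Lemma det22 (A : 'M[K]_2) : \det A = A 0 0 * A 1 1 - A 0 1 * A 1 0.
Proof.
rewrite (expand_det_row _ 0) !big_ord_recl big_ord0 addr0 /cofactor !det_mx11 !mxE/=.
rewrite expr0 expr1 mul1r mulN1r mulrN.
by congr (_ * A _ _ - A _ _ * A _ _); apply: val_inj.
Qed.

Lemma traceless22 (A : 'M[K]_2) : \tr A = 0 -> A 1 1 = - A 0 0.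
Proof. by rewrite tr22 => /eqP; rewrite addr_eq0 => /eqP ->; rewrite opprK. Qed.

Lemma neq0_mx22 (A : 'M[K]_2) : \tr A = 0 -> A != 0 ->
  [\/ A 0 0 != 0, A 0 1 != 0 | A 1 0 != 0].
Proof.
move=> /traceless22 a11 An0; apply/or3P; apply: contraNT An0.
rewrite !negb_or !negbK => /and3P[/eqP a00 /eqP a01 /eqP a10].
by apply/eqP; apply: mx22P; rewrite !mxE ?a11 ?a00 ?oppr0.
Qed.

Lemma traceless_sqr (A : 'M[K]_2) : \tr A = 0 -> A *m A = (- \det A)%:M.
Proof.
move=> /traceless22 a11.
apply: mx22P; rewrite mulmx22 !mxE/= det22 ?mulr1n ?mulr0n a11; ring.
Qed.

(** Traceless matrices commute exactly when the vectors of their entries are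
    parallel: the entries of the commutator are, up to a factor 2, those of the
    vector product. *)
Lemma commuting_traceless (A N : 'M[K]_2) : \tr A = 0 -> \tr N = 0 -> A != 0 ->
  A *m N = N *m A -> exists b, N = b *: A.
Proof.
move=> trA trN An0 AN; have a11 := traceless22 trA; have n11 := traceless22 trN.
have e00 : A 0 1 * N 1 0 = N 0 1 * A 1 0.
  have := congr1 (fun M : 'M_2 => M 0 0) AN; rewrite /= !mulmx22 mulrC.
  by move/addrI.
have two0 : (2 : K) != 0 by rewrite pnatr_eq0.
have e01 : A 0 0 * N 0 1 = N 0 0 * A 0 1.
  have := congr1 (fun M : 'M_2 => M 0 1) AN; rewrite /= !mulmx22 a11 n11 => H.
  apply: (mulfI two0); apply/eqP; rewrite -subr_eq0; apply/eqP.
  have : A 0 0 * N 0 1 + A 0 1 * - N 0 0 - (N 0 0 * A 0 1 + N 0 1 * - A 0 0) = 0.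
    by rewrite H subrr.
  by move=> <-; ring.
have e10 : A 0 0 * N 1 0 = N 0 0 * A 1 0.
  have := congr1 (fun M : 'M_2 => M 1 0) AN; rewrite /= !mulmx22 a11 n11 => H.
  apply: (mulfI two0); apply/eqP; rewrite -subr_eq0; apply/eqP.
  have : N 1 0 * A 0 0 + - N 0 0 * A 1 0 - (A 1 0 * N 0 0 + - A 0 0 * N 1 0) = 0.
    by rewrite H subrr.
  by move=> <-; ring.
have fin b : N 0 0 = b * A 0 0 -> N 0 1 = b * A 0 1 -> N 1 0 = b * A 1 0 ->
    N = b *: A.
  move=> h0 h1 h2; apply: mx22P; rewrite mxE//.
  by rewrite n11 a11 mulrN h0.
case: (neq0_mx22 trA An0) => an0.
- exists (N 0 0 / A 0 0); apply: fin; first by rewrite divfK.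
    by rewrite mulrAC -e01 mulrAC divff// mul1r.
  by rewrite mulrAC -e10 mulrAC divff// mul1r.
- exists (N 0 1 / A 0 1); apply: fin; last 2 first.
  + by rewrite divfK.
  + by rewrite mulrAC -e00 mulrAC divff// mul1r.
  + by rewrite mulrAC [N 0 1 * _]mulrC e01 mulfK.
- exists (N 1 0 / A 1 0); apply: fin; last 1 first.
  + by rewrite divfK.
  + by rewrite mulrAC [N 1 0 * _]mulrC e10 mulfK.
  + by rewrite mulrAC [N 1 0 * _]mulrC e00 mulfK.
Qed.

(** A matrix of size two with two independent eigenvectors for the same
    eigenvalue is scalar, and a traceless scalar matrix vanishes. *)
Lemma left_eigenline (A : 'M[K]_2) (a : K) (x y : 'rV[K]_2) : \tr A = 0 -> A != 0 ->
  x != 0 -> x *m A = a *: x -> y *m A = a *: y -> exists m, y = m *: x.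
Proof.
move=> trA An0 xn0 xA yA.
pose D := x 0 0 * y 0 1 - x 0 1 * y 0 0.
have E (z : 'rV_2) : z *m A = a *: z ->
    (z 0 0 * (A 0 0 - a) = - (z 0 1 * A 1 0)) /\ (z 0 0 * A 0 1 = z 0 1 * (a - A 1 1)).
  move=> zA; have := congr1 (fun M : 'rV_2 => M 0 0) zA.
  have := congr1 (fun M : 'rV_2 => M 0 1) zA.
  rewrite /= !mulmx12 !mxE => h1 h0; split.
    by rewrite mulrBr [z 0 0 * a]mulrC -h0; ring.
  by rewrite mulrBr [z 0 1 * a]mulrC -h1; ring.
have [x0 x1] := E _ xA; have [y0 y1] := E _ yA.
have D0 : D = 0.
  apply/eqP; apply: contraNT An0 => Dn0.
  have z (t : K) : D * t = 0 -> t = 0.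
    by move/eqP; rewrite mulf_eq0 (negbTE Dn0) => /eqP.
  have a10 : A 1 0 = 0.
    apply: z; rewrite /D.
    have -> : (x 0 0 * y 0 1 - x 0 1 * y 0 0) * A 1 0 =
      x 0 0 * (y 0 1 * A 1 0) - y 0 0 * (x 0 1 * A 1 0) by ring.
    by rewrite -[y 0 1 * _]opprK -[x 0 1 * A 1 0]opprK -x0 -y0; ring.
  have a00 : A 0 0 - a = 0.
    apply: z; rewrite /D.
    have -> : (x 0 0 * y 0 1 - x 0 1 * y 0 0) * (A 0 0 - a) =
      y 0 1 * (x 0 0 * (A 0 0 - a)) - x 0 1 * (y 0 0 * (A 0 0 - a)) by ring.
    by rewrite x0 y0; ring.
  have a01 : A 0 1 = 0.
    apply: z; rewrite /D.
    have -> : (x 0 0 * y 0 1 - x 0 1 * y 0 0) * A 0 1 =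
      y 0 1 * (x 0 0 * A 0 1) - x 0 1 * (y 0 0 * A 0 1) by ring.
    by rewrite x1 y1; ring.
  have a11 : a - A 1 1 = 0.
    apply: z; rewrite /D.
    have -> : (x 0 0 * y 0 1 - x 0 1 * y 0 0) * (a - A 1 1) =
      x 0 0 * (y 0 1 * (a - A 1 1)) - y 0 0 * (x 0 1 * (a - A 1 1)) by ring.
    by rewrite -x1 -y1; ring.
  have aA : A 0 0 = a by exact: subr0_eq.
  have aA1 : A 1 1 = a by rewrite -(subr0_eq a11).
  have two0 : (2 : K) != 0 by rewrite pnatr_eq0.
  have a0 : a = 0.
    by apply: (mulfI two0); rewrite mulr0 -trA tr22 aA aA1; ring.
  by apply/eqP; apply: mx22P; rewrite ?mxE ?aA ?aA1 ?a0.
have xx : x 0 0 != 0 \/ x 0 1 != 0.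
  apply/orP; apply: contraNT xn0; rewrite negb_or !negbK => /andP[/eqP h0 /eqP h1].
  apply/eqP/matrixP => i j; rewrite ord1 mxE.
  have [->|->] : j = 0 \/ j = 1.
    by case: j => [[|[|//]] k2]; [left|right]; apply: val_inj.
  exact: h0. exact: h1.
have D1 : x 0 0 * y 0 1 = x 0 1 * y 0 0 by apply/eqP; rewrite -subr_eq0 -/D D0.
have fin m : y 0 0 = m * x 0 0 -> y 0 1 = m * x 0 1 -> y = m *: x.
  move=> h0 h1; apply/matrixP => i j; rewrite ord1 !mxE.
  have [->|->] : j = 0 \/ j = 1.
    by case: j => [[|[|//]] k2]; [left|right]; apply: val_inj.
  exact: h0. exact: h1.
case: xx => h.
- exists (y 0 0 / x 0 0); apply: fin; first by rewrite divfK.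
  by rewrite mulrAC [y 0 0 * _]mulrC -D1 mulrC mulKf.
- exists (y 0 1 / x 0 1); apply: fin; last by rewrite divfK.
  by rewrite mulrAC [y 0 1 * _]mulrC D1 mulrC mulKf.
Qed.

End TwoByTwo.

(** * The coefficients of a Higgs field *)

Lemma slope_mul_vanishing (K : numFieldType) (F G : K -> K) (z0 d e : K) :
  slope_at F z0 d -> slope_at G z0 e -> F z0 = 0 -> G z0 = 0 ->
  slope_at (fun z => F z * G z) z0 0.
Proof.
move=> [g [Fg g0 gc]] /slope_continuous Gc F0 G0; exists (fun z => g z * G z); split.
- by move=> z; rewrite F0 mul0r add0r (Fg z) F0 add0r mulrAC.
- by rewrite G0 mulr0.
- exact: (cvgM gc Gc).
Qed.

Section HiggsMatrix.
Variables (R : realType) (X : surface R).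
Hypothesis X_surface : riemann_surface X.
Local Notation C := (cplx R).

Lemma chart_transM (c c' c'' : chart X) x : cdom c x -> cdom c' x -> cdom c'' x ->
  btrans (b := canonical_bundle X) c c'' x =
  btrans (b := canonical_bundle X) c c' x *m btrans (b := canonical_bundle X) c' c'' x.
Proof.
move=> cx c'x c''x; rewrite /= -scalar_mxM; congr (_%:M).
case: (X_surface) => _ _ _ tx.
have /derivableP_slope s1 := tx c c' x cx c'x.
have /derivableP_slope s2 := tx c' c'' x c'x c''x.
have := slope_comp s1; rewrite (chartK X_surface cx) => /(_ _ _ s2) s3.
rewrite mulrC; apply: slope_derive1; apply: slope_near s3; near=> z.
rewrite /= (chartK X_surface)//; near: z.
exact: (cbwd_cvg X_surface cx (cdom_nbhs X_surface c'x)).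
Unshelve. all: by end_near. Qed.

Lemma chart_trans1 (c : chart X) x : cdom c x ->
  btrans (b := canonical_bundle X) c c x = 1%:M.
Proof.
move=> cx; rewrite /=; congr (_%:M); apply: slope_derive1.
apply: (@slope_near _ id).
  near=> z; have [_ zE] : cdom c (cbwd c z) /\ cfwd c (cbwd c z) = z.
    by near: z; exact: near_chart.
  by rewrite zE.
by apply: is_derive_slope; exact: is_derive_id.
Unshelve. all: by end_near. Qed.

Variables (r : nat) (E : bundle X r) (Phi : higgs_field E).
Hypotheses (E_hol : hol_bundle E) (Phi_hol : hol_hom Phi).

(** The coefficient matrix A of Phi = A dz_c in the frame i. *)
Definition higgs_mx (i : bidx E) (c : chart X) (x : X) : 'M[C]_r :=
  hom_matrix E_hol Phi (i, c) i x.

Lemma higgs_mxE i c x (v : fiber E x) : bdom i x ->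
  Phi v (i, c) = higgs_mx i c x *m v i.
Proof. by move=> ix; rewrite (hom_matrixE E_hol Phi_hol (i, c) v ix). Qed.

Lemma higgs_mxP (i : bidx E) (c : chart X) (x : X) : bdom i x -> cdom c x ->
  higgs_matrix Phi x i c (higgs_mx i c x).
Proof. by move=> ix cx; split=> // v; exact: higgs_mxE. Qed.

Lemma higgs_mx_hol i c k l x : bdom i x -> cdom c x ->
  hol_at (fun y => higgs_mx i c y k l) x.
Proof.
by move=> ix cx; apply: (hom_matrix_hol X_surface E_hol Phi_hol).
Qed.

Lemma higgs_mx_chart i c c' x : bdom i x -> cdom c x -> cdom c' x ->
  higgs_mx i c x = btrans (b := canonical_bundle X) c c' x 0 0 *: higgs_mx i c' x.
Proof.
move=> ix cx c'x; apply/matrixP => k l.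
have := coords_trans (Phi (frame E_hol i x (delta_mx l 0))) (i := (i, c))
  (j := (i, c')) (conj ix cx) (conj ix c'x).
rewrite !higgs_mxE// frame_id// => /(congr1 (fun M : 'cV_r => M k 0)) /=.
rewrite (btrans1 E_hol)// -scalemxAl mul1mx -!colE !mxE => ->.
by rewrite mulr1n.
Qed.

(** The derivatives of chart changes are holomorphic because they are the ratios
    of the coefficients of a Higgs field in two charts, the denominator being
    nonzero where this field does not vanish. *)
Lemma canonical_bundle_hol :
  (forall i c x, bdom i x -> cdom c x -> higgs_mx i c x != 0) ->
  hol_bundle (canonical_bundle X).
Proof.
move=> An0; split.
- by move=> c; case: (X_surface) => _ _ /(_ c)[].
- by move=> x; exact: chart_exists.
- move=> c c' k l; apply/hol_funP => x [cx c'x].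
  have ix := some_indexP E_hol x; set i := some_index _ _ in ix.
  have [a [b ab]] : exists a b, higgs_mx i c' x a b != 0.
    apply: contrapT => H; move/negP: (An0 i c' x ix c'x); apply.
    apply/eqP/matrixP => a b; rewrite [RHS]mxE; apply/eqP; apply: contrapT => /negP ab.
    by apply: H; exists a, b.
  have ac := hol_at_continuous X_surface (higgs_mx_hol a b ix c'x).
  apply: (hol_at_near X_surface
    (h := fun y => higgs_mx i c y a b * (higgs_mx i c' y a b)^-1)).
    near=> y.
    have iy : bdom i y by near: y; exact: (bdom_nbhs E_hol).
    have cy : cdom c y by near: y; exact: (cdom_nbhs X_surface).
    have c'y : cdom c' y by near: y; exact: (cdom_nbhs X_surface).
    have aby : higgs_mx i c' y a b != 0.
      near: y; exact: (cvgr_neq0 _ ac ab).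
    have -> : higgs_mx i c y a b =
        btrans (b := canonical_bundle X) c c' y 0 0 * higgs_mx i c' y a b.
      by rewrite (higgs_mx_chart iy cy c'y) [LHS]mxE.
    by rewrite mulfK// (ord1 k) (ord1 l).
  apply: hol_atM; first exact: higgs_mx_hol.
  by apply: (hol_atV X_surface ab); exact: higgs_mx_hol.
- by move=> c x cx; exact: chart_trans1.
- by move=> c c' c'' x cx c'x c''x; exact: chart_transM.
Unshelve. all: by end_near. Qed.

End HiggsMatrix.

Section SL2Higgs.
Variables (R : realType) (X : surface R) (E : bundle X 2) (Phi : higgs_field E).
Hypotheses (X_surface : riemann_surface X) (E_higgs : SL2_higgs_bundle Phi).
Variable q : sec (quadratic X).
Hypotheses (q_simple : simple_zeros q) (q_char : higgs_char Phi q).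
Local Notation C := (cplx R).

Hypothesis E_hol : hol_bundle E.
Let Phi_hol : hol_hom Phi. Proof. by case: E_higgs. Qed.
Local Notation hA := (higgs_mx Phi E_hol).

Lemma higgs_mx_tr i c x : bdom i x -> cdom c x -> \tr (hA i c x) = 0.
Proof.
move=> ix cx; case: E_higgs => _ _ _; apply; exact: (higgs_mxP E_hol Phi_hol ix cx).
Qed.

Lemma higgs_mx_det i c x : bdom i x -> cdom c x -> q x (c, c) 0 0 = - \det (hA i c x).
Proof. by move=> ix cx; apply: q_char; exact: (higgs_mxP E_hol Phi_hol ix cx). Qed.

Lemma q_eq0 x (c : chart X) : cdom c x -> q x (c, c) 0 0 = 0 -> q x = 0.
Proof.
move=> cx q0; apply: (fiber_ext (i := (c, c) : bidx (quadratic X))) => //.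
by apply/matrixP => k l; rewrite !ord1 q0 coords0 mxE.
Qed.

(** Where all entries of A vanish, q = - det A vanishes to second order. *)
Lemma higgs_mx_neq0 i c x : bdom i x -> cdom c x -> hA i c x != 0.
Proof.
move=> ix cx; apply/eqP => A0.
have qx : q x = 0.
  apply: (q_eq0 cx).
  by rewrite (higgs_mx_det ix cx) A0 det22 !mxE mul0r subrr oppr0.
have /eqP := q_simple cx qx; apply; apply: slope_derive1.
have As k l : exists d, slope_at (fun z => hA i c (cbwd c z) k l) (cfwd c x) d.
  have [/(_ c cx)/derivableP_slope] := higgs_mx_hol X_surface E_hol Phi_hol k l ix cx.
  by eexists; eassumption.
have A0' k l : hA i c (cbwd c (cfwd c x)) k l = 0.
  by rewrite (chartK X_surface cx) A0 mxE.
have [d00 s00] := As 0 0; have [d01 s01] := As 0 1.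
have [d10 s10] := As 1 0; have [d11 s11] := As 1 1.
have /slope_is_derive h1 := slope_mul_vanishing s00 s11 (A0' 0 0) (A0' 1 1).
have /slope_is_derive h2 := slope_mul_vanishing s01 s10 (A0' 0 1) (A0' 1 0).
apply: is_derive_slope.
have := is_deriveB h2 h1; rewrite subrr; apply: near_eq_is_derive.
near=> z.
have [cz _] : cdom c (cbwd c z) /\ cfwd c (cbwd c z) = z.
  by near: z; exact: near_chart.
have iz : bdom i (cbwd c z).
  by near: z; exact: (cbwd_cvg X_surface cx (bdom_nbhs E_hol ix)).
by rewrite (higgs_mx_det iz cz) det22 opprB.
Unshelve. all: by end_near. Qed.

Lemma canonical_hol : hol_bundle (canonical_bundle X).
Proof.
exact: (canonical_bundle_hol X_surface Phi_hol higgs_mx_neq0).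
Qed.

End SL2Higgs.

(** * The anti-linear map of a fixed Higgs bundle *)

(** The chain rule for the identity f o f = id. *)
Lemma conj_jac_inv (R : realType) (X : surface R) (f : X -> X) (c c' : chart X) x :
  riemann_surface X -> antihol_map f -> (forall x, f (f x) = x) ->
  cdom c x -> cdom c' (f x) ->
  conj_jac f c c' (f x) * (conj_jac f c' c x)^* = 1.
Proof.
move=> hX [fc fh] ff cx c'x.
have cx' : cdom c (f (f x)) by rewrite ff.
have /derivableP_slope sF := fh c' c x c'x cx.
have /derivableP_slope sG := fh c c' (f x) cx' c'x.
change (slope_at (fun z : cplx R => (cfwd c' (f (cbwd c z)))^*) (cfwd c x)
  (conj_jac f c' c x)) in sF.
change (slope_at (fun z : cplx R => (cfwd c (f (cbwd c' z)))^*) (cfwd c' (f x))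
  (conj_jac f c c' (f x))) in sG.
have := @slope_conj R (fun z => (cfwd c' (f (cbwd c z)))^*) (cfwd c x)^* _.
rewrite conjCK => /(_ _ sF) sF'.
have := slope_comp sF'; rewrite !conjCK (chartK hX cx) => /(_ _ _ sG) s1.
apply: (slope_unique s1); apply: (@slope_near _ id); last first.
  by apply: is_derive_slope; exact: is_derive_id.
have conjc : (fun w : cplx R => w^*) @ (cfwd c x)^* --> cfwd c x.
  by have := @conj_continuous R (cfwd c x)^*; rewrite /continuous_at conjCK.
near=> w.
have [cw cwE] : cdom c (cbwd c w^*) /\ cfwd c (cbwd c w^*) = w^*.
  by near: w; exact: (conjc _ (near_chart hX cx)).
have c'w : cdom c' (f (cbwd c w^*)).
  near: w; exact: (conjc _ (cbwd_cvg hX cx (fc x _ (cdom_nbhs hX c'x)))).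
by rewrite /= !conjCK (chartK hX c'w) ff cwE conjCK.
Unshelve. all: by end_near. Qed.

Lemma mulmx_col_inj (K : pzRingType) m n (A B : 'M[K]_(m, n)) :
  (forall a : 'cV_n, A *m a = B *m a) -> A = B.
Proof.
move=> AB; apply/matrixP => k l.
by have := congr1 (fun M : 'cV_m => M k 0) (AB (delta_mx l 0)); rewrite -!colE !mxE.
Qed.

Lemma tensE (R : realType) (X : surface R) r (E : bundle X r) (N : bundle X 1) x
    (u : fiber E x) (v : fiber N x) i j : tens u v (i, j) = v j 0 0 *: u i.
Proof. by []. Qed.

Section HomMatrixTheory.
Variables (R : realType) (X : surface R) (r r' : nat).
Variables (E : bundle X r) (F : bundle X r').
Hypotheses (E_hol : hol_bundle E).
Variable psi : forall x, fiber E x -> fiber F x.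
Hypothesis psi_hol : hol_hom psi.
Local Notation M := (hom_matrix E_hol psi).

Lemma hom_matrix_trans i i' j j' x : bdom i x -> bdom i' x -> bdom j x -> bdom j' x ->
  M i' j' x = btrans i' i x *m M i j x *m btrans j j' x.
Proof.
move=> ix i'x jx j'x; apply: mulmx_col_inj => a.
rewrite -[in LHS](frame_id E_hol a j'x) -(hom_matrixE E_hol psi_hol i' _ j'x).
rewrite (coords_trans _ i'x ix) (hom_matrixE E_hol psi_hol i _ jx).
by rewrite (coords_trans _ jx j'x) (frame_id E_hol a j'x) !mulmxA.
Qed.

Lemma hom_matrix_inj i j x (a : 'cV_r) : injective (@psi x) -> bdom i x -> bdom j x ->
  M i j x *m a = 0 -> a = 0.
Proof.
move=> psi_inj ix jx Ma; rewrite -(frame_id E_hol a jx).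
have -> : frame E_hol j x a = 0; last by rewrite coords0.
apply: psi_inj; apply: (fiber_ext ix).
by rewrite !(hom_matrixE E_hol psi_hol i _ jx) frame_id// Ma coords0 mulmx0.
Qed.

End HomMatrixTheory.

Lemma hol_iso_inj (R : realType) (X : surface R) r (E F : bundle X r)
    (psi : forall x, fiber E x -> fiber F x) : hol_iso psi -> forall x, injective (psi x).
Proof. by move=> [_ [psi' [_ /[swap] x /(_ x)[c _]]]]; exact: can_inj c. Qed.

Lemma det_bundle_hol (R : realType) (X : surface R) (E : bundle X 2) :
  hol_bundle E -> hol_bundle (det_bundle E).
Proof.
move=> hE; have [h1 h2 h3 h4 h5] := hE; split=> //.
- move=> i j k l; apply/hol_funP => x [ix jx].
  pose g y : 'M[cplx R]_2 := @btrans _ _ _ E i j y.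
  have gh a b : hol_at (fun y => g y a b) x by exact: (btrans_hol hE).
  rewrite (_ : (fun y => _) = fun y => g y 0 0 * g y 1 1 + - (g y 0 1 * g y 1 0)).
    exact: (hol_atD (hol_atM (gh 0 0) (gh 1 1)) (hol_atN (hol_atM (gh 0 1) (gh 1 0)))).
  by apply/funext => y /=; rewrite !ord1 mxE mulr1n det22.
- by move=> i x ix; rewrite /= (btrans1 hE ix) det1.
- move=> i j k x ix jx kx.
  by rewrite /= -(btransM hE ix jx kx) det_mulmx scalar_mxM.
Qed.

Section Symplectic.
Variable K : numFieldType.

(** The standard symplectic form on a plane.  It identifies a plane with its
    dual up to the determinant, and the transpose of a traceless matrix A
    with - A. *)
Definition symplectic_mx : 'M[K]_2 :=
  \matrix_(i, j) ((i == 0) && (j == 1))%:R - \matrix_(i, j) ((i == 1) && (j == 0))%:R.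
Local Notation J := symplectic_mx.

Lemma symplecticE : [/\ J 0 0 = 0, J 0 1 = 1, J 1 0 = -1 & J 1 1 = 0].
Proof. by split; rewrite !mxE/= ?subr0 ?sub0r ?subrr ?oppr0. Qed.

Lemma symplectic_conj (g : 'M[K]_2) : g *m J *m g^T = \det g *: J.
Proof.
have [j00 j01 j10 j11] := symplecticE.
by apply: mx22P; rewrite [RHS]mxE !mulmx22 ![g^T _ _]mxE j00 j01 j10 j11 det22; ring.
Qed.

Lemma symplectic_inv_tr (g : 'M[K]_2) : g \in unitmx ->
  J *m (invmx g)^T = (\det g)^-1 *: (g *m J).
Proof.
move=> ug; have dg : \det g != 0 by rewrite -unitfE -unitmxE.
have ugT : g^T \in unitmx by rewrite unitmx_tr.
rewrite -(mulmxK ugT (g *m J)) symplectic_conj trmx_inv -scalemxAl scalerA.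
by rewrite mulVf// scale1r.
Qed.

Lemma symplectic_tr (A : 'M[K]_2) : \tr A = 0 -> J *m A^T = - (A *m J).
Proof.
move=> /traceless22 a11; have [j00 j01 j10 j11] := symplecticE.
apply: mx22P; rewrite [RHS]mxE !mulmx22 ![A^T _ _]mxE ?j00 ?j01 ?j10 ?j11 ?a11; ring.
Qed.

Lemma symplectic_inj (a : 'cV[K]_2) : J *m a = 0 -> a = 0.
Proof.
have [j00 j01 j10 j11] := symplecticE => Ja.
have := congr1 (fun M : 'cV_2 => M 0 0) Ja; have := congr1 (fun M : 'cV_2 => M 1 0) Ja.
rewrite /= !mulmx22 j00 j01 j10 j11 ![(0 : 'cV_2) _ _]mxE !mul0r mulN1r mul1r.
rewrite addr0 add0r => /eqP; rewrite oppr_eq0 => /eqP a0 a1.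
apply/matrixP => i j; rewrite ord1 mxE.
have [->|->//] : i = 0 \/ i = 1.
  by case: i => [[|[|//]] k2]; [left|right]; apply: val_inj.
exact: a0.
Qed.

End Symplectic.

Section FixedHiggs.
Variables (R : realType) (X : surface R) (E : bundle X 2) (Phi : higgs_field E)
  (f : X -> X).
Hypotheses (X_surface : riemann_surface X) (E_higgs : SL2_higgs_bundle Phi)
  (f_antihol : antihol_map f) (f_invol : forall x, f (f x) = x).
Variable q : sec (quadratic X).
Hypotheses (q_simple : simple_zeros q) (q_char : higgs_char Phi q).
Hypothesis E_hol : hol_bundle E.
Local Notation C := (cplx R).
Local Notation "A ^j" := (map_mx Num.conj A) (at level 2).
Local Notation hA := (higgs_mx Phi E_hol).
Local Notation J := (symplectic_mx C).

Lemma mx_conj_trK m n (A : 'M[C]_(m, n)) : (A^j^T)^j = A^T.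
Proof. by apply/matrixP => k l; rewrite !mxE/= conjCK. Qed.

Lemma btrans_unit (i j : bidx E) x : bdom i x -> bdom j x -> btrans i j x \in unitmx.
Proof.
move=> ix jx; have := btransM E_hol ix jx ix; rewrite (btrans1 E_hol ix).
by case/mulmx1_unit.
Qed.

(** The isomorphism of E with the conjugate pull-back of its dual, composed with
    the isomorphism of the dual with E given by a trivialization d of det E and
    the symplectic form, is an anti-linear endomorphism of E.  The transpose in
    the dual Higgs field turns into a sign. *)
Lemma fixed_higgs_lift : fixed_higgs f Phi ->
  exists P : bidx E -> bidx E -> X -> 'M[C]_2,
  [/\ anti_cocycle f P,
      forall (i j : bidx E) c c' x, bdom i (f x) -> bdom j x -> cdom c x -> cdom c' (f x) ->
        hA i c' (f x) *m P i j x =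
        - conj_jac f c c' (f x) *: (P i j x *m (hA j c x)^j) &
      forall (i j : bidx E) x (a : 'cV[C]_2), bdom i (f x) -> bdom j x ->
        P i j x *m a = 0 -> a = 0].
Proof.
move=> [Psi [PsiP [psi [psi_iso psiPhi]]]].
have [_ [delta delta_iso] Phi_hol Phi_tr] := E_higgs.
have psi_hol := psi_iso.1; have delta_hol := delta_iso.1.
have hdet := det_bundle_hol E_hol.
pose ii (i : bidx E) : bidx (conj_pull f (dual E)) := i.
pose Q (i j : bidx E) x : 'M[C]_2 := hom_matrix E_hol psi (ii i) j x.
pose d (i : bidx E) x : C := hom_matrix hdet delta tt i x 0 0.
have dT (i j : bidx E) x : bdom i x -> bdom j x -> d j x = d i x * \det (btrans i j x).
  move=> ix jx.
  rewrite /d (hom_matrix_trans hdet delta_hol (i := tt) (i' := tt) (j := i) (j' := j))//.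
  by rewrite /= mul1mx mul_mx_scalar mxE mulrC.
have dn0 (i : bidx E) x : bdom i x -> d i x != 0.
  move=> ix; apply/eqP => d0.
  have : (1%:M : 'cV[C]_1) = 0.
    apply: (hom_matrix_inj delta_hol (i := tt) (j := i) (hol_iso_inj delta_iso (x := x))) => //.
    rewrite mulmx1; apply/matrixP => k l; rewrite !ord1 [RHS]mxE; exact: d0.
  by move/matrixP => /(_ 0 0) /eqP; rewrite !mxE oner_eq0.
have d_hol (i : bidx E) x : bdom i x -> hol_at (d i) x.
  move=> ix; exact: (hom_matrix_hol X_surface hdet delta_hol (i := tt) 0 0 I ix).
have Q_hol (i j : bidx E) k l x : bdom i (f x) -> bdom j x -> hol_at (fun y => Q i j y k l) x.
  move=> ix jx.
  exact: (hom_matrix_hol X_surface E_hol psi_hol (i := ii i) k l ix jx).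
have QT (i i' j j' : bidx E) x : bdom i (f x) -> bdom i' (f x) -> bdom j x -> bdom j' x ->
    (Q i' j' x)^j = (invmx (btrans i' i (f x)))^T *m (Q i j x)^j *m (btrans j j' x)^j.
  move=> ix i'x jx j'x.
  rewrite /Q (hom_matrix_trans E_hol psi_hol (i := ii i)
    (i' := ii i') ix i'x jx j'x).
  rewrite !map_mxM; exact: (congr1 (fun M => M *m _ *m _) (mx_conjK _)).
have K_hol := canonical_hol X_surface E_higgs q_simple q_char E_hol.
(* psi is compatible with decomposable values of Phi; all values are of this
   form, because the canonical bundle is a line bundle *)
have QA (i j : bidx E) c c' x : bdom i (f x) -> bdom j x -> cdom c x -> cdom c' (f x) ->
    Q i j x *m hA j c x =
    (conj_jac f c' c x *: ((hA i c' (f x))^j)^T) *m Q i j x.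
  move=> ix jx cx c'x; apply: mulmx_col_inj => a.
  pose v := frame E_hol j x a; have vj : v j = a by exact: frame_id.
  pose u := frame E_hol j x (hA j c x *m a).
  pose y := frame K_hol c x (1%:M).
  have yc : y c 0 0 = 1 by rewrite (frame_id K_hol) ?mxE.
  have Phiv : Phi v = tens u y.
    apply: (fiber_ext (i := (j, c) : bidx (tensor E (canonical_bundle X)))) => //.
    rewrite (higgs_mxE E_hol Phi_hol c v jx) vj tensE yc scale1r.
    by rewrite /u (frame_id E_hol).
  have := psiPhi x v u y Phiv.
  move=> /(congr1 (fun w : fiber (tensor (conj_pull f (dual E))
    (canonical_bundle X)) x => w (ii i, c))).
  have [_ _ ->] := PsiP x i c' c _ (higgs_mxP E_hol Phi_hol ix c'x) cx.
  rewrite tensE yc scale1r.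
  rewrite (hom_matrixE E_hol psi_hol (ii i) u jx) (hom_matrixE E_hol psi_hol (ii i) v jx).
  rewrite vj /u (frame_id E_hol _ jx).
  by rewrite !mulmxA => ->.
pose P (i j : bidx E) x := (d i (f x))^-1 *: (J *m (Q i j x)^j).
exists P; split.
- split=> [i i' j j' x ix i'x jx j'x|i j k l x ix jx].
    rewrite /P (QT i i' j j' x)// !mulmxA (symplectic_inv_tr (btrans_unit i'x ix)).
    rewrite (dT i' i)// -!scalemxAl scalerA -invfM -scalemxAr -scalemxAl.
    by rewrite !mulmxA.
  rewrite (_ : (fun y => _) = fun y => ((d i (f y))^*)^-1 *
      \sum_m (J k m)^* * Q i j y m l); last first.
    apply/funext => y; rewrite mxE rmorphM/= fmorphV mxE rmorph_sum; congr (_ * _).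
    by apply: eq_bigr => m _; rewrite rmorphM/= [_^j _ _]mxE conjCK.
  apply: hol_atM.
    apply: (hol_atV X_surface); first by rewrite conjC_eq0 dn0.
    exact: (hol_at_conj_comp X_surface X_surface f_antihol (d_hol i (f x) ix)).
  by apply: hol_at_sum => m; apply: hol_atM; [exact: hol_at_cst|exact: Q_hol].
- move=> i j c c' x ix jx cx c'x.
  have trA : \tr (hA i c' (f x)) = 0 by exact: (higgs_mx_tr E_higgs).
  have QAj : (Q i j x)^j *m (hA j c x)^j =
      (conj_jac f c' c x)^* *: ((hA i c' (f x))^T *m (Q i j x)^j).
    rewrite -map_mxM (QA i j c c' x)// -scalemxAl map_mxZ map_mxM.
    exact: (congr1 (fun M => _ *: (M *m _)) (mx_conj_trK _)).
  have IN : J *m (Q i j x)^j *m (hA j c x)^j =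
      - ((conj_jac f c' c x)^* *: (hA i c' (f x) *m J *m (Q i j x)^j)).
    by rewrite -mulmxA QAj -scalemxAr mulmxA (symplectic_tr trA) mulNmx scalerN.
  rewrite /P -scalemxAl IN -scalemxAr mulmxA scaleNr !scalerN opprK !scalerA.
  congr (_ *: _); rewrite mulrAC.
  by rewrite (conj_jac_inv X_surface f_antihol f_invol cx c'x) mul1r.
- move=> i j x a ix jx.
  rewrite /P -scalemxAl => /eqP; rewrite scaler_eq0 invr_eq0 (negbTE (dn0 _ _ ix)) /=.
  rewrite -mulmxA => /eqP/symplectic_inj Qa.
  have : Q i j x *m a^j = 0.
    have := congr1 (map_mx Num.conj) Qa; rewrite map_mxM map_mx0 => {}Qa.
    rewrite -[RHS]Qa; exact: (congr1 (fun M => M *m _) (esym (mx_conjK _))).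
  move=> /(hom_matrix_inj psi_hol (hol_iso_inj psi_iso (x := x)) ix jx) aj.
  by rewrite -(mx_conjK a) aj map_mx0.
Qed.

End FixedHiggs.

(** * The real structure on the Higgs bundle *)

Section HiggsRealStructure.
Variables (R : realType) (X : surface R) (E : bundle X 2) (Phi : higgs_field E)
  (f : X -> X).
Hypotheses (X_surface : riemann_surface X) (X_compact : compact [set: X])
  (X_connected : connected [set: X]) (E_higgs : SL2_higgs_bundle Phi)
  (f_antihol : antihol_map f) (f_invol : forall x, f (f x) = x).
Variable q : sec (quadratic X).
Hypotheses (q_hol : hol_sec setT q) (q_simple : simple_zeros q)
  (q_char : higgs_char Phi q).
Hypothesis E_hol : hol_bundle E.
Local Notation C := (cplx R).
Local Notation "A ^j" := (map_mx Num.conj A) (at level 2).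
Local Notation hA := (higgs_mx Phi E_hol).

Variable P : bidx E -> bidx E -> X -> 'M[C]_2.
Hypothesis PP : anti_cocycle f P.

(** The relation phi o Phi = - Phi o phi between P and the Higgs field, in frames
    and charts; conj_jac expresses the action of f on forms. *)
Definition anticommutes (P : bidx E -> bidx E -> X -> 'M[C]_2) : Prop :=
  forall i j c c' x, bdom i (f x) -> bdom j x -> cdom c x -> cdom c' (f x) ->
    hA i c' (f x) *m P i j x =
    - conj_jac f c c' (f x) *: (P i j x *m (hA j c x)^j).

Hypothesis P_higgs : anticommutes P.
Hypothesis P_inj : forall i j x (a : 'cV[C]_2), bdom i (f x) -> bdom j x ->
  P i j x *m a = 0 -> a = 0.

(** The two signs cancel, and so do the two Jacobians of f. *)
Lemma anti_square_commutes i j c x : bdom i x -> bdom j (f x) -> cdom c x ->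
  hA i c x *m anti_square f P i j x = anti_square f P i j x *m hA i c x.
Proof.
move=> ix jx cx; have [c' c'x] := chart_exists X_surface (f x).
have h1 := P_higgs (i := i) (j := j) (c := c') (c' := c) (x := f x).
rewrite f_invol in h1; have {}h1 := h1 ix jx c'x cx.
have h2 := congr1 (map_mx Num.conj) (P_higgs jx ix cx c'x).
rewrite map_mxM map_mxZ map_mxM in h2.
have h3 : (hA j c' (f x))^j *m (P j i x)^j =
    - (conj_jac f c c' (f x))^* *: ((P j i x)^j *m hA i c x).
  rewrite [LHS]h2 rmorphN; congr (_ *: _).
  exact: (congr1 (fun M => _ *m M) (mx_conjK _)).
have jj := congr1 Num.conj (conj_jac_inv X_surface f_antihol f_invol cx c'x).
rewrite rmorphM rmorph1/= conjCK in jj.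
rewrite /anti_square mulmxA h1 -scalemxAl -mulmxA h3 -scalemxAr scalerA.
by rewrite mulNr mulrN opprK mulrC jj scale1r mulmxA.
Qed.

Lemma kernel_vector (A : 'M[C]_2) : A != 0 -> A *m A = 0 ->
  exists2 v : 'cV_2, v != 0 & A *m v = 0.
Proof.
move=> An0 AA; have [l vl] : exists l, col l A != 0.
  apply: contrapT => H; move/negP: An0; apply; apply/eqP/matrixP => k l.
  have /eqP/matrixP/(_ k 0) : col l A == 0.
    by apply: contrapT => /negP ?; apply: H; exists l.
  by rewrite !mxE.
exists (col l A) => //; rewrite colE mulmxA AA mul0mx//.
Qed.

Lemma trace_sqr_scalar_add (A : 'M[C]_2) (a b : C) : \tr A = 0 ->
  \tr ((a%:M + b *: A) *m (a%:M + b *: A)) = 2 * a ^+ 2 - 2 * b ^+ 2 * \det A.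
Proof.
move=> trA; rewrite mulmxDl !mulmxDr -!scalemxAl -!scalemxAr (traceless_sqr trA).
rewrite mul_scalar_mx !mul_mx_scalar mul_scalar_mx !mxtraceD !mxtraceZ trA !mxtrace_scalar.
by rewrite !mulr0 -[_ *+ 2]mulr_natl -[(- \det A) *+ 2]mulr_natl; ring.
Qed.

(** At a simple zero q is z - z0 times a function close to its nonzero
    derivative. *)
Lemma isolated_zero c x : cdom c x -> q x = 0 ->
  \forall z \near cfwd c x, z != cfwd c x -> q (cbwd c z) (c, c) 0 0 != 0.
Proof.
move=> cx qx.
have [/(_ c cx)/derivableP_slope] := hol_sec_at (i := (c, c) : bidx (quadratic X))
  0 q_hol I (conj cx cx).
have := q_simple cx qx; set d := derive1 _ _ => d0 [g [Qg g0 gc]].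
have g0' : g @ cfwd c x --> d by rewrite -g0.
have gn := cvgr_neq0 _ g0' d0.
near=> z; move=> zx; have gz : g z != 0 by near: z; exact: gn.
rewrite (Qg z) (chartK X_surface cx) qx coords0 mxE add0r.
by rewrite mulf_neq0// subr_eq0.
Unshelve. all: by end_near. Qed.

(** The square B commutes with the Higgs field A, so B = a + b A.  The traces of
    B and of its square are constant, and at x0, where A is nilpotent, they are
    2 a and 2 a^2; hence b^2 det A = 0 everywhere, and B = a off the zeros of q,
    which are isolated.  As P preserves the kernel of A at x0, it acts on that
    line by some lam up to conjugation, and a = |lam|^2. *)
Lemma anti_square_positive x0 : q x0 = 0 -> f x0 = x0 ->
  exists2 a : C, 0 < a & forall i j x, bdom i x -> bdom j (f x) ->
    anti_square f P i j x = a%:M.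
Proof.
move=> qx0 fx0.
have Phi_hol : hol_hom Phi by case: E_higgs.
have ix0 := some_indexP E_hol x0; set i0 := some_index _ _ in ix0.
have ifx0 : bdom i0 (f x0) by rewrite fx0.
have [c0 cx0] := chart_exists X_surface x0.
have cfx0 : cdom c0 (f x0) by rewrite fx0.
pose A0 := hA i0 c0 x0.
have A0n0 : A0 != 0 by exact: (higgs_mx_neq0 X_surface E_higgs q_simple q_char).
have trA0 : \tr A0 = 0 by exact: (higgs_mx_tr E_higgs).
have detA0 : \det A0 = 0.
  apply: oppr_inj; rewrite -(higgs_mx_det E_higgs q_char E_hol ix0 cx0) qx0.
  by rewrite coords0 mxE oppr0.
have A0A0 : A0 *m A0 = 0 by rewrite traceless_sqr// detA0 oppr0 raddf0.
have [v vn0 Av] := kernel_vector A0n0 A0A0.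
pose P0 := P i0 i0 x0.
have Au : A0 *m (P0 *m v^j) = 0.
  have := P_higgs ifx0 ix0 cx0 cfx0; rewrite fx0 -/A0 -/P0 => H.
  rewrite mulmxA H -scalemxAl -mulmxA -map_mxM Av map_mx0 mulmx0 scaler0//.
have [lam ulam] : exists lam, P0 *m v^j = lam *: v.
  have trT : \tr A0^T = 0 by rewrite mxtrace_tr.
  have AT0 : A0^T != 0 by rewrite trmx_eq0.
  have vT0 : v^T != 0 by rewrite trmx_eq0.
  have vT : v^T *m A0^T = 0 *: v^T by rewrite -trmx_mul Av trmx0 scale0r.
  have uT : (P0 *m v^j)^T *m A0^T = 0 *: (P0 *m v^j)^T.
    by rewrite -trmx_mul Au trmx0 scale0r.
  have [m um] := left_eigenline trT AT0 vT0 vT uT.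
  by exists m; apply: trmx_inj; rewrite um linearZ.
have lam0 : lam != 0.
  apply/eqP => l0; move/eqP: vn0; apply.
  have : P0 *m v^j = 0 by rewrite ulam l0 scale0r.
  move/(P_inj ifx0 ix0) => vj0; rewrite -(mx_conjK v) vj0 map_mx0//.
pose a := `|lam| ^+ 2.
have a0 : 0 < a by rewrite exprn_gt0// normr_gt0.
pose B0 := anti_square f P i0 i0 x0.
have B0v : B0 *m v = a *: v.
  have Pv : P0^j *m v = lam^* *: v^j.
    have := congr1 (map_mx Num.conj) ulam; rewrite map_mxM map_mxZ => <-.
    exact: (congr1 (fun M => _ *m M) (esym (mx_conjK _))).
  rewrite /B0 /anti_square fx0 -/P0 -mulmxA Pv -scalemxAr ulam scalerA.
  by rewrite /a normCK mulrC.
have decomp t i j c x : bdom i x -> bdom j (f x) -> cdom c x ->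
    \tr (anti_square f P i j x) = 2 * t ->
    exists b, anti_square f P i j x = t%:M + b *: hA i c x.
  move=> ix jx cx trB.
  have trA : \tr (hA i c x) = 0 by exact: (higgs_mx_tr E_higgs).
  have An0 : hA i c x != 0 by exact: (higgs_mx_neq0 X_surface E_higgs q_simple q_char).
  have trN : \tr (anti_square f P i j x - t%:M) = 0.
    by rewrite raddfB/= trB mxtrace_scalar -[t *+ 2]mulr_natl subrr.
  have AN : hA i c x *m (anti_square f P i j x - t%:M) =
      (anti_square f P i j x - t%:M) *m hA i c x.
    by rewrite mulmxBr mulmxBl (anti_square_commutes ix jx cx) mul_mx_scalar mul_scalar_mx.
  have [b bE] := commuting_traceless trA trN An0 AN.
  by exists b; rewrite -bE addrC subrK.
have two0 : (2 : C) != 0 by rewrite pnatr_eq0.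
have trB0 : \tr B0 = 2 * a.
  have tr2 : \tr (anti_square f P i0 i0 x0) = 2 * (\tr B0 / 2).
    by rewrite mulrC divfK.
  have [b B0E] := decomp (\tr B0 / 2) i0 i0 c0 x0 ix0 ifx0 cx0 tr2.
  have : B0 *m v = (\tr B0 / 2) *: v.
    by rewrite {1}/B0 B0E mulmxDl mul_scalar_mx -scalemxAl -/A0 Av scaler0 addr0.
  rewrite B0v => /eqP; rewrite -subr_eq0 -scalerBl scaler_eq0 (negbTE vn0) orbF.
  by rewrite subr_eq0 => /eqP ->; rewrite mulrC divfK.
have trB0B0 : \tr (B0 *m B0) = 2 * a ^+ 2.
  have [b B0E] := decomp a i0 i0 c0 x0 ix0 ifx0 cx0 trB0.
  by rewrite /B0 B0E trace_sqr_scalar_add// -/A0 detA0 mulr0 subr0.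
have off_zeros i j c x : bdom i x -> bdom j (f x) -> cdom c x ->
    q x (c, c) 0 0 != 0 -> anti_square f P i j x = a%:M.
  move=> ix jx cx qx.
  have tr1 : \tr (anti_square f P i j x) = 2 * a.
    rewrite -trB0; exact: (anti_square_trace X_surface X_compact X_connected
      E_hol f_antihol f_invol PP ix ix0 jx ifx0).
  have tr2 : \tr (anti_square f P i j x *m anti_square f P i j x) = 2 * a ^+ 2.
    rewrite -trB0B0; exact: (anti_square_trace2 X_surface X_compact X_connected
      E_hol f_antihol f_invol PP ix ix0 jx ifx0).
  have [b BE] := decomp a i j c x ix jx cx tr1.
  have trA : \tr (hA i c x) = 0 by exact: (higgs_mx_tr E_higgs).
  move: tr2; rewrite BE trace_sqr_scalar_add// => /eqP.
  rewrite -[eqbRHS]subr0 (inj_eq (addrI _)) eqr_opp !mulf_eq0 (negbTE two0) /=.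
  have detA : \det (hA i c x) != 0.
    by move: qx; rewrite (higgs_mx_det E_higgs q_char E_hol ix cx) oppr_eq0.
  by rewrite (negbTE detA) orbF orbb => /eqP ->; rewrite scale0r addr0.
exists a => // i j x ix jx.
have [c cx] := chart_exists X_surface x.
(* at a zero of q the value follows by continuity *)
have [qx0'|qx] := eqVneq (q x (c, c) 0 0) 0; last exact: (off_zeros i j c x).
have qx := q_eq0 cx qx0'.
apply/matrixP => k l.
pose H z := anti_square f P i j (cbwd c z) k l.
have Hc : H @ cfwd c x --> H (cfwd c x).
  have [/(_ c cx)/derivableP_slope/slope_continuous] :=
    anti_square_hol X_surface f_antihol f_invol PP k l ix jx.
  exact.
have He : \forall z \near (cfwd c x)^', H z = a%:M k l.
  have fc : continuous f by case: f_antihol.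
  have n1 : \forall z \near cfwd c x, cdom c (cbwd c z).
    exact: (cbwd_cvg X_surface cx (cdom_nbhs X_surface cx)).
  have n2 : \forall z \near cfwd c x, bdom i (cbwd c z).
    exact: (cbwd_cvg X_surface cx (bdom_nbhs E_hol ix)).
  have n3 : \forall z \near cfwd c x, bdom j (f (cbwd c z)).
    exact: (cbwd_cvg X_surface cx (fc x _ (bdom_nbhs E_hol jx))).
  have n4 := isolated_zero cx qx.
  have : \forall z \near cfwd c x, z != cfwd c x -> H z = a%:M k l.
    near=> z; move=> zx; rewrite /H (off_zeros i j c (cbwd c z))//.
    - by near: z.
    - by near: z.
    - by near: z.
    - by move: zx; near: z.
  exact.
have Hx : H (cfwd c x) = anti_square f P i j x k l by rewrite /H (chartK X_surface cx).
rewrite -Hx.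
have l1 : H @ (cfwd c x)^' --> H (cfwd c x) by apply: cvg_within_filter; exact: Hc.
have l2 : H @ (cfwd c x)^' --> (a%:M : 'M[C]_2) k l.
  apply: (@cvg_trans _ ((fun=> (a%:M : 'M[C]_2) k l) @ (cfwd c x)^')); last exact: cvg_cst.
  by apply: near_eq_cvg; apply: filterS He => z ->.
exact: (cvg_unique _ l1 l2).
Unshelve. all: by end_near. Qed.

End HiggsRealStructure.

Section HiggsInvolution.
Variables (R : realType) (X : surface R) (E : bundle X 2) (Phi : higgs_field E)
  (f : X -> X).
Hypotheses (X_surface : riemann_surface X) (f_antihol : antihol_map f)
  (f_invol : forall x, f (f x) = x) (E_hol : hol_bundle E) (Phi_hol : hol_hom Phi)
  (K_hol : hol_bundle (canonical_bundle X)).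
Local Notation C := (cplx R).
Local Notation "A ^j" := (map_mx Num.conj A) (at level 2).
Variable P : bidx E -> bidx E -> X -> 'M[C]_2.
Hypotheses (PP : anti_cocycle f P) (P_higgs : anticommutes Phi f E_hol P).
Local Notation phi := (anti_map f E_hol P).

(** Over a point every form-valued vector is decomposable, with a chosen dz as
    second factor; this determines the extension of phi to forms. *)
Lemma higgs_anti_map : exists phiK : forall x : X,
    fiber (tensor E (canonical_bundle X)) x ->
    fiber (tensor E (canonical_bundle X)) (f x),
  extends_to_forms phi phiK /\
  forall x (v : fiber E x), Phi (phi v) = phiK x (- Phi v).
Proof.
pose ch x : chart X := some_index K_hol x.
have chP x : cdom (ch x) x by exact: (some_indexP K_hol x).
pose id x := some_index E_hol x.
have idP x : bdom (id x) x by exact: (some_indexP E_hol x).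
pose phiK x (w : fiber (tensor E (canonical_bundle X)) x) :=
  tens (phi (frame E_hol (id x) x (w (id x, ch x))))
    (conj_jac f (ch x) (ch (f x)) (f x) *: frame K_hol (ch (f x)) (f x) 1%:M).
have yE x : (conj_jac f (ch x) (ch (f x)) (f x) *:
    frame K_hol (ch (f x)) (f x) 1%:M) (ch (f x)) 0 0 =
    conj_jac f (ch x) (ch (f x)) (f x).
  by rewrite coordsZ (frame_id K_hol _ (chP (f x))) !mxE mulr1.
exists phiK; split.
- move=> x u y y' [_ /(_ (ch x) (ch (f x)) (chP x) (chP (f x)))/= y'E].
  apply: (fiber_ext (i := (id (f x), ch (f x)) : bidx (tensor E (canonical_bundle X)))).
    by split; [exact: idP|exact: chP].
  rewrite /phiK !tensE yE y'E.
  rewrite !(anti_mapE E_hol PP _ (idP (f x)) (idP x)) (frame_id E_hol _ (idP x)).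
  by rewrite map_mxZ -scalemxAr scalerA mulrC.
- move=> x v.
  apply: (fiber_ext (i := (id (f x), ch (f x)) : bidx (tensor E (canonical_bundle X)))).
    by split; [exact: idP|exact: chP].
  rewrite (higgs_mxE E_hol Phi_hol _ _ (idP (f x))) /phiK tensE yE.
  rewrite !(anti_mapE E_hol PP _ (idP (f x)) (idP x)) (frame_id E_hol _ (idP x)).
  rewrite coordsN (higgs_mxE E_hol Phi_hol _ _ (idP x)).
  rewrite mulmxA (P_higgs (idP (f x)) (idP x) (chP x) (chP (f x))).
  by rewrite map_mxN mulmxN scalerN scaleNr mulNmx -scalemxAl map_mxM mulmxA.
Qed.

End HiggsInvolution.

(** * The involution of the spectral curve *)

Section JacobianHolomorphic.
Variables (R : realType) (X : surface R) (E : bundle X 2) (Phi : higgs_field E)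
  (f : X -> X).
Hypotheses (X_surface : riemann_surface X) (f_antihol : antihol_map f)
  (E_hol : hol_bundle E) (Phi_hol : hol_hom Phi).
Local Notation C := (cplx R).
Local Notation "A ^j" := (map_mx Num.conj A) (at level 2).
Local Notation hA := (higgs_mx Phi E_hol).
Hypothesis hA_neq0 : forall i c x, bdom i x -> cdom c x -> hA i c x != 0.
Variable P : bidx E -> bidx E -> X -> 'M[C]_2.
Hypotheses (PP : anti_cocycle f P) (P_higgs : anticommutes Phi f E_hol P).
Hypothesis P_inj : forall i j x (a : 'cV[C]_2), bdom i (f x) -> bdom j x ->
  P i j x *m a = 0 -> a = 0.

(** The anticommutation relation expresses the Jacobian of f as a ratio of
    coefficients of P and of the Higgs field, the denominator being nonzero since
    P is injective and the Higgs field vanishes nowhere. *)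
Lemma conj_jac_hol (c c' : chart X) x : cdom c x -> cdom c' (f x) ->
  hol_at (fun y => (conj_jac f c c' (f y))^*) x.
Proof.
move=> cx c'x.
have jx := some_indexP E_hol x; set j := some_index _ _ in jx.
have ix := some_indexP E_hol (f x); set i := some_index _ _ in ix.
pose W y := P i j y *m (hA j c y)^j.
have Wn0 : W x != 0.
  apply/eqP => W0; move/eqP: (hA_neq0 jx cx); apply.
  rewrite -(mx_conjK (hA j c x)) (_ : (hA j c x)^j = 0) ?map_mx0//.
  apply: mulmx_col_inj => a; rewrite mul0mx; apply: (P_inj ix jx).
  by rewrite mulmxA -/(W x) W0 mul0mx.
have [k [l Wkl]] : exists k l, W x k l != 0.
  apply: contrapT => H; move/negP: Wn0; apply.
  apply/eqP/matrixP => k l; rewrite [RHS]mxE; apply/eqP.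
  by apply: contrapT => /negP ?; apply: H; exists k, l.
have W_hol : hol_at (fun y => (W y k l)^*) x.
  rewrite (_ : (fun y => _) = fun y => \sum_m (P i j y k m)^* * hA j c y m l).
    apply: hol_at_sum => m; apply: hol_atM; first exact: PP.2.
    exact: (higgs_mx_hol X_surface E_hol Phi_hol m l jx cx).
  apply/funext => y; rewrite mxE rmorph_sum; apply: eq_bigr => m _.
  by rewrite rmorphM/= [_^j _ _]mxE conjCK.
have V_hol : hol_at (fun y => ((hA i c' (f y) *m P i j y) k l)^*) x.
  rewrite (_ : (fun y => _) = fun y => \sum_m (hA i c' (f y) k m)^* * (P i j y m l)^*).
    apply: hol_at_sum => m; apply: hol_atM; last exact: PP.2.
    exact: (hol_at_conj_comp X_surface X_surface f_antihol
      (higgs_mx_hol X_surface E_hol Phi_hol k m ix c'x)).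
  by apply/funext => y; rewrite mxE rmorph_sum; apply: eq_bigr => m _; rewrite rmorphM.
have Wc0 : (W x k l)^* != 0 by rewrite conjC_eq0.
have Wc := hol_at_continuous X_surface W_hol.
apply: (hol_at_near X_surface (h := fun y =>
  - (((hA i c' (f y) *m P i j y) k l)^* * ((W y k l)^*)^-1))); last first.
  exact: (hol_atN (hol_atM V_hol (hol_atV X_surface Wc0 W_hol))).
have fc : continuous f by case: f_antihol.
near=> y.
have iy : bdom i (f y) by near: y; exact: (fc x _ (bdom_nbhs E_hol ix)).
have jy : bdom j y by near: y; exact: (bdom_nbhs E_hol jx).
have cy : cdom c y by near: y; exact: (cdom_nbhs X_surface cx).
have c'y : cdom c' (f y) by near: y; exact: (fc x _ (cdom_nbhs X_surface c'x)).
have Wy : (W y k l)^* != 0 by near: y; exact: (cvgr_neq0 _ Wc Wc0).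
have -> : (hA i c' (f y) *m P i j y) k l = - conj_jac f c c' (f y) * W y k l.
  by rewrite (P_higgs iy jy cy c'y) [LHS]mxE.
by rewrite mulNr rmorphN rmorphM/= mulNr opprK mulfK.
Unshelve. all: by end_near. Qed.

End JacobianHolomorphic.

Section SpectralInvolution.
Variables (R : realType) (X S : surface R) (f : X -> X) (p : S -> X)
  (eta : forall s, fiber (canonical_bundle X) (p s)) (q : sec (quadratic X)).
Hypotheses (X_surface : riemann_surface X) (S_surface : riemann_surface S)
  (K_hol : hol_bundle (canonical_bundle X))
  (f_antihol : antihol_map f) (f_invol : forall x, f (f x) = x)
  (S_spectral : spectral_curve eta q).
Variables (sigma ftil : S -> S).
Hypotheses (sigma_exchange : sheet_exchange eta sigma)
  (ftil_lift : spectral_lift eta f ftil).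
Hypothesis jac_hol : forall (c c' : chart X) x, cdom c x -> cdom c' (f x) ->
  hol_at (fun y => (conj_jac f c c' (f y))^*) x.
Local Notation C := (cplx R).
Local Notation tau := (fun s => ftil (sigma s)).

Lemma spectral_ext s s' (c : chart X) : p s = p s' -> cdom c (p s') ->
  eta s c = eta s' c -> s = s'.
Proof.
move=> pss cs ess; case: S_spectral => inj _ _ _ _; apply: inj.
exact: (@total_space_ext _ _ _ _ (spectral_point eta s) (spectral_point eta s') c pss cs ess).
Qed.

Lemma p_hol : hol_map p.
Proof. by case: S_spectral => _ _ []. Qed.

Lemma eta_hol (c : chart X) s : cdom c (p s) -> hol_at (fun t => eta t c 0 0) s.
Proof.
by move=> cs; case: S_spectral => _ _ [_ /(_ c)/hol_funP H] _ _; exact: H.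
Qed.

Lemma eta_sqr (c : chart X) s : eta s c 0 0 ^+ 2 = q (p s) (c, c) 0 0.
Proof.
have : [set v | tens (tagged v) (tagged v) = q (tag v)] (spectral_point eta s).
  by case: S_spectral => _ <- _ _ _; exists s.
by rewrite /= => <-; rewrite tensE mxE expr2.
Qed.

Lemma p_sigma s : p (sigma s) = p s.
Proof. exact: (congr1 (fun v => tag v) (sigma_exchange s)). Qed.

Lemma eta_sigma (c : chart X) s : eta (sigma s) c 0 0 = - eta s c 0 0.
Proof.
have e : (- eta s) c 0 0 = - eta s c 0 0 by rewrite coordsN mxE.
rewrite -e; exact: (congr1 (fun v : total_space (canonical_bundle X) =>
  tagged v c 0 0) (sigma_exchange s)).
Qed.

Lemma p_tau s : p (tau s) = f (p s).
Proof. by rewrite -(p_sigma s); have [H _] := ftil_lift (sigma s); exact: H. Qed.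

Lemma eta_tau (c c' : chart X) s : cdom c (p s) -> cdom c' (f (p s)) ->
  eta (tau s) c' 0 0 = - ((eta s c 0 0)^* * conj_jac f c c' (f (p s))).
Proof.
move=> cs c's; have [_ H] := ftil_lift (sigma s).
have c1 : cdom c (p (sigma s)) by rewrite p_sigma.
have c2 : cdom c' (p (tau s)) by rewrite p_tau.
have E : eta (tau s) c' 0 0 =
    (eta (sigma s) c 0 0)^* * conj_jac f c c' (p (tau s)) := H c c' c1 c2.
by rewrite E eta_sigma p_tau rmorphN mulNr.
Qed.

Lemma tau_invol s : tau (tau s) = s.
Proof.
have [c cs] := chart_exists X_surface (p s).
have [c' c's] := chart_exists X_surface (f (p s)).
have pE : p (tau (tau s)) = p s by rewrite p_tau p_tau f_invol.
apply: (spectral_ext pE cs); apply/matrixP => k l; rewrite !ord1.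
have cs' : cdom c (f (p (tau s))) by rewrite p_tau f_invol.
have c's' : cdom c' (p (tau s)) by rewrite p_tau.
rewrite (eta_tau c's' cs') (eta_tau cs c's) p_tau f_invol.
rewrite rmorphN rmorphM/= conjCK mulNr opprK -mulrA.
have := conj_jac_inv X_surface f_antihol f_invol cs c's.
move=> /(congr1 Num.conj); rewrite rmorphM rmorph1/= conjCK => ->.
by rewrite mulr1.
Qed.

Lemma tau_chart_hol (c' : chart X) s : cdom c' (f (p s)) ->
  hol_at (fun t => (cfwd c' (p (tau t)))^*) s.
Proof.
move=> c's.
rewrite (_ : (fun t => _) = (fun x => (cfwd c' (f x))^*) \o p).
  apply: (hol_at_comp S_surface X_surface p_hol).
  by case: f_antihol => _ /(_ c')/hol_funP; apply.
by apply/funext => t; rewrite p_tau.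
Qed.

(** Together with tau_chart_hol, this makes tau antiholomorphic in the ambient
    coordinates (z, eta) of the total space of K. *)
Lemma tau_eta_hol (c' : chart X) s : cdom c' (f (p s)) ->
  hol_at (fun t => (eta (tau t) c' 0 0)^*) s.
Proof.
move=> c's; have [c cs] := chart_exists X_surface (p s).
apply: (hol_at_near S_surface
  (h := fun t => - (eta t c 0 0 * (conj_jac f c c' (f (p t)))^*))).
  have pc : continuous p by case: p_hol.
  have fc : continuous f by case: f_antihol.
  near=> t.
  have ct : cdom c (p t) by near: t; exact: (pc s _ (cdom_nbhs X_surface cs)).
  have c't : cdom c' (f (p t)).
    by near: t; exact: (pc s _ (fc (p s) _ (cdom_nbhs X_surface c's))).
  by rewrite (eta_tau ct c't) rmorphN rmorphM/= conjCK.
apply: hol_atN; apply: hol_atM; first exact: eta_hol.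
exact: (hol_at_comp S_surface X_surface p_hol (jac_hol cs c's)).
Unshelve. all: by end_near. Qed.

(** The topology of S is the one induced by the coordinates (z, eta). *)
Lemma tau_continuous : continuous tau.
Proof.
move=> s A; case: (S_spectral) => _ _ _ top _.
have [c' c's] := chart_exists X_surface (f (p s)).
have c's' : cdom c' (p (tau s)) by rewrite p_tau.
move=> /(top (tau s) c' A c's')[e e0 eA].
have /cvg_dist_ltP/(_ e e0) n1 := hol_at_continuous S_surface (tau_chart_hol c's).
have /cvg_dist_ltP/(_ e e0) n2 := hol_at_continuous S_surface (tau_eta_hol c's).
have pc : continuous p by case: p_hol.
have fc : continuous f by case: f_antihol.
change (\forall t \near s, A (tau t)).
near=> t; apply: eA.
- by rewrite p_tau; near: t; exact: (pc s _ (fc (p s) _ (cdom_nbhs X_surface c's))).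
- by rewrite -norm_conjC rmorphB/= distrC; near: t; exact: n1.
- by rewrite -norm_conjC rmorphB/= distrC; near: t; exact: n2.
Unshelve. all: by end_near. Qed.

(** One of the coordinates z and eta is a local coordinate on S at tau s; implicit
    differentiation transfers the antiholomorphy from it to the charts of S. *)
Lemma tau_antihol : antihol_map tau.
Proof.
split; first exact: tau_continuous.
move=> k; apply/hol_funP => s ks; split=> k0 k0s.
have [c' c's] := chart_exists X_surface (f (p s)).
have c's' : cdom c' (p (tau s)) by rewrite p_tau.
pose W z : C := (cfwd k (tau (cbwd k0 z)))^*.
have Wc : {for cfwd k0 s, continuous W}.
  have h1 := cbwd_cvg S_surface k0s.
  have h2 : (fun z => tau (cbwd k0 z)) @ cfwd k0 s --> tau s.
    exact: (cvg_comp _ _ h1 (@tau_continuous s)).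
  have h3 : (fun z => cfwd k (tau (cbwd k0 z))) @ cfwd k0 s --> cfwd k (tau s).
    exact: (cvg_comp _ _ h2 (cfwd_cvg S_surface ks)).
  rewrite /prop_for /continuous_at /W (chartK S_surface k0s).
  exact: (cvg_comp _ _ h3 (@conj_continuous R _)).
have Wk : W (cfwd k0 s) = (cfwd k (tau s))^* by rewrite /W (chartK S_surface k0s).
have nk : \forall z \near cfwd k0 s, cdom k (tau (cbwd k0 z)).
  exact: (cbwd_cvg S_surface k0s (tau_continuous (cdom_nbhs S_surface ks))).
have conclude (G : S -> C) :
    hol_at G (tau s) -> hol_at (fun t => (G (tau t))^*) s ->
    derive1 (fun z : C => G (cbwd k z) : C) (cfwd k (tau s)) != 0 ->
    derivable (fun z : C => (cfwd k (tau (cbwd k0 z)))^* : C) (cfwd k0 s) 1.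
  move=> [/(_ k ks)/derivableP_slope sG] [/(_ k0 k0s)/derivableP_slope sQ] d0.
  have sP := @slope_conj R (fun z => G (cbwd k z)) (W (cfwd k0 s)) _.
  rewrite Wk conjCK in sP; have {}sP := sP _ sG; rewrite -Wk in sP.
  have dc0 : (derive1 (fun z : C => G (cbwd k z) : C) (cfwd k (tau s)))^* != 0.
    by rewrite conjC_eq0.
  apply: (slope_derivable (slope_inv Wc _ sP dc0 sQ)).
  near=> z; rewrite /W conjCK (chartK S_surface)//.
  by near: z; exact: nk.
case: (S_spectral) => _ _ _ _ /(_ (tau s) c' k c's' ks)[d0|d0].
- have ph : hol_at (fun t => cfwd c' (p t)) (tau s).
    by have [_ /(_ c')/hol_funP H] := p_hol; exact: H.
  exact: (conclude _ ph (tau_chart_hol c's) d0).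
- exact: (conclude _ (eta_hol c's') (tau_eta_hol c's) d0).
Unshelve. all: by end_near. Qed.

End SpectralInvolution.

(** * Evaluation of a direct image *)

Lemma pull_hol (R : realType) (X Y : surface R) (h : X -> Y) r (E : bundle Y r) :
  riemann_surface X -> riemann_surface Y -> hol_map h -> hol_bundle E ->
  hol_bundle (pull h E).
Proof.
move=> hX hY hh hE; have [h1 h2 h3 h4 h5] := hE; split=> /=.
- move=> i; apply: open_comp => //; move=> x _.
  by case: hh => hc _; exact: hc.
- by move=> x; exact: h2.
- move=> i j k l; apply/hol_funP => x [ix jx].
  exact: (hol_at_comp hX hY hh (btrans_hol hE k l ix jx)).
- by move=> i x; exact: h4.
- by move=> i j k x; exact: h5.
Qed.

Lemma conj_pull_hol (R : realType) (X Y : surface R) (h : X -> Y) r (E : bundle Y r) :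
  riemann_surface X -> riemann_surface Y -> antihol_map h -> hol_bundle E ->
  hol_bundle (conj_pull h E).
Proof.
move=> hX hY hh hE; have [h1 h2 h3 h4 h5] := hE; split=> /=.
- move=> i; apply: open_comp => //; move=> x _.
  by case: hh => hc _; exact: hc.
- by move=> x; exact: h2.
- move=> i j k l; apply/hol_funP => x [ix jx].
  have := hol_at_conj_comp hX hY hh (btrans_hol hE k l ix jx).
  by congr hol_at; apply/funext => y; rewrite mxE.
- by move=> i x ix; rewrite h4// map_mx1.
- by move=> i j k x ix jx kx; rewrite (h5 i j k)// map_mxM.
Qed.

Lemma tensor_hol (R : realType) (X : surface R) r (E : bundle X r) (N : bundle X 1) :
  hol_bundle E -> hol_bundle N -> hol_bundle (tensor E N).
Proof.
move=> hE hN; split=> /=.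
- move=> [i i']; apply: openI; first by case: hE.
  by case: hN.
- move=> x; exists (some_index hE x, some_index hN x).
  by split; exact: some_indexP.
- move=> [i i'] [j j'] k l; apply/hol_funP => x [[ix i'x] [jx j'x]] /=.
  rewrite (_ : (fun y => _) = fun y => btrans i' j' y 0 0 * btrans i j y k l).
    exact: (hol_atM (btrans_hol hN 0 0 i'x j'x) (btrans_hol hE k l ix jx)).
  by apply/funext => y; rewrite mxE.
- move=> [i i'] x [/= ix i'x]; rewrite (btrans1 hN i'x) (btrans1 hE ix).
  by rewrite mxE scale1r.
- move=> [i i'] [j j'] [k k'] x [/= ix i'x] [/= jx j'x] [/= kx k'x].
  rewrite -(btransM hE ix jx kx) -(btransM hN i'x j'x k'x).
  by rewrite mxE big_ord1 -scalemxAl -scalemxAr scalerA.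
Qed.

Lemma hol_sec_subset (R : realType) (X : surface R) r (E : bundle X r) (U V : set X)
    (s : sec E) : U `<=` V -> hol_sec V s -> hol_sec U s.
Proof.
move=> UV sV i k; apply/hol_funP => x [Ux ix].
exact: (hol_sec_at k sV (UV _ Ux) ix).
Qed.

Section DirectImage.
Variables (R : realType) (X S : surface R) (p : S -> X)
  (eta : forall s, fiber (canonical_bundle X) (p s)) (q : sec (quadratic X)).
Hypotheses (X_surface : riemann_surface X) (S_surface : riemann_surface S)
  (S_spectral : spectral_curve eta q) (q_hol : hol_sec setT q).
Variables (E : bundle X 2) (M : bundle S 1) (Theta : set X -> sec E -> sec M).
Hypotheses (E_hol : hol_bundle E) (M_hol : hol_bundle M)
  (E_direct_image : direct_image_iso p Theta).
Local Notation C := (cplx R).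

Definition frame_sec (j : bidx E) (a : 'cV[C]_2) : sec E := fun x => frame E_hol j x a.

Lemma frame_sec_hol j a : hol_sec (bdom j) (frame_sec j a).
Proof.
have := hol_sec_frame (U := setT) (E_hol := E_hol) (i := j) (a := fun=> a)
  (fun x k _ _ => hol_at_cst _ x) X_surface.
by rewrite setTI.
Qed.

Arguments frame_sec_hol : clear implicits.

(** The evaluation map from the fibre of E at p t to the fibre of M at t which
    underlies Theta, in the frames j of E and m of M. *)
Definition theta_row (j : bidx E) (m : bidx M) (t : S) : 'rV[C]_2 :=
  \row_k Theta (bdom j) (frame_sec j (delta_mx k 0)) t m 0 0.

(** Linearity over holomorphic functions on X: near p t a section is a combination
    of the frame sections, whose coefficients are pulled out and evaluated. *)
Lemma theta_rowE (U : set X) (s : sec E) (j : bidx E) (m : bidx M) t :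
  open U -> hol_sec U s -> U (p t) -> bdom j (p t) ->
  Theta U s t m 0 0 = (theta_row j m t *m s (p t) j) 0 0.
Proof.
move=> oU sU Upt jpt; case: E_direct_image => _ lin loc _ _.
pose W := U `&` bdom j.
have oj : open (bdom j) by case: E_hol.
have oW : open W by exact: openI.
have WU : W `<=` U by move=> x [].
have Wj : W `<=` bdom j by move=> x [].
have Wpt : W (p t) by [].
pose e k := frame_sec j (delta_mx k 0).
have eW k : hol_sec W (e k) by exact: (hol_sec_subset Wj (frame_sec_hol _ _)).
have sk k : hol_fun W (fun x => s x j k 0).
  by apply/hol_funP => x [Ux jx]; exact: (hol_sec_at k sU Ux jx).
pose z : sec E := fun x => 0.
have zW : hol_sec W z.
  move=> i k; apply/hol_funP => x _.
  rewrite (_ : (fun y => _) = fun=> 0); first exact: hol_at_cst.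
  by apply/funext => y; rewrite /z coords0 mxE.
pose s1 : sec E := fun x => s x j 1 0 *: e 1 x.
have s1W : hol_sec W s1.
  move=> i k; apply/hol_funP => x [Wx ix].
  rewrite (_ : (fun y => _) = fun y => s y j 1 0 * e 1 y i k 0); last first.
    by apply/funext => y; rewrite /s1 coordsZ mxE.
  apply: hol_atM; last exact: (hol_sec_at k (eW 1) Wx ix).
  by have /hol_funP H := sk 1; exact: H.
(* linearity involves two sections at a time, so the sum over the frame is
   built up from the zero section *)
have tz : Theta W z t = 0.
  have h1 : hol_fun W (fun=> 1) by apply/hol_funP => x _; exact: hol_at_cst.
  have hz x : W x -> z x = 1 *: z x + z x by rewrite scale1r /z addr0.
  have := lin W (fun=> 1) z z z oW h1 zW zW hz t Wpt.
  by rewrite scale1r => H; apply: (addrI (Theta W z t)); rewrite addr0 -H.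
have t1 : Theta W s1 t = s (p t) j 1 0 *: Theta W (e 1) t.
  have := lin W (fun x => s x j 1 0) (e 1) z s1 oW (sk 1) (eW 1) zW _ t Wpt.
  by rewrite tz addr0; apply=> x _; rewrite /z addr0.
have t0 : Theta W s t = s (p t) j 0 0 *: Theta W (e 0) t + Theta W s1 t.
  apply: (lin W (fun x => s x j 0 0) (e 0) s1 s oW (sk 0) (eW 0) s1W _ t Wpt).
  move=> x [Ux jx]; apply: (fiber_ext jx).
  rewrite coordsD !coordsZ /e /frame_sec !(frame_id E_hol _ jx).
  have d01 : (0 == 1 :> 'I_2) = false by [].
  have d10 : (1 == 0 :> 'I_2) = false by [].
  apply/matrixP => k l; rewrite ord1 !mxE.
  have [->|->] : k = 0 \/ k = 1.
    by case: k => [[|[|//]] k2]; [left|right]; apply: val_inj.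
    by rewrite eqxx d01 /= mulr1 mulr0 addr0.
  by rewrite eqxx d10 /= mulr1 mulr0 add0r.
have sWU : Theta W s t = Theta U s t.
  exact: (loc U W s s oU oW WU sU (hol_sec_subset WU sU) (fun x _ => erefl) t Wpt).
have eWj k : Theta W (e k) t = Theta (bdom j) (e k) t.
  exact: (loc (bdom j) W (e k) (e k) oj oW Wj (frame_sec_hol _ _) (eW k)
    (fun x _ => erefl) t Wpt).
rewrite -sWU t0 t1 !eWj coordsD !coordsZ.
rewrite mulmx12 [theta_row _ _ _ 0 0]mxE [theta_row _ _ _ 0 1]mxE !mxE.
by rewrite mulrC [X in _ + X = _]mulrC.
Qed.

Lemma theta_row_trans (j j' : bidx E) (m m' : bidx M) t :
  bdom j (p t) -> bdom j' (p t) -> bdom m t -> bdom m' t ->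
  theta_row j' m' t =
  btrans m' m t 0 0 *: (theta_row j m t *m btrans j j' (p t)).
Proof.
move=> jt j't mt m't; apply/matrixP => z k; rewrite ord1 [LHS]mxE.
rewrite (coords_trans _ m't mt) mxE big_ord1 [RHS]mxE; congr (_ * _).
have oj' : open (bdom j') by case: E_hol.
rewrite (theta_rowE _ oj' (frame_sec_hol _ _) j't jt).
by rewrite /frame_sec (frameE E_hol _ j't jt) mulmxA -colE mxE.
Qed.

Lemma theta_row_hol j m k t : bdom j (p t) -> bdom m t ->
  hol_at (fun t => theta_row j m t 0 k) t.
Proof.
move=> jt mt; case: E_direct_image => hol _ _ _ _.
have oj : open (bdom j) by case: E_hol.
have := hol_sec_at 0 (hol _ _ oj (frame_sec_hol j (delta_mx k 0))) jt mt.
by congr hol_at; apply/funext => y; rewrite mxE.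
Qed.

(** The push-forward of eta, fibre by fibre: evaluation at t is a left eigenvector
    of the Higgs field. *)
Lemma theta_row_higgs (Phi : higgs_field E) j m (c : chart X) t :
  hol_hom Phi -> hol_bundle (canonical_bundle X) ->
  higgs_direct_image eta Theta Phi ->
  bdom j (p t) -> bdom m t -> cdom c (p t) ->
  theta_row j m t *m higgs_mx Phi E_hol j c (p t) = eta t c 0 0 *: theta_row j m t.
Proof.
move=> Phi_hol K_hol Phi_di jt mt ct; apply: mulmx_col_inj => a.
have oj : open (bdom j) by case: E_hol.
have oc : open (cdom c) by case: X_surface => _ _ /(_ c)[].
pose U := cdom c `&` bdom j.
have oU : open U by exact: openI.
have Ut : U (p t) by [].
have Uj : U `<=` bdom j by move=> x [].
have Uc : U `<=` cdom c by move=> x [].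
pose s := frame_sec j a.
have sU : hol_sec U s by exact: (hol_sec_subset Uj (frame_sec_hol _ _)).
pose s' : sec E := fun x => frame E_hol j x (higgs_mx Phi E_hol j c x *m a).
have s'U : hol_sec U s'.
  apply: (hol_sec_frame (E_hol := E_hol)
    (a := fun x => higgs_mx Phi E_hol j c x *m a)) => // x k cx jx.
  rewrite (_ : (fun y => _) = fun y => \sum_l higgs_mx Phi E_hol j c y k l * a l 0).
    apply: hol_at_sum => l; apply: hol_atM; last exact: hol_at_cst.
    exact: (higgs_mx_hol X_surface E_hol Phi_hol k l jx cx).
  by apply/funext => y; rewrite mxE.
pose w : sec (canonical_bundle X) := fun x => frame K_hol c x 1%:M.
have wU : hol_sec U w.
  apply: (hol_sec_subset Uc).
  have := hol_sec_frame (U := setT) (E_hol := K_hol) (i := c) (a := fun=> 1%:M)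
    (fun x k _ _ => hol_at_cst _ x) X_surface.
  by rewrite setTI.
have rel x : U x -> Phi x (s x) = tens (s' x) (w x).
  move=> [cx jx]; apply: (fiber_ext (i := (j, c) : bidx (tensor E (canonical_bundle X)))) => //.
  rewrite (higgs_mxE E_hol Phi_hol c _ jx) tensE /s /s' /w /frame_sec.
  by rewrite !(frame_id E_hol _ jx) (frame_id K_hol (i := c) _ cx) mxE scale1r.
have := Phi_di U s s' w oU sU s'U wU rel t Ut.
move=> /(congr1 (fun v : fiber (tensor M (pull p (canonical_bundle X))) t => v (m, c) 0 0)).
rewrite !tensE [LHS]mxE [RHS]mxE.
have -> : pullv (w (p t)) c 0 0 = 1.
  by change (w (p t) c 0 0 = 1); rewrite /w (frame_id K_hol (i := c) _ ct) mxE.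
have -> : pullv (eta t) c 0 0 = eta t c 0 0 by [].
rewrite mul1r (theta_rowE _ oU s'U Ut jt) (theta_rowE _ oU sU Ut jt).
rewrite /s' /s /frame_sec !(frame_id E_hol _ jt) => H.
apply/matrixP => k l; rewrite !ord1 -mulmxA H -scalemxAl [RHS]mxE.
by [].
Qed.

(** A frame of M around t, cut off to zero on the other sheet.  This is holomorphic
    over a small neighbourhood of p t, because q (p s) - q (p t) is the product of
    eta s - eta t and eta s + eta t: one of the two factors has to be small. *)
Lemma sheet_section (i : bidx M) t : bdom i t ->
  exists U, [/\ open U, U (p t) &
    exists m : sec M, hol_sec (p @^-1` U) m /\ m t i 0 0 = 1].
Proof.
move=> it; have [c ct] := chart_exists X_surface (p t).
have [e e0 eA] : exists2 e : C, 0 < e & forall s', cdom c (p s') ->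
    `|cfwd c (p s') - cfwd c (p t)| < e ->
    `|eta s' c 0 0 - eta t c 0 0| < e -> bdom i s'.
  case: S_spectral => _ _ _ /(_ t c (bdom i) ct)[+ _] _; apply.
  exact: (bdom_nbhs M_hol).
pose eta0 := eta t c 0 0.
(* unless eta0 = 0, the discs of radius d around eta0 and - eta0 are disjoint *)
have [d [d0 de deta]] : exists d : C, [/\ 0 < d, d <= e & eta0 = 0 \/ d <= `|eta0|].
  have [->|n0] := eqVneq eta0 0; first by exists e; split=> //; left.
  have [le|le] := real_leP (gtr0_real e0) (normr_real eta0).
    by exists e; split=> //; right.
  by exists `|eta0|; split; [rewrite normr_gt0|exact: ltW|right].
pose Q x : C := q x (c, c) 0 0.
pose V := [set x | [/\ cdom c x, `|cfwd c x - cfwd c (p t)| < e &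
  `|Q x - Q (p t)| < d ^+ 2]].
have Vn : nbhs (p t) V.
  have Qh : hol_at Q (p t).
    exact: (hol_sec_at (i := (c, c) : bidx (quadratic X)) 0 q_hol I (conj ct ct)).
  have d20 : 0 < d ^+ 2 by rewrite exprn_gt0.
  have /cvg_dist_ltP/(_ _ d20) n1 := hol_at_continuous X_surface Qh.
  have /cvg_dist_ltP/(_ _ e0) n2 := cfwd_cvg X_surface ct.
  near=> x; split.
  - by near: x; exact: (cdom_nbhs X_surface ct).
  - by rewrite distrC; near: x; exact: n2.
  - by rewrite distrC; near: x; exact: n1.
pose B s := `|eta s c 0 0 - eta0| < d.
exists V°; split; first exact: open_interior.
  exact: Vn.
exists (fun s => if B s then frame M_hol i s 1%:M else 0); split; last first.
  by rewrite /B subrr normr0 d0 (frame_id M_hol _ it) mxE.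
move=> k l; apply/hol_funP => s [/interior_subset[cs ce qs] ks].
have etac := hol_at_continuous S_surface (eta_hol S_spectral cs).
have [Bs|nBs] := boolP (B s).
  have is_ : bdom i s by apply: eA => //; exact: lt_le_trans de.
  apply: (hol_at_near S_surface (h := fun y => frame M_hol i y 1%:M k l 0)).
    have r0 : 0 < d - `|eta s c 0 0 - eta0| by rewrite subr_gt0.
    have /cvg_dist_ltP/(_ _ r0) n1 := etac.
    near=> y; rewrite (_ : B y)// /B.
    have -> : eta y c 0 0 - eta0 = (eta s c 0 0 - eta0) - (eta s c 0 0 - eta y c 0 0).
      by ring.
    apply: (le_lt_trans (ler_normB _ _)); rewrite addrC -ltrBrDr.
    by near: y; exact: n1.
  have H := hol_sec_frame (U := setT) (E_hol := M_hol) (i := i) (a := fun=> 1%:M)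
    (fun x k _ _ => hol_at_cst _ x) S_surface.
  exact: (hol_sec_at l H (conj I is_) ks).
have ds : d <= `|eta s c 0 0 - eta0|.
  by have := nBs; rewrite /B -real_leNgt ?normr_real ?gtr0_real.
have prod : `|eta s c 0 0 - eta0| * `|eta s c 0 0 + eta0| < d * d.
  rewrite -normrM -subr_sqr /eta0 (eta_sqr S_spectral c s) (eta_sqr S_spectral c t).
  by rewrite -expr2; exact: qs.
have ps : `|eta s c 0 0 + eta0| < d.
  rewrite -(ltr_pM2l d0); apply: le_lt_trans prod.
  by apply: ler_wpM2r.
have [eta00|deta0] := deta.
  by move: ps; rewrite eta00 addr0 => ps; move: nBs; rewrite /B eta00 subr0 ps.
have ds' : d < `|eta s c 0 0 - eta0|.
  have : `|eta0 *+ 2| <= `|eta s c 0 0 + eta0| + `|eta s c 0 0 - eta0|.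
    have -> : eta0 *+ 2 = (eta s c 0 0 + eta0) - (eta s c 0 0 - eta0) by ring.
    exact: ler_normB.
  rewrite normrMn -lerBlDl; apply: lt_le_trans.
  by rewrite ltrBrDl mulr2n; exact: (ltr_leD (lt_le_trans ps deta0) deta0).
apply: (hol_at_near S_surface (h := fun=> 0)); last exact: hol_at_cst.
have r0 : 0 < `|eta s c 0 0 - eta0| - d by rewrite subr_gt0.
have /cvg_dist_ltP/(_ _ r0) n1 := etac.
near=> y; rewrite ifN ?coords0 ?mxE// /B -real_leNgt ?normr_real ?gtr0_real//.
have h1 : `|eta s c 0 0 - eta y c 0 0| < `|eta s c 0 0 - eta0| - d.
  by near: y; exact: n1.
have h2 : `|eta s c 0 0 - eta0| <= `|eta s c 0 0 - eta y c 0 0| + `|eta y c 0 0 - eta0|.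
  have -> : eta s c 0 0 - eta0 = (eta s c 0 0 - eta y c 0 0) + (eta y c 0 0 - eta0) by ring.
  exact: ler_normD.
apply/ltW; rewrite -(ltrD2l `|eta s c 0 0 - eta y c 0 0|).
apply: lt_le_trans h2; by rewrite -ltrBrDr.
Unshelve. all: by end_near. Qed.

(** By surjectivity of Theta the cut-off sections come from E. *)
Lemma theta_row_neq0 j m t : bdom j (p t) -> bdom m t -> theta_row j m t != 0.
Proof.
move=> jt mt; apply/eqP => T0.
have [U [oU Ut [v [vU vt]]]] := sheet_section mt.
case: E_direct_image => _ _ _ _ /(_ U v oU vU)[s sU /(_ t Ut) sv].
have := theta_rowE m oU sU Ut jt; rewrite sv vt T0 mul0mx mxE => /eqP.
by rewrite oner_eq0.
Qed.

End DirectImage.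

(** * The anti-linear map on the line bundle *)

Section LineBundleLift.
Variables (R : realType) (X S : surface R) (f : X -> X) (p : S -> X)
  (eta : forall s, fiber (canonical_bundle X) (p s)) (q : sec (quadratic X)).
Hypotheses (X_surface : riemann_surface X) (S_surface : riemann_surface S)
  (f_antihol : antihol_map f) (f_invol : forall x, f (f x) = x)
  (S_spectral : spectral_curve eta q).
Variables (E : bundle X 2) (Phi : higgs_field E) (Kh : bundle X 1) (L : bundle S 1).
Local Notation M := (tensor L (pull p Kh)).
Variable Theta : set X -> sec E -> sec M.
Hypotheses (E_hol : hol_bundle E) (Kh_hol : hol_bundle Kh) (L_hol : hol_bundle L).
Local Notation C := (cplx R).
Local Notation "A ^j" := (map_mx Num.conj A) (at level 2).
Local Notation hA := (higgs_mx Phi E_hol).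
Local Notation T j b k := (theta_row Theta E_hol j ((b, k) : bidx M)).
Hypotheses (T_trans : forall (j j' : bidx E) (m m' : bidx M) t,
    bdom j (p t) -> bdom j' (p t) -> bdom m t -> bdom m' t ->
    theta_row Theta E_hol j' m' t = btrans m' m t 0 0 *:
      (theta_row Theta E_hol j m t *m btrans j j' (p t)))
  (T_hol : forall (j : bidx E) (m : bidx M) k t, bdom j (p t) -> bdom m t ->
    hol_at (fun t => theta_row Theta E_hol j m t 0 k) t)
  (T_higgs : forall (j : bidx E) (m : bidx M) (c : chart X) t,
    bdom j (p t) -> bdom m t -> cdom c (p t) ->
    theta_row Theta E_hol j m t *m hA j c (p t) =
      eta t c 0 0 *: theta_row Theta E_hol j m t)
  (T_neq0 : forall (j : bidx E) (m : bidx M) t,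
    bdom j (p t) -> bdom m t -> theta_row Theta E_hol j m t != 0).
Hypotheses (hA_tr : forall i c x, bdom i x -> cdom c x -> \tr (hA i c x) = 0)
  (hA_neq0 : forall i c x, bdom i x -> cdom c x -> hA i c x != 0).
Variables (tau : S -> S).
Hypotheses (tau_antihol : antihol_map tau) (tau_invol : forall s, tau (tau s) = s)
  (p_tau : forall s, p (tau s) = f (p s))
  (eta_tau : forall (c c' : chart X) s, cdom c (p s) -> cdom c' (f (p s)) ->
    eta (tau s) c' 0 0 = - ((eta s c 0 0)^* * conj_jac f c c' (f (p s)))).
Variables (P : bidx E -> bidx E -> X -> 'M[C]_2) (Pk : bidx Kh -> bidx Kh -> X -> 'M[C]_1).
Hypotheses (PP : anti_cocycle f P) (PPk : anti_cocycle f Pk)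
  (P_higgs : anticommutes Phi f E_hol P)
  (P_sq : forall i j x, bdom i x -> bdom j (f x) -> P i j (f x) *m (P j i x)^j = 1%:M)
  (Pk_sq : forall i j x, bdom i x -> bdom j (f x) ->
    Pk i j (f x) *m (Pk j i x)^j = 1%:M).

Lemma Pk_sq_entry i j x : bdom i x -> bdom j (f x) ->
  Pk i j (f x) 0 0 * (Pk j i x 0 0)^* = 1.
Proof.
move=> ix jx; have /matrixP/(_ 0 0) := Pk_sq ix jx.
by rewrite mxE big_ord1 !mxE.
Qed.

Lemma Pk_neq0 i j x : bdom i (f x) -> bdom j x -> Pk i j x 0 0 != 0.
Proof.
move=> ix jx; apply/eqP => P0; have := Pk_sq_entry jx ix.
by rewrite P0 conjC0 mulr0 => /eqP; rewrite eq_sym oner_eq0.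
Qed.

(** The anti-linear map P of E covers a map between the fibres at s and tau s of
    the tensor product of L with the pull-back of Kh.  The number m is what
    remains of its coefficient after division by that of Pk, hence the
    coefficient of a map between the fibres of L. *)
Definition lift_coeff (a b : bidx L) (j j' : bidx E) (k k' : bidx Kh) s (m : C) : Prop :=
  T j' a k' (tau s) *m P j' j (p s) = (m * Pk k' k (p s) 0 0) *: (T j b k s)^j.

Definition adapted (a b : bidx L) (j j' : bidx E) (k k' : bidx Kh) s : Prop :=
  [/\ bdom b s, bdom a (tau s), bdom j (p s) & bdom k (p s)] /\
  bdom j' (f (p s)) /\ bdom k' (f (p s)).

Lemma lift_coeff_trans a b j j' k k' a' b' i i' l l' s m :
  adapted a b j j' k k' s -> adapted a' b' i i' l l' s ->
  lift_coeff a b j j' k k' s m ->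
  lift_coeff a' b' i i' l l' s
    (btrans a' a (tau s) 0 0 * m * (btrans b b' s 0 0)^*).
Proof.
move=> [[bs as_ jx kx] [j'x k'x]] [[b's a's ix lx] [i'x l'x]]; rewrite /lift_coeff => H.
have pj' : bdom j' (p (tau s)) by rewrite p_tau.
have pk' : bdom k' (p (tau s)) by rewrite p_tau.
have pi' : bdom i' (p (tau s)) by rewrite p_tau.
have pl' : bdom l' (p (tau s)) by rewrite p_tau.
rewrite (T_trans (m := (a, k') : bidx M) (m' := (a', l') : bidx M)
  pj' pi' (conj as_ pk') (conj a's pl')).
rewrite (T_trans (m := (b, k) : bidx M) (m' := (b', l) : bidx M)
  jx ix (conj bs kx) (conj b's lx)).
rewrite p_tau (PP.1 j' i' j i (p s) j'x i'x jx ix).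
rewrite -scalemxAl -!mulmxA (mulmxA (btrans j' i' _)) (btransM E_hol j'x i'x j'x).
rewrite (btrans1 E_hol j'x) mul1mx (mulmxA (T j' a k' (tau s))) H.
rewrite map_mxZ map_mxM -scalemxAl !scalerA; congr (_ *: _).
rewrite (PPk.1 k' l' k l (p s) k'x l'x kx lx).
rewrite /= p_tau [(_ *: btrans a' a (tau s)) 0 0]mxE [(_ *: btrans b' b s) 0 0]mxE.
rewrite [(_ *m (btrans k l (p s))^j) 0 0]mxE big_ord1.
rewrite [(_ *m Pk k' k (p s)) 0 0]mxE big_ord1 [(btrans k l (p s))^j 0 0]mxE.
have e1 : (btrans k l (p s) 0 0)^* * (btrans l k (p s) 0 0)^* = 1.
  have /matrixP/(_ 0 0) := btransM Kh_hol kx lx kx.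
  rewrite (btrans1 Kh_hol kx) mxE big_ord1 mxE => h.
  by rewrite -rmorphM/= h rmorph1.
have e2 : (btrans b b' s 0 0)^* * (btrans b' b s 0 0)^* = 1.
  have /matrixP/(_ 0 0) := btransM L_hol bs b's bs.
  rewrite (btrans1 L_hol bs) mxE big_ord1 mxE => h.
  by rewrite -rmorphM/= h rmorph1.
rewrite rmorphM/=.
set x1 := (btrans k l _ 0 0)^* in e1 *; set x2 := (btrans l k _ 0 0)^* in e1 *.
set y1 := (btrans b b' s 0 0)^* in e2 *; set y2 := (btrans b' b s 0 0)^* in e2 *.
set u := btrans l' k' _ 0 0; set v := btrans a' a _ 0 0; set w := Pk k' k _ 0 0.
transitivity (u * v * m * w * (x1 * x2) * (y1 * y2)); last by ring.
by rewrite e1 e2 !mulr1; ring.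
Qed.

Lemma lift_coeff_unique a b j j' k k' s m m' : adapted a b j j' k k' s ->
  lift_coeff a b j j' k k' s m -> lift_coeff a b j j' k k' s m' -> m = m'.
Proof.
move=> [[bs as_ jx kx] [j'x k'x]]; rewrite /lift_coeff => -> /eqP.
rewrite -subr_eq0 -scalerBl scaler_eq0 -mulrBl mulf_eq0.
rewrite (negbTE (Pk_neq0 k'x kx)) orbF subr_eq0 => /orP[/eqP//|].
have := T_neq0 (m := (b, k) : bidx M) jx (conj bs kx).
by rewrite map_mx_eq0 => /negbTE ->.
Qed.

(** Both rows are left eigenvectors of the conjugate Higgs field with the same
    eigenvalue: P changes the sign of the Higgs field and tau that of eta.  The
    eigenspace is a line, as the Higgs field is traceless and nonzero. *)
Lemma lift_coeff_exists a b j j' k k' s : adapted a b j j' k k' s ->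
  exists m, lift_coeff a b j j' k k' s m.
Proof.
move=> [[bs as_ jx kx] [j'x k'x]].
have [c cx] := chart_exists X_surface (p s).
have [c' c'x] := chart_exists X_surface (f (p s)).
have pj' : bdom j' (p (tau s)) by rewrite p_tau.
have pk' : bdom k' (p (tau s)) by rewrite p_tau.
have pc' : cdom c' (p (tau s)) by rewrite p_tau.
have Tn0 : (T j b k s)^j != 0.
  by rewrite map_mx_eq0; exact: (T_neq0 (m := (b, k) : bidx M) jx (conj bs kx)).
have An0 : (hA j c (p s))^j != 0 by rewrite map_mx_eq0; exact: hA_neq0.
have trA : \tr (hA j c (p s))^j = 0.
  by rewrite tr22 ![_^j _ _]mxE -rmorphD/= -tr22 hA_tr// conjC0.
have TA : (T j b k s)^j *m (hA j c (p s))^j = (eta s c 0 0)^* *: (T j b k s)^j.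
  by rewrite -map_mxM (T_higgs (m := (b, k) : bidx M) jx (conj bs kx) cx) map_mxZ.
have jj := conj_jac_inv X_surface f_antihol f_invol cx c'x.
set cj := conj_jac f c c' (f (p s)) in jj.
have cj0 : cj != 0.
  by apply/eqP => cj0; move: jj; rewrite cj0 mul0r => /eqP; rewrite eq_sym oner_eq0.
have PA : P j' j (p s) *m (hA j c (p s))^j = - cj^-1 *: (hA j' c' (f (p s)) *m P j' j (p s)).
  by rewrite (P_higgs j'x jx cx c'x) scalerA mulNr mulrN opprK mulVf// scale1r.
have TPA : T j' a k' (tau s) *m P j' j (p s) *m (hA j c (p s))^j =
    (eta s c 0 0)^* *: (T j' a k' (tau s) *m P j' j (p s)).
  rewrite -mulmxA PA -scalemxAr mulmxA.
  have := T_higgs (m := (a, k') : bidx M) pj' (conj as_ pk') pc'.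
  rewrite (eta_tau cx c'x) p_tau => ->; rewrite -/cj -scalemxAl scalerA.
  by rewrite mulrN mulNr opprK mulrCA mulVf// mulr1.
have [m mE] := left_eigenline trA An0 Tn0 TA TPA.
exists (m / Pk k' k (p s) 0 0); rewrite /lift_coeff divfK//.
exact: Pk_neq0.
Qed.

Definition lift_scalar (a b : bidx L) (s : S) : C :=
  get [set m | lift_coeff a b (some_index E_hol (p s)) (some_index E_hol (f (p s)))
    (some_index Kh_hol (p s)) (some_index Kh_hol (f (p s))) s m].

Lemma lift_scalarP a b j j' k k' s : adapted a b j j' k k' s ->
  lift_coeff a b j j' k k' s (lift_scalar a b s).
Proof.
move=> ad; have [[bs as_ jx kx] [j'x k'x]] := ad.
set i := some_index E_hol (p s); set i' := some_index E_hol (f (p s)).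
set l := some_index Kh_hol (p s); set l' := some_index Kh_hol (f (p s)).
have ad' : adapted a b i i' l l' s.
  by split; split=> //; exact: some_indexP.
have /getPex m0 := lift_coeff_exists ad'.
have := lift_coeff_trans ad' ad m0.
by rewrite (btrans1 L_hol as_) (btrans1 L_hol bs) !mxE conjC1 mul1r mulr1.
Qed.

Definition lift_mx (a b : bidx L) (s : S) : 'M[C]_1 := (lift_scalar a b s)%:M.

Lemma adapted_exists a b s : bdom a (tau s) -> bdom b s ->
  adapted a b (some_index E_hol (p s)) (some_index E_hol (f (p s)))
    (some_index Kh_hol (p s)) (some_index Kh_hol (f (p s))) s.
Proof. by move=> as_ bs; split; split=> //; exact: some_indexP. Qed.

Lemma lift_mx_cocycle : anti_cocycle tau lift_mx.
Proof.
split=> [a a' b b' s as_ a's bs b's|a b k0 l0 s as_ bs].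
  have ad := adapted_exists as_ bs; have ad' := adapted_exists a's b's.
  have := lift_coeff_trans ad ad' (lift_scalarP ad).
  move=> /(lift_coeff_unique ad' (lift_scalarP ad')).
  rewrite /lift_mx => ->; apply/matrixP => z z'; rewrite !ord1.
  rewrite [RHS]mxE big_ord1 [(_ *m _%:M) 0 0]mxE big_ord1 [(btrans b b' s)^j 0 0]mxE.
  by rewrite ![(_)%:M 0 0]mxE !mulr1n.
have ad := adapted_exists as_ bs.
set j := some_index E_hol (p s) in ad; set j' := some_index E_hol (f (p s)) in ad.
set k := some_index Kh_hol (p s) in ad; set k' := some_index Kh_hol (f (p s)) in ad.
have [[_ _ jx kx] [j'x k'x]] := ad.
have [n Tn] : exists n, T j b k s 0 n != 0.
  have Tn0 := T_neq0 (m := (b, k) : bidx M) jx (conj bs kx).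
  apply: contrapT => H; move/negP: Tn0; apply; apply/eqP/matrixP => z n.
  by rewrite ord1 [RHS]mxE; apply/eqP; apply: contrapT => /negP ?; apply: H; exists n.
have ph := p_hol S_spectral.
have pj' : bdom j' (p (tau s)) by rewrite p_tau.
have pk' : bdom k' (p (tau s)) by rewrite p_tau.
have T_h : hol_at (fun t => T j b k t 0 n) s.
  exact: (T_hol (m := (b, k) : bidx M) n jx (conj bs kx)).
have Pk_h : hol_at (fun t => (Pk k' k (p t) 0 0)^*) s.
  exact: (hol_at_comp S_surface X_surface ph (PPk.2 k' k 0 0 (p s) k'x kx)).
have TP_h : hol_at (fun t => ((T j' a k' (tau t) *m P j' j (p t)) 0 n)^*) s.
  rewrite (_ : (fun t => _) = fun t =>
    \sum_m (T j' a k' (tau t) 0 m)^* * (P j' j (p t) m n)^*); last first.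
    by apply/funext => t; rewrite mxE rmorph_sum; apply: eq_bigr => m _; rewrite rmorphM.
  apply: hol_at_sum => m; apply: hol_atM.
    exact: (hol_at_conj_comp S_surface S_surface tau_antihol
      (h := fun u => T j' a k' u 0 m)
      (T_hol (m := (a, k') : bidx M) m pj' (conj as_ pk'))).
  exact: (hol_at_comp S_surface X_surface ph (PP.2 j' j m n (p s) j'x jx)).
have Pk0 : (Pk k' k (p s) 0 0)^* != 0 by rewrite conjC_eq0 Pk_neq0.
have D0 : (Pk k' k (p s) 0 0)^* * T j b k s 0 n != 0 by rewrite mulf_neq0.
have Tc := hol_at_continuous S_surface T_h.
apply: (hol_at_near S_surface (h := fun t =>
  ((T j' a k' (tau t) *m P j' j (p t)) 0 n)^* *
  ((Pk k' k (p t) 0 0)^* * T j b k t 0 n)^-1)); last first.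
  exact: (hol_atM TP_h (hol_atV S_surface (h := fun t => (Pk k' k (p t) 0 0)^* * T j b k t 0 n)
    D0 (hol_atM Pk_h T_h))).
have pc : continuous p by case: ph.
have fc : continuous f by case: f_antihol.
have tc : continuous tau by case: tau_antihol.
near=> t.
have bt : bdom b t by near: t; exact: (bdom_nbhs L_hol bs).
have at_ : bdom a (tau t) by near: t; exact: (tc s _ (bdom_nbhs L_hol as_)).
have jt : bdom j (p t) by near: t; exact: (pc s _ (bdom_nbhs E_hol jx)).
have kt : bdom k (p t) by near: t; exact: (pc s _ (bdom_nbhs Kh_hol kx)).
have j't : bdom j' (f (p t)).
  by near: t; exact: (pc s _ (fc (p s) _ (bdom_nbhs E_hol j'x))).
have k't : bdom k' (f (p t)).
  by near: t; exact: (pc s _ (fc (p s) _ (bdom_nbhs Kh_hol k'x))).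
have Tt : T j b k t 0 n != 0 by near: t; exact: (cvgr_neq0 _ Tc Tn).
have adt : adapted a b j j' k k' t by [].
have E1 : (T j' a k' (tau t) *m P j' j (p t)) 0 n =
    lift_scalar a b t * Pk k' k (p t) 0 0 * (T j b k t 0 n)^*.
  rewrite [LHS](congr1 (fun N : 'rV_2 => N 0 n) (lift_scalarP adt)) /=.
  by rewrite [LHS]mxE [X in _ * X]mxE.
rewrite E1 !rmorphM/= conjCK.
have Pkt : (Pk k' k (p t) 0 0)^* != 0 by rewrite conjC_eq0 Pk_neq0.
rewrite /lift_mx !ord1 [_%:M 0 0]mxE mulr1n -[X in X / _]mulrA mulfK//.
exact: mulf_neq0.
Unshelve. all: by end_near. Qed.

(** The squares of P and of Pk being 1, so is that of their quotient. *)
Lemma lift_mx_involutive a b s : bdom a s -> bdom b (tau s) ->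
  lift_mx a b (tau s) *m (lift_mx b a s)^j = 1%:M.
Proof.
move=> as_ bs.
have ad := adapted_exists bs as_.
set j := some_index E_hol (p s) in ad; set j' := some_index E_hol (f (p s)) in ad.
set k := some_index Kh_hol (p s) in ad; set k' := some_index Kh_hol (f (p s)) in ad.
have [[_ _ jx kx] [j'x k'x]] := ad.
have ad' : adapted a b j' j k' k (tau s).
  by rewrite /adapted tau_invol p_tau f_invol; split; split.
have h1 := lift_scalarP ad; have h2 := lift_scalarP ad'.
rewrite /lift_coeff tau_invol p_tau in h2; rewrite /lift_coeff in h1.
have Tn0 := T_neq0 (m := (a, k) : bidx M) jx (conj as_ kx).
have h3 : T j a k s = (lift_scalar a b (tau s) * (lift_scalar b a s)^*) *: T j a k s.
  have := congr1 (fun N => N *m (P j' j (p s))^j) h2.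
  rewrite -mulmxA (P_sq jx j'x) mulmx1 => {1}->.
  rewrite -scalemxAl -map_mxM h1 map_mxZ scalerA rmorphM/=.
  rewrite -[RHS]/((_ * _) *: _); congr (_ *: _); last exact: mx_conjK.
  rewrite mulrACA (Pk_sq_entry kx k'x) mulr1//.
have : lift_scalar a b (tau s) * (lift_scalar b a s)^* = 1.
  move/eqP: h3; rewrite -subr_eq0 -{1}[T j a k s]scale1r -scalerBl scaler_eq0.
  by rewrite (negbTE Tn0) orbF subr_eq0 => /eqP <-.
rewrite /lift_mx map_scalar_mx -scalar_mxM => -> //.
Qed.

End LineBundleLift.

(** * Existence of the real structures *)

Lemma line_anti_cocycle (R : realType) (X : surface R) (N : bundle X 1) (f : X -> X) :
  riemann_surface X -> hol_bundle N -> antihol_map f -> (forall x, f (f x) = x) ->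
  isomorphic (conj_pull f N) N ->
  exists P : bidx N -> bidx N -> X -> 'M[cplx R]_1, anti_cocycle f P /\
    forall i j x, bdom i (f x) -> bdom j x -> P i j x 0 0 != 0.
Proof.
move=> hX hN fa ff [kap kap_iso]; have hcN := conj_pull_hol hX hX fa hN.
have kap_hol := kap_iso.1.
pose jj (j : bidx N) : bidx (conj_pull f N) := j.
pose P (i j : bidx N) x := hom_matrix hcN kap i (jj j) (f x).
have cjx (j : bidx N) x : bdom j x -> bdom (jj j) (f x).
  by move=> jx; rewrite /= ff.
exists P; split.
- split=> [i i' j j' x ix i'x jx j'x|i j k l x ix jx].
    rewrite /P (hom_matrix_trans hcN kap_hol ix i'x (cjx _ _ jx) (cjx _ _ j'x)).
    by rewrite /= ff.
  exact: (hol_at_conj_comp hX hX fa (h := fun y => hom_matrix hcN kap i (jj j) y k l)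
    (hom_matrix_hol hX hcN kap_hol k l ix (cjx _ _ jx))).
- move=> i j x ix jx; apply/eqP => P0.
  have : (1%:M : 'cV[cplx R]_1) = 0.
    apply: (hom_matrix_inj kap_hol (hol_iso_inj kap_iso (x := f x)) ix (cjx _ _ jx)).
    by rewrite mulmx1; apply/matrixP => k l; rewrite !ord1 [RHS]mxE; exact: P0.
  by move/matrixP => /(_ 0 0) /eqP; rewrite !mxE oner_eq0.
Qed.

Theorem proposition41 (R : realType)
  (X : surface R) (X_surface : riemann_surface X)
  (X_compact : compact [set: X]) (X_connected : connected [set: X])
  (g : nat) (X_genus : has_genus X g) (g_ge2 : (2 <= g)%N)
  (f : X -> X) (f_antihol : antihol_map f) (f_invol : forall x, f (f x) = x)
  (E : bundle X 2) (Phi : higgs_field E)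
  (E_higgs : SL2_higgs_bundle Phi) (E_stable : stable_higgs Phi)
  (E_fixed : fixed_higgs f Phi)
  (q : sec (quadratic X)) (q_hol : hol_sec setT q)
  (q_simple : simple_zeros q) (q_real : conj_invariant f q)
  (q_char : higgs_char Phi q)
  (S : surface R) (S_surface : riemann_surface S) (p : S -> X)
  (eta : forall s, fiber (canonical_bundle X) (p s))
  (S_spectral : spectral_curve eta q)
  (sigma : S -> S) (sigma_exchange : sheet_exchange eta sigma)
  (ftil : S -> S) (ftil_lift : spectral_lift eta f ftil)
  (Kh : bundle X 1) (Kh_hol : hol_bundle Kh)
  (Kh_theta : isomorphic (tensor Kh Kh) (canonical_bundle X))
  (Kh_real : isomorphic (conj_pull f Kh) Kh)
  (L : bundle S 1) (L_hol : hol_bundle L)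
  (L_prym : isomorphic (pull sigma L) (dual L))
  (Theta : set X -> sec E -> sec (tensor L (pull p Kh)))
  (E_direct_image : direct_image_iso p Theta)
  (Phi_direct_image : higgs_direct_image eta Theta Phi)
  (q_fixed_zero : exists x : X, q x = 0 /\ f x = x) :
  (exists tautil : forall s : S, fiber L s -> fiber L (ftil (sigma s)),
     antilinear_lift (f := fun s => ftil (sigma s)) tautil /\
     (forall v : total_space L, total_map tautil (total_map tautil v) = v)) /\
  (exists (phi : forall x : X, fiber E x -> fiber E (f x))
     (phiK : forall x : X, fiber (tensor E (canonical_bundle X)) x ->
                           fiber (tensor E (canonical_bundle X)) (f x)),
     [/\ antilinear_lift phi,
         extends_to_forms phi phiK,
         (forall x (v : fiber E x), Phi (f x) (phi x v) = phiK x (- Phi x v)) &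
         forall v : total_space E, total_map phi (total_map phi v) = v]).
Proof.
have [x0 [qx0 fx0]] := q_fixed_zero.
have [E_hol _ Phi_hol _] := E_higgs.
have K_hol := canonical_hol X_surface E_higgs q_simple q_char E_hol.
have [P0 [P0P P0_higgs P0_inj]] :=
  fixed_higgs_lift X_surface E_higgs f_antihol f_invol q_simple q_char E_hol E_fixed.
have [a a0 P0_sq] := anti_square_positive X_surface X_compact X_connected E_higgs
  f_antihol f_invol q_hol q_simple q_char P0P P0_higgs P0_inj qx0 fx0.
have [b b0 P_sq] := anti_cocycle_normalize a0 P0_sq.
pose P i j x := b *: P0 i j x.
have PP : anti_cocycle f P := anti_cocycle_scale P0P b.
have P_higgs : anticommutes Phi f E_hol P.
  move=> i j c c' x ix jx cx c'x.
  rewrite /P -scalemxAr (P0_higgs i j c c' x ix jx cx c'x) -scalemxAl.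
  by rewrite !scalerA mulrC.
split; last first.
  have [phiK [phiK_ext phiK_higgs]] := higgs_anti_map Phi_hol K_hol PP P_higgs.
  exists (anti_map f E_hol P), phiK; split=> //.
    exact: (anti_map_lift X_surface E_hol f_antihol f_invol PP).
  exact: (anti_map_involutive E_hol f_invol PP P_sq).
have [Pk0 [Pk0P Pk0_neq0]] := line_anti_cocycle X_surface Kh_hol f_antihol f_invol Kh_real.
have [Pk [PkP Pk_sq]] := line_real_structure X_surface X_compact X_connected
  Kh_hol f_antihol f_invol Pk0P fx0 (fun i j => @Pk0_neq0 i j x0).
have hA_tr i c x : bdom i x -> cdom c x -> \tr (higgs_mx Phi E_hol i c x) = 0.
  exact: (higgs_mx_tr E_higgs E_hol).
have hA_neq0 i c x : bdom i x -> cdom c x -> higgs_mx Phi E_hol i c x != 0.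
  exact: (higgs_mx_neq0 X_surface E_higgs q_simple q_char E_hol).
have jac_hol (c c' : chart X) x : cdom c x -> cdom c' (f x) ->
    hol_at (fun y => (conj_jac f c c' (f y))^*) x.
  exact: (conj_jac_hol X_surface f_antihol Phi_hol hA_neq0 P0P P0_higgs P0_inj).
have taua := tau_antihol X_surface S_surface f_antihol S_spectral sigma_exchange
  ftil_lift jac_hol.
have taui := tau_invol X_surface f_antihol f_invol S_spectral sigma_exchange ftil_lift.
have ptau := p_tau sigma_exchange ftil_lift.
have etau := eta_tau sigma_exchange ftil_lift.
have M_hol : hol_bundle (tensor L (pull p Kh)).
  apply: (tensor_hol L_hol).
  exact: (pull_hol S_surface X_surface (p_hol S_spectral) Kh_hol).
have T_trans := theta_row_trans X_surface E_hol E_direct_image.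
have T_hol := theta_row_hol X_surface E_hol E_direct_image.
have T_neq0 := theta_row_neq0 X_surface S_surface S_spectral q_hol E_hol M_hol E_direct_image.
have T_higgs j m c t := @theta_row_higgs R X S p eta X_surface E _ Theta E_hol
  E_direct_image Phi j m c t Phi_hol K_hol Phi_direct_image.
have lift_cocycle := lift_mx_cocycle X_surface S_surface f_antihol f_invol S_spectral
  Kh_hol L_hol T_trans T_hol T_higgs T_neq0 hA_tr hA_neq0 taua ptau etau PP PkP P_higgs Pk_sq.
have lift_inv := lift_mx_involutive X_surface f_antihol f_invol
  Kh_hol L_hol T_trans T_higgs T_neq0 hA_tr hA_neq0 taui ptau etau PP PkP P_higgs P_sq Pk_sq.
exists (anti_map (fun s => ftil (sigma s)) L_hol
  (lift_mx f Theta E_hol Kh_hol (fun s => ftil (sigma s)) P Pk)); split.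
  exact: (anti_map_lift S_surface L_hol taua taui lift_cocycle).
exact: (anti_map_involutive L_hol taui lift_cocycle lift_inv).
Qed.
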